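(* Let $\mathcal{I}$ be a set of nonempty strictly increasing multi-indices over $\{1,\dots,n\}$, with corresponding unknowns $u^I$ ($I\in\mathcal{I}$), and let $\bar x\in\mathbb{R}^n$. Let data functions $\bar u^I$ ($I\in\mathcal I$) be given, each $\bar u^I$ being an $\mathbb{R}^{d_I}$-valued function of $x_{I^c}$ defined on a neighborhood of $\bar x_{I^c}$ (a constant if $I^c$ is empty), and let $\bar U:=(\bar u^I(\bar x_{I^c}))_{I\in\mathcal{I}}$. Assume that $$u^I_{x_i}(x)=F^I_i(x;U^I_i(x))\qquad\text{whenever } i\in I\in\mathcal{I} \qquad ( * )$$ is a Darboux system near $(\bar x,\bar U)$. Assume that all functions $F^I_i$ in $( * )$ are $C^2$-smooth near $(\bar x,\bar U)$, and that all data functions $\bar u^I$ are $C^2$-smooth near $\bar x_{I^c}$. Then there is a neighborhood of $\bar x$ on which the system $( * )$ has a unique $C^2$-smooth solution $U=(u^I)_{I\in\mathcal{I}}$ taking on the assigned data $$u^I(x)|_{x_I=\bar x_I}=\bar u^I(x_{I^c})\qquad\text{for each } I\in\mathcal{I}.$$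
   Context: Multi-indices. A strictly increasing multi-index over $\{1,\dots,n\}$ is $I=(i_1,\dots,i_m)$ with $1\le i_1<\dots<i_m\le n$; it is identified with the set of its indices, so $i\in I$ means that $i$ is one of its indices, $I\setminus i$ is $I$ with the index $i$ removed, $I^c$ is the strictly increasing multi-index of the indices in $\{1,\dots,n\}$ not belonging to $I$, and $J\supset K$ means that every index of $K$ belongs to $J$. For $x\in\mathbb{R}^n$, $x_I:=(x_{i_1},\dots,x_{i_m})$, and similarly for $x_{I^c}$. Unknowns. For each $I\in\mathcal{I}$ there is one unknown $u^I=u^I(x)$, which may be vector-valued, with values in $\mathbb{R}^{d_I}$, $d_I\ge1$; $U=(u^I)_{I\in\mathcal{I}}$ denotes the list of all unknowns. The system prescribes exactly the partial derivatives $u^I_{x_i}$ with $i\in I$. For $i\in I\in\mathcal{I}$ define $$\mathcal{I}^I_i:=\{J\in\mathcal{I} : J\supset I\setminus i\},\qquad U^I_i:=\{u^J : J\in\mathcal{I}^I_i\}.$$ Darboux system. A system of equations of the form $$u^I_{x_i}(x)=F^I_i(x;U^I_i(x))\qquad\text{whenever } i\in I\in\mathcal{I},$$ where each given $\mathbb{R}^{d_I}$-valued map $F^I_i$ depends only on $x$ and on the unknowns in $U^I_i$ and is defined on a neighborhood of the given point $(\bar x,\bar U)$, is called a Darboux system near $(\bar x,\bar U)$ if the following integrability conditions hold: whenever $I\in\mathcal{I}$, $i,j\in I$ and $i\ne j$, then $$F^I_{i,x_j}(x;U^I_i)+\sum_{J\in\mathcal{I}^I_i}F^I_{i,u^J}(x;U^I_i)\,F^J_j(x;U^J_j)=F^I_{j,x_i}(x;U^I_j)+\sum_{J\in\mathcal{I}^I_j}F^I_{j,u^J}(x;U^I_j)\,F^J_i(x;U^J_i)$$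 holds as an identity in $(x,U)$, with $x$ and $U$ regarded as independent variables, in a neighborhood of $(\bar x,\bar U)$. Here $F^I_{i,x_j}$ is the partial derivative of $F^I_i$ with respect to $x_j$, and $F^I_{i,u^J}$ is the Jacobian matrix of $F^I_i$ with respect to $u^J$. (In the left sum $j\in I\setminus i\subset J$, so $F^J_j$ is one of the given functions; similarly for the right sum.) The integrability conditions are allowed to be vacuous. A solution on a neighborhood of $\bar x$ is a function $U=(u^I)_{I\in\mathcal I}$ that satisfies the equations and the data conditions at every point of that neighborhood (with $(x,U(x))$ remaining in the region where the $F^I_i$ are defined). *)

(* Defs.v *)
From mathcomp Require Import all_boot all_order all_algebra.
From mathcomp Require Import all_classical all_reals all_analysis.
Set Implicit Arguments.
Unset Strict Implicit.
Unset Printing Implicit Defensive.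
Import Order.TTheory GRing.Theory Num.Theory.
Import numFieldNormedType.Exports.
Local Open Scope classical_set_scope.
Local Open Scope ring_scope.

(* C^k-smoothness on an open set A: all partial derivatives of order at most k
   exist and are continuous on A. *)
Fixpoint smooth_on (R : realType) (m p k : nat) (A : set 'rV[R]_m)
    (f : 'rV[R]_m -> 'rV[R]_p) : Prop :=
  (forall x, A x -> {for x, continuous f}) /\
  if k is k'.+1 then
    forall j : 'I_m,
      (forall x, A x -> derivable f x (delta_mx 0 j)) /\
      smooth_on k' A (fun x => 'D_(delta_mx 0 j) f x)
  else True.

Definition smooth_near (R : realType) (m p k : nat) (a : 'rV[R]_m)
    (f : 'rV[R]_m -> 'rV[R]_p) : Prop :=
  exists2 A : set 'rV[R]_m, open_nbhs a A & smooth_on k A f.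

(* A strictly increasing multi-index over {1, ..., n} is encoded by its set of
   indices.  [enum_val] lists a set of ordinals in increasing order, so this is
   x_I = (x_{i_1}, ..., x_{i_m}). *)
Definition xsub (R : realType) (n : nat) (I : {set 'I_n}) (x : 'rV[R]_n) :
    'rV[R]_#|I| :=
  \row_(k < #|I|) x 0 (enum_val k).

(* A list of unknowns is a family U : forall J, 'rV_(d J) over all multi-indices;
   only the members indexed by the relevant collection of multi-indices matter.
   Below, the subfamily {u^J : J in A} is turned into one vector, whose
   coordinates are indexed by the pairs (J, k) with J in A and k < d J. *)
Definition slot (n : nat) (d : {set 'I_n} -> nat) (A : {set {set 'I_n}}) :
    {set {J : {set 'I_n} & 'I_(d J)}} :=
  [set s : {J : {set 'I_n} & 'I_(d J)} | tag s \in A]%SET.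

Definition pack (R : realType) (n : nat) (d : {set 'I_n} -> nat)
    (A : {set {set 'I_n}}) (U : forall J : {set 'I_n}, 'rV[R]_(d J)) :
    'rV[R]_#|slot d A| :=
  \row_(k < #|slot d A|) let s := enum_val k in U (tag s) 0 (tagged s).

(* The indices of the unknowns on which F^I_i may depend. *)
Definition subI (n : nat) (II : {set {set 'I_n}}) (I : {set 'I_n}) (i : 'I_n) :
    {set {set 'I_n}} :=
  [set J in II | I :\ i \subset J]%SET.

(* The point (x; U^I_i). *)
Definition arg (R : realType) (n : nat) (d : {set 'I_n} -> nat)
    (II : {set {set 'I_n}}) (I : {set 'I_n}) (i : 'I_n)
    (x : 'rV[R]_n) (U : forall J : {set 'I_n}, 'rV[R]_(d J)) :
    'rV[R]_(n + #|slot d (subI II I i)|) :=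
  row_mx x (pack (subI II I i) U).

(* The right-hand sides F^I_i, as functions of (x; U^I_i) only (those with
   i \notin I or I \notin II are never used), and their domains. *)
Definition rhs (R : realType) (n : nat) (d : {set 'I_n} -> nat)
    (II : {set {set 'I_n}}) : Type :=
  forall (I : {set 'I_n}) (i : 'I_n),
    'rV[R]_(n + #|slot d (subI II I i)|) -> 'rV[R]_(d I).

Definition rhs_dom (R : realType) (n : nat) (d : {set 'I_n} -> nat)
    (II : {set {set 'I_n}}) : Type :=
  forall (I : {set 'I_n}) (i : 'I_n), set 'rV[R]_(n + #|slot d (subI II I i)|).

(* F^I_{i,x_j} *)
Definition rhs_dx (R : realType) (n : nat) (d : {set 'I_n} -> nat)
    (II : {set {set 'I_n}}) (F : rhs R d II) (I : {set 'I_n}) (i j : 'I_n)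
    (x : 'rV[R]_n) (U : forall J : {set 'I_n}, 'rV[R]_(d J)) : 'rV[R]_(d I) :=
  'D_(delta_mx 0 j) (fun y : 'rV[R]_n => F I i (arg II I i y U)) x.

(* F^I_{i,u^J}; [jacobian] follows the row-vector convention, so the product of
   the Jacobian matrix with a vector v is [v *m rhs_du F I i J x U]. *)
Definition rhs_du (R : realType) (n : nat) (d : {set 'I_n} -> nat)
    (II : {set {set 'I_n}}) (F : rhs R d II) (I : {set 'I_n}) (i : 'I_n)
    (J : {set 'I_n})
    (x : 'rV[R]_n) (U : forall K : {set 'I_n}, 'rV[R]_(d K)) :
    'M[R]_(d J, d I) :=
  jacobian (fun w : 'rV[R]_(d J) => F I i (arg II I i x (dfwith U J w))) (U J).

(* The value of (u^I_{x_i})_{x_j} along solutions, by the chain rule; j \in I is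
   intended, so that F^J_j is given for each J in subI II I i. *)
Definition cross_derivative (R : realType) (n : nat) (d : {set 'I_n} -> nat)
    (II : {set {set 'I_n}}) (F : rhs R d II) (I : {set 'I_n}) (i j : 'I_n)
    (x : 'rV[R]_n) (U : forall J : {set 'I_n}, 'rV[R]_(d J)) : 'rV[R]_(d I) :=
  rhs_dx F I i j x U +
  \sum_(J in subI II I i) F J j (arg II J j x U) *m rhs_du F I i J x U.

Definition darboux_system (R : realType) (n : nat) (d : {set 'I_n} -> nat)
    (II : {set {set 'I_n}}) (D : rhs_dom R d II) (F : rhs R d II)
    (xbar : 'rV[R]_n) (Ubar : forall J : {set 'I_n}, 'rV[R]_(d J)) : Prop :=
  (forall I i, I \in II -> i \in I -> nbhs (arg II I i xbar Ubar) (D I i)) /\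
  (forall I i j, I \in II -> i \in I -> j \in I -> i != j ->
     exists2 e : R, 0 < e &
       forall (x : 'rV[R]_n) (U : forall J : {set 'I_n}, 'rV[R]_(d J)),
         ball xbar e x -> (forall J, J \in II -> ball (Ubar J) e (U J)) ->
         cross_derivative F I i j x U = cross_derivative F I j i x U).

(* U solves the system on N and takes on the data ubar, where ubar I is a
   function of x_{I^c} with domain B I. *)
Definition darboux_solution (R : realType) (n : nat) (d : {set 'I_n} -> nat)
    (II : {set {set 'I_n}}) (D : rhs_dom R d II) (F : rhs R d II)
    (xbar : 'rV[R]_n) (B : forall I : {set 'I_n}, set 'rV[R]_#|(~: I)%SET|)
    (ubar : forall I : {set 'I_n}, 'rV[R]_#|(~: I)%SET| -> 'rV[R]_(d I))
    (N : set 'rV[R]_n)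
    (U : forall I : {set 'I_n}, 'rV[R]_n -> 'rV[R]_(d I)) : Prop :=
  (forall I i x, I \in II -> i \in I -> N x ->
     [/\ D I i (arg II I i x (U ^~ x)),
         derivable (U I) x (delta_mx 0 i) &
         'D_(delta_mx 0 i) (U I) x = F I i (arg II I i x (U ^~ x))]) /\
  (forall I x, I \in II -> N x -> xsub I x = xsub I xbar ->
     B I (xsub (~: I)%SET x) /\ U I x = ubar I (xsub (~: I)%SET x)).

(* Main.v *)
Require Import Defs.
From HB Require Import structures.
From mathcomp Require Import all_boot all_order all_algebra.
From mathcomp Require Import all_classical all_reals all_analysis.
From mathcomp Require Import ring lra.
Import Order.TTheory GRing.Theory Num.Theory.
Import numFieldNormedType.Exports.
Local Open Scope classical_set_scope.
Local Open Scope ring_scope.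

(** Write S_I(t) x for the point obtained from x by replacing x_i, for i in I,
    by xbar_i + t (x_i - xbar_i).  Integrating the equations along the segment
    t |-> S_I(t) x turns the system with its data into one fixed-point equation

      u^I(x) = ubar^I(x_{I^c})
             + int_0^1 sum_(i in I) (x_i - xbar_i) F^I_i(S_I(t) x; U(S_I(t) x)) dt,

    which is determined although the system is overdetermined.  The proof solves
    this equation and then shows that its solution satisfies every equation of
    the system.

    Existence and regularity.  The right-hand sides and the data are composed
    with a C^2 map of the whole space into a bounded set that is the identity
    near the base point ([clamp_row]), and so are the offsets x_i - xbar_i, at a
    small scale.  The equation then has the form
    W_a(x) = int_0^1 H_a(t, x, W(S_a(t) x)) dt with H globally C^2 and a
    contraction in its last argument, and Picard iteration converges locally
    uniformly ([exists_solution]).  For the regularity, the formal derivative of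
    the equation in the direction e_k is an equation of the same form, linear in
    the unknown; it has a continuous solution P by the same existence result,
    and the contraction estimate applied to W(x + h e_k) - W(x) - h P(x) shows
    that P is the derivative of W ([solution_derive]).  As the linearized
    equation has the same form, induction shows that the solution is C^k when H is
    ([solution_csmooth]).

    The equations.  Let E^I_i = u^I_{x_i} - F^I_i(x; U) be the defect of the
    integral solution.  Differentiating the integral and comparing with
    F^I_i(x) = int_0^1 d/dt (t F^I_i(S_I(t) x)) dt gives

      E^I_i(x) = int_0^1 t sum_(j in I) (x_j - xbar_j)
                   (d_i F^I_j - d_j F^I_i)(S_I(t) x) dt

    ([is_derive_radial_primitive]), where F^I_j stands for F^I_j(x; U(x)).  By
    the chain rule, d_i F^I_j involves the derivatives u^J_{x_i} with J
    containing I minus j; such J contain i, so u^J_{x_i} = F^J_i + E^J_i, and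
    the integrability conditions cancel everything except terms linear in E
    ([rotation_bound]).  Thus E is a fixed point of a linear contraction on a
    small ball, and vanishes ([defect_eq0]).

    Uniqueness.  The difference of two solutions vanishes where the segment
    starts, and its derivative along the segment is controlled by the Lipschitz
    constant of F as long as both solutions stay close to the base value
    ([unique_while_close]).  A solution equal to U on a ball stays close to the
    base value on a slightly larger one, by an amount that is uniform on compact
    sets, so the equality propagates to the whole ball ([unique_solution]). *)

Set Implicit Arguments.
Unset Strict Implicit.

(** * Row vectors and the mean value theorem along a line *)

Section RowNorm.
Context {R : realType} {m : nat}.
Implicit Types x y : 'rV[R]_m.

Lemma row_norm_ge x j : `|x 0 j| <= `|x|.
Proof.
rewrite [leRHS]/Num.Def.normr /= mx_normrE.
exact: (le_bigmax _ (fun ij => `|x ij.1 ij.2|) (0, j)).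
Qed.

Lemma row_subE x y j : (x - y) 0 j = x 0 j - y 0 j.
Proof. by rewrite !mxE. Qed.

Lemma row_addE x y j : (x + y) 0 j = x 0 j + y 0 j.
Proof. by rewrite !mxE. Qed.
Lemma row_norm_le x e : 0 <= e -> (forall j, `|x 0 j| <= e) -> `|x| <= e.
Proof.
move=> e0 xe; rewrite /Num.Def.normr /= mx_normrE; apply: bigmax_le => // -[i j] _ /=.
by rewrite (ord1 i).
Qed.

Lemma row_norm_lt x e : 0 < e -> (forall j, `|x 0 j| < e) -> `|x| < e.
Proof.
move=> e0 xe; rewrite /Num.Def.normr /= mx_normrE; apply: bigmax_lt => // -[i j] _ /=.
by rewrite (ord1 i).
Qed.

Lemma row_continuousP (T : topologicalType) (f : T -> 'rV[R]_m) (x : T) :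
  (forall j, {for x, continuous (fun y : T => f y 0 j)}) -> {for x, continuous f}.
Proof.
move=> fc; apply/cvgrPdist_lt => e e0; near=> y.
apply: row_norm_lt => // j; rewrite !mxE.
move: j; near: y; apply: filter_forall => j.
by move/cvgrPdist_lt: (fc j) => /(_ _ e0).
Unshelve. all: by end_near. Qed.

End RowNorm.

Lemma linear_form_continuous (R : realType) m (a : 'I_m -> R) :
  continuous (fun h : 'rV[R]_m => \sum_j h 0 j * a j).
Proof.
have cj j (y : 'rV[R]_m) : (fun h : 'rV[R]_m => h 0 j * a j) @ y --> y 0 j * a j.
  have c1 : (fun h : 'rV[R]_m => h 0 j) @ y --> y 0 j by exact: coord_continuous.
  have c2 : (fun h : 'rV[R]_m => a j) @ y --> a j by exact: cst_continuous.
  exact: (cvgM c1 c2).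
by apply: continuous_big => [|j _ y]; [exact: add_continuous|exact: cj].
Qed.

Section Lines.
Context {R : realType} {V : normedModType R}.
Implicit Types (f : V -> R) (x v : V).

Lemma is_derive_line f x v t : derivable f (x + t *: v) v ->
  is_derive t (1 : R) (fun s => f (x + s *: v)) ('D_v f (x + t *: v)).
Proof.
move=> df.
have E : (fun h : R => h^-1 *: (((fun s => f (x + s *: v)) \o shift t) (h *: 1) -
     f (x + t *: v))) =
   (fun h : R => h^-1 *: ((f \o shift (x + t *: v)) (h *: v) - f (x + t *: v))).
  apply/funext => h /=; congr (_ *: (f _ - _)).
  by rewrite scalerDl addrCA; congr (_ + _); rewrite [h *: 1]mulr1.
by split; [rewrite /derivable E|rewrite /derive E].
Qed.

Lemma mvt_nonneg f x v (a : R) : 0 <= a ->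
  (forall s : R, 0 <= s <= a -> derivable f (x + s *: v) v) ->
  exists2 c : R, 0 <= c <= a & f (x + a *: v) - f x = a * 'D_v f (x + c *: v).
Proof.
move=> a0 df.
pose g s := f (x + s *: v); pose dg s := 'D_v f (x + s *: v).
have D (s : R) : s \in `[0, a] -> is_derive s (1 : R) g (dg s).
  by rewrite in_itv => /df; exact: is_derive_line.
have D' s : s \in `]0, a[ -> is_derive s (1 : R) g (dg s).
  by move=> s0; apply/D/subset_itv_oo_cc.
have C : {within `[0, a], continuous g}.
  apply: continuous_in_subspaceT => s; rewrite inE /= => sbc.
  by apply: differentiable_continuous; apply/derivable1_diffP; have [] := D s sbc.
have [c cI E] := MVT_segment a0 D' C.
exists c; first by move: cI; rewrite in_itv.
by move: E; rewrite /g /dg scale0r addr0 subr0 mulrC.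
Qed.

Lemma mvt_line f x v (a : R) :
  (forall s, `|s| <= `|a| -> derivable f (x + s *: v) v) ->
  exists2 c, `|c| <= `|a| & f (x + a *: v) - f x = a * 'D_v f (x + c *: v).
Proof.
move=> df; have [a0|a0] := leP 0 a.
  have [s /andP[s0 sa]|c /andP[c0 ca] E] := @mvt_nonneg f x v a a0.
    by apply: df; rewrite !ger0_norm.
  by exists c => //; rewrite !ger0_norm.
have a0' : 0 <= - a by rewrite oppr_ge0 ltW.
have [s /andP[s0 sa]|c /andP[c0 ca] E] := @mvt_nonneg f (x + a *: v) v (- a) a0'.
  rewrite -addrA -scalerDl; apply: df.
  by rewrite (ltr0_norm a0) ler_norml; apply/andP; split; lra.
exists (a + c); first by rewrite (ltr0_norm a0) ler_norml; apply/andP; split; lra.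
by move: E; rewrite scaleNr addrK -addrA -scalerDl => E; lra.
Qed.

Lemma mvt_segment f x v :
  (forall s : R, 0 <= s <= 1 -> derivable f (x + s *: v) v) ->
  exists2 c : R, 0 <= c <= 1 & f (x + v) - f x = 'D_v f (x + c *: v).
Proof.
move=> df; have [|c cI E] := @mvt_nonneg f x v 1 ler01; first exact: df.
by exists c => //; move: E; rewrite scale1r mul1r.
Qed.

End Lines.

(** * Functions with continuous partial derivatives *)
Section CSmooth.
Context {R : realType}.

(** The scalar counterpart of [smooth_on].  Sums and products make sense for
    scalar functions only, and a row-valued function is smooth when its
    components are ([smooth_on_csmooth], [csmooth_smooth_on]). *)
Fixpoint csmooth (m k : nat) (A : set 'rV[R]_m) (f : 'rV[R]_m -> R) : Prop :=
  (forall x, A x -> {for x, continuous f}) /\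
  if k is k'.+1 then
    forall j : 'I_m,
      (forall x, A x -> derivable f x (delta_mx 0 j)) /\
      csmooth k' A (fun x => 'D_(delta_mx 0 j) f x)
  else True.

Context {m : nat}.
Implicit Types (A B : set 'rV[R]_m) (f g : 'rV[R]_m -> R).

Lemma csmooth_continuous k A f x : csmooth k A f -> A x -> {for x, continuous f}.
Proof. by case: k => [|k] [+ _]; exact. Qed.

Lemma csmooth_derivable k A f j x : csmooth k.+1 A f -> A x ->
  derivable f x (delta_mx 0 j).
Proof. by case=> _ /(_ j)[+ _]; exact. Qed.

Lemma csmoothD k A f j : csmooth k.+1 A f -> csmooth k A ('D_(delta_mx 0 j) f).
Proof. by case=> _ /(_ j)[]. Qed.

Lemma csmoothW k A f : csmooth k.+1 A f -> csmooth k A f.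
Proof.
elim: k f => [|k IH] f; first by case.
case=> cf df; split=> // j; split; first by case: (df j).
by apply: IH; case: (df j).
Qed.

Lemma csmooth_le k l A f : (k <= l)%N -> csmooth l A f -> csmooth k A f.
Proof.
move=> /subnK <-; elim: (l - k)%N => // p IH.
by rewrite addSn => /csmoothW.
Qed.

Lemma csmoothS k A B f : B `<=` A -> csmooth k A f -> csmooth k B f.
Proof.
move=> BA; elim: k f => [|k IH] f [cf df]; split => //.
- by move=> x /BA; exact: cf.
- by move=> x /BA; exact: cf.
- move=> j; case: (df j) => dj sj; split; first by move=> x /BA; exact: dj.
  exact: IH.
Qed.

Lemma csmooth_ext k A f g : open A -> {in A, f =1 g} ->
  csmooth k A f -> csmooth k A g.
Proof.
move=> oA; elim: k f g => [|k IH] f g fg.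
  move=> [cf _]; split => // x Ax.
  have nfg : \near x, f x = g x.
    by near=> y; apply/fg/mem_set; near: y; exact: open_nbhs_nbhs.
  have := cf x Ax; rewrite /prop_for /continuous_at (fg x (mem_set Ax)).
  exact: (cvg_trans (near_eq_cvg nfg)).
have nfg x : A x -> \near x, f x = g x.
  by move=> Ax; near=> y; apply/fg/mem_set; near: y; exact: open_nbhs_nbhs.
move=> [cf df]; split => [x Ax|j].
  have := cf x Ax; rewrite /prop_for /continuous_at (fg x (mem_set Ax)).
  exact: (cvg_trans (near_eq_cvg (nfg _ Ax))).
case: (df j) => dj sj; split=> [x Ax|].
  apply: near_eq_derivable (dj x Ax); exact: nfg.
apply: IH sj => x /set_mem Ax; apply: near_eq_derive; exact: nfg.
Unshelve. all: by end_near. Qed.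

(** Moving from [x] to [x + h] one coordinate at a time, each increment is, by
    the mean value theorem, a partial derivative at a nearby point, which is
    close to the one at [x] by continuity. *)
Lemma c1_differentiable A f x : open A -> csmooth 1 A f -> A x ->
  differentiable f x.
Proof.
move=> oA sf Ax.
pose a j : R := 'D_(delta_mx 0 j) f x.
pose L (h : 'rV[R]_m) : R := \sum_j h 0 j * a j.
have Llin : linear L.
  move=> b u v; have -> : b *: L u = b * L u by [].
  rewrite /L mulr_sumr -big_split /=; apply: eq_bigr => j _.
  by rewrite !mxE mulrDl mulrA.
pose LM := GRing.isLinear.Build _ _ _ _ L Llin.
pose LL : {linear 'rV[R]_m -> R} := HB.pack L LM.
have LE h : LL h = \sum_j h 0 j * 'D_(delta_mx 0 j) f x by [].
have Lc : continuous LL by exact: linear_form_continuous.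
have key : f \o shift x = cst (f x) + (LL : 'rV[R]_m -> R) +o_ (0 : 'rV[R]_m) id.
  apply/eqaddoP => e e0.
  pose e' := e / m.+1%:R.
  have e'0 : 0 < e' by rewrite divr_gt0.
  have : \forall y \near x, A y /\ forall j,
     `|'D_(delta_mx 0 j) f x - 'D_(delta_mx 0 j) f y| < e'.
    near=> y; split; first by near: y; exact: open_nbhs_nbhs.
    near: y; apply: filter_forall => j.
    have := csmooth_continuous (csmoothD j sf) Ax.
    by move/cvgrPdist_lt => /(_ _ e'0).
  move=> /nbhs_ballP[d /= d0 dP].
  have dP' h : `|h| < d -> A (x + h) /\ forall j,
     `|'D_(delta_mx 0 j) f x - 'D_(delta_mx 0 j) f (x + h)| < e'.
    by move=> hd; apply: dP; rewrite -ball_normE /= opprD addrA subrr sub0r normrN.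
  apply: (@nbhs_norm0P R 'rV[R]_m _).2; exists d => // h /= hd.
  pose hk k : 'rV[R]_m := \row_j (if (j < k)%N then h 0 j else 0).
  have hk0 : hk 0%N = 0 by apply/rowP => j; rewrite !mxE.
  have hkm : hk m = h by apply/rowP => j; rewrite !mxE ltn_ord.
  have hkS (k : 'I_m) : hk k.+1 = hk k + h 0 k *: delta_mx 0 k.
    apply/rowP => j; rewrite !mxE eqxx /= ltnS leq_eqVlt.
    have [->|jk] := eqVneq j k; first by rewrite eqxx ltnn mulr1 add0r.
    by rewrite (inj_eq val_inj) (negbTE jk) mulr0 addr0.
  have tel : f (x + h) - f x = \sum_(k < m) (f (x + hk k.+1) - f (x + hk k)).
    rewrite -(big_mkord xpredT (fun k => f (x + hk k.+1) - f (x + hk k))).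
    by rewrite telescope_sumr // hkm hk0 addr0.
  have incr : f (h + x) - (f x + LL h) =
      \sum_(k < m) ((f (x + hk k.+1) - f (x + hk k)) -
         h 0 k * 'D_(delta_mx 0 k) f x).
    by rewrite big_split /= -tel sumrN -LE [h + x]addrC opprD addrA.
  rewrite [X in `|X|](_ : _ = f (h + x) - (f x + LL h)) // incr.
  have ek (k : 'I_m) : `|f (x + hk k.+1) - f (x + hk k) -
     h 0 k * 'D_(delta_mx 0 k) f x| <= e' * `|h|.
    have near_d s : `|s| <= `|h 0 k| -> `|hk k + s *: delta_mx 0 k| < d.
      move=> sh; apply: le_lt_trans hd; apply: row_norm_le => // j.
      rewrite !mxE eqxx /=; have [->|jk] := eqVneq j k.
        by rewrite ltnn add0r mulr1 (le_trans sh)// row_norm_ge.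
      rewrite mulr0 addr0; case: ifP => _; last by rewrite normr0.
      exact: row_norm_ge.
    have [s sh|c ch E] := @mvt_line _ _ f (x + hk k) (delta_mx 0 k) (h 0 k).
      rewrite -addrA; apply: csmooth_derivable sf _.
      by case: (dP' _ (near_d s sh)).
    rewrite hkS addrA E -addrA -mulrBr normrM mulrC.
    have [_ /(_ k) P] := dP' _ (near_d c ch).
    by rewrite ler_pM// ?row_norm_ge// distrC ltW.
  apply: le_trans (ler_norm_sum _ _ _) _.
  apply: le_trans (ler_sum _ (fun k _ => ek k)) _.
  rewrite sumr_const card_ord -[leLHS]mulr_natl mulrA /= /e'.
  rewrite ler_wpM2r// mulrCA ger_pMr// ler_pdivrMr// mul1r ler_nat.
  exact: leqnSn.
have dE : 'd f x = LL :> (_ -> _) by exact: diff_unique.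
apply/diff_locallyP; rewrite dE; split => //.
Unshelve. all: by end_near. Qed.

End CSmooth.

Section ChainRule.
Context {R : realType} {V : normedModType R} {p : nat}.

Lemma derive_diff_sum (F : 'rV[R]_p -> R) (y w : 'rV[R]_p) :
  differentiable F y -> 'D_w F y = \sum_l w 0 l * 'D_(delta_mx 0 l) F y.
Proof.
move=> dF; rewrite deriveE// {1}[w]row_sum_delta linear_sum.
by apply: eq_bigr => l _; rewrite linearZ /= deriveE.
Qed.

Lemma is_derive_comp_diff (W X : normedModType R) (F : W -> X) (Phi : V -> W) x v :
  differentiable F (Phi x) -> derivable Phi x v ->
  is_derive x v (fun y => F (Phi y)) ('D_('D_v Phi x) F (Phi x)).
Proof.
move=> dF dPhi.
pose G (s : R) := Phi (s *: v + x).
have G0 : G 0 = Phi x by rewrite /G scale0r add0r.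
have dG : derivable G 0 1 by apply: (derivable1P Phi x v).1.
have dG' : differentiable G 0 by apply/derivable1_diffP.
have dFG : differentiable F (G 0) by rewrite G0.
have dC : differentiable (F \o G) 0 by exact: differentiable_comp.
have line0 (h : R) : h *: (1 : R) + 0 = h by rewrite addr0 [h *: 1]mulr1.
have DG : 'D_1 G 0 = 'D_v Phi x.
  rewrite /derive [X in lim (X @ _) = _](_ : _ =
    (fun h : R => h^-1 *: ((Phi \o shift x) (h *: v) - Phi x)))//.
  by apply/funext => h; rewrite G0 /= line0.
have E : 'D_v (fun y => F (Phi y)) x = 'D_1 (F \o G) 0.
  rewrite /derive [X in _ = lim (X @ _)](_ : _ =
    (fun h : R => h^-1 *: (((fun y => F (Phi y)) \o shift x) (h *: v) - F (Phi x))))//.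
  by apply/funext => h; rewrite /= line0 G0.
split.
  by apply: (derivable1P _ x v).2; apply/derivable1_diffP; exact: dC.
rewrite E deriveE// diff_comp//= -deriveE// -(deriveE _ dG') DG G0//.
Qed.

End ChainRule.

Section CSmoothAlgebra.
Context {R : realType} {m : nat}.
Implicit Types (A B : set 'rV[R]_m) (f g : 'rV[R]_m -> R).

(** To recognize the derivatives up to equality on [A], not everywhere. *)
Lemma csmooth_mk k A f (g : 'I_m -> 'rV[R]_m -> R) : open A ->
  (forall x, A x -> {for x, continuous f}) ->
  (forall j x, A x -> is_derive x (delta_mx 0 j) f (g j x)) ->
  (forall j, csmooth k A (g j)) -> csmooth k.+1 A f.
Proof.
move=> oA cf df sg; split=> // j; split.
  by move=> x /(df j)[].
apply: csmooth_ext (sg j) => // x /set_mem /(df j)[_ <-] //.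
Qed.

Lemma csmooth_derive k A f j x : csmooth k.+1 A f -> A x ->
  is_derive x (delta_mx 0 j) f ('D_(delta_mx 0 j) f x).
Proof. by move=> sf Ax; apply: derivableP; exact: csmooth_derivable sf Ax. Qed.

Lemma csmooth_cst k A (c : R) : csmooth k A (fun=> c).
Proof.
elim: k c => [|k IH] c; first by split=> // x _; exact: cst_continuous.
split=> [x _|j]; first exact: cst_continuous.
split=> [x _|]; first exact: derivable_cst.
rewrite [X in csmooth k A X](_ : _ = fun=> 0); first exact: IH.
by apply/funext => x; rewrite derive_cst.
Qed.

Lemma is_derive_coord (x v : 'rV[R]_m) i :
  is_derive x v (fun y : 'rV[R]_m => y 0 i) (v 0 i).
Proof.
have H : (fun h : R => h^-1 *: (((fun y : 'rV[R]_m => y 0 i) \o shift x) (h *: v) - x 0 i))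
   @ 0^' --> v 0 i.
  apply: cvg_near_cst; near=> h.
  rewrite /= !mxE addrK scalerA mulVf ?scale1r//.
  by near: h; exact: nbhs_dnbhs_neq.
split; first by apply/cvg_ex; exists (v 0 i).
exact: cvg_lim H.
Unshelve. all: by end_near. Qed.

Lemma csmooth_coord k A i : open A -> csmooth k A (fun x => x 0 i).
Proof.
move=> oA; case: k => [|k].
  by split=> // x _; exact: coord_continuous.
apply: (@csmooth_mk _ _ _ (fun j _ => (delta_mx 0 j : 'rV[R]_m) 0 i)) => //.
- by move=> x _; exact: coord_continuous.
- by move=> j x _; exact: is_derive_coord.
- by move=> j; exact: csmooth_cst.
Qed.

Lemma csmooth_add k A f g : open A -> csmooth k A f -> csmooth k A g ->
  csmooth k A (fun x => f x + g x).
Proof.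
move=> oA; elim: k f g => [|k IH] f g sf sg.
  split=> // x Ax.
  exact: (cvgD (csmooth_continuous sf Ax) (csmooth_continuous sg Ax)).
apply: (@csmooth_mk _ _ _ (fun j x => 'D_(delta_mx 0 j) f x + 'D_(delta_mx 0 j) g x)) => //.
- move=> x Ax.
  exact: (cvgD (csmooth_continuous sf Ax) (csmooth_continuous sg Ax)).
- move=> j x Ax; exact: (is_deriveD (csmooth_derive j sf Ax) (csmooth_derive j sg Ax)).
- by move=> j; apply: IH; exact: csmoothD.
Qed.

Lemma csmooth_mul k A f g : open A -> csmooth k A f -> csmooth k A g ->
  csmooth k A (fun x => f x * g x).
Proof.
move=> oA; elim: k f g => [|k IH] f g sf sg.
  split=> // x Ax.
  exact: (cvgM (csmooth_continuous sf Ax) (csmooth_continuous sg Ax)).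
apply: (@csmooth_mk _ _ _ (fun j x =>
     f x * 'D_(delta_mx 0 j) g x + g x * 'D_(delta_mx 0 j) f x)) => //.
- move=> x Ax.
  exact: (cvgM (csmooth_continuous sf Ax) (csmooth_continuous sg Ax)).
- move=> j x Ax; exact: (is_deriveM (csmooth_derive j sf Ax) (csmooth_derive j sg Ax)).
- move=> j; apply: csmooth_add => //; apply: IH.
  + exact: csmoothW.
  + exact: csmoothD.
  + exact: csmoothW.
  + exact: csmoothD.
Qed.

Lemma csmooth_opp k A f : open A -> csmooth k A f -> csmooth k A (fun x => - f x).
Proof.
move=> oA sf; have := csmooth_mul oA (@csmooth_cst k A (-1)) sf.
by under eq_fun do rewrite mulN1r.
Qed.

Lemma csmooth_sub k A f g : open A -> csmooth k A f -> csmooth k A g ->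
  csmooth k A (fun x => f x - g x).
Proof. by move=> oA sf sg; apply: csmooth_add => //; exact: csmooth_opp. Qed.

Lemma csmooth_sum k A (I : Type) (r : seq I) (P : pred I)
    (F : I -> 'rV[R]_m -> R) : open A ->
  (forall i, P i -> csmooth k A (F i)) ->
  csmooth k A (fun x => \sum_(i <- r | P i) F i x).
Proof.
move=> oA sF; elim: r => [|i r IH].
  by under eq_fun do rewrite big_nil; exact: csmooth_cst.
under eq_fun do rewrite big_cons.
by case: (boolP (P i)) => Pi //; apply: csmooth_add => //; exact: sF.
Qed.

Lemma csmooth_row_continuous p k A (Phi : 'rV[R]_m -> 'rV[R]_p) x :
  (forall l, csmooth k A (fun y => Phi y 0 l)) -> A x ->
  {for x, continuous Phi}.
Proof.
by move=> sP Ax; apply: row_continuousP => l; exact: csmooth_continuous (sP l) Ax.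
Qed.

Lemma derivable_row p (Phi : 'rV[R]_m -> 'rV[R]_p) x v :
  (forall l, derivable (fun y => Phi y 0 l) x v) -> derivable Phi x v.
Proof. by move=> dP; apply/derivable_mxP => i l; rewrite (ord1 i). Qed.

Lemma is_derive_comp p (F : 'rV[R]_p -> R) (Phi : 'rV[R]_m -> 'rV[R]_p) x v :
  differentiable F (Phi x) -> (forall l, derivable (fun y => Phi y 0 l) x v) ->
  is_derive x v (fun y => F (Phi y))
    (\sum_l 'D_v (fun y => Phi y 0 l) x * 'D_(delta_mx 0 l) F (Phi x)).
Proof.
move=> dF dP; have dPhi := derivable_row dP.
apply: is_derive_eq (is_derive_comp_diff dF dPhi) _.
rewrite derive_diff_sum //; apply: eq_bigr => l _; congr (_ * _).
by rewrite derive_mx// mxE.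
Qed.

(** By induction on [k]: the partial derivatives of the composite are sums of
    products of derivatives of [Phi] and of composites with derivatives of [F]. *)
Lemma csmooth_comp p k A (B : set 'rV[R]_p) (F : 'rV[R]_p -> R)
    (Phi : 'rV[R]_m -> 'rV[R]_p) : open A -> open B ->
  csmooth k B F -> (forall l, csmooth k A (fun x => Phi x 0 l)) ->
  (forall x, A x -> B (Phi x)) -> csmooth k A (fun x => F (Phi x)).
Proof.
move=> oA oB; elim: k F => [|k IH] F sF sP AB.
  split=> // x Ax; apply: (@continuous_comp _ _ _ Phi F).
    exact: csmooth_row_continuous sP Ax.
  exact: csmooth_continuous sF (AB _ Ax).
apply: (@csmooth_mk _ _ _ (fun j x => \sum_l 'D_(delta_mx 0 j) (fun y => Phi y 0 l) x *
    'D_(delta_mx 0 l) F (Phi x))) => //.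
- move=> x Ax; apply: (@continuous_comp _ _ _ Phi F).
    exact: csmooth_row_continuous sP Ax.
  exact: csmooth_continuous sF (AB _ Ax).
- move=> j x Ax; apply: is_derive_comp.
    apply: c1_differentiable (AB _ Ax) => //.
    by apply: csmooth_le sF.
  by move=> l; exact: csmooth_derivable (sP l) Ax.
- move=> j; apply: csmooth_sum => // l _; apply: csmooth_mul => //.
    exact: csmoothD.
  apply: (IH ('D_(delta_mx 0 l) F)) => //; first exact: csmoothD.
  by move=> i; exact: csmoothW.
Qed.

End CSmoothAlgebra.

Lemma smooth_on_csmooth (R : realType) m p k (A : set 'rV[R]_m) (f : 'rV[R]_m -> 'rV[R]_p) l :
  open A -> smooth_on k A f -> csmooth k A (fun x => f x 0 l).
Proof.
have cl (g : 'rV[R]_m -> 'rV[R]_p) x : {for x, continuous g} ->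
    {for x, continuous (fun y => g y 0 l)}.
  move=> cg; apply: (@continuous_comp _ _ _ g (fun z : 'rV[R]_p => z 0 l)) => //.
  exact: coord_continuous.
move=> oA; elim: k f => [|k IH] f [cf df].
  by split=> // x /cf; exact: cl.
split=> [x /cf|j]; first exact: cl.
case: (df j) => dj sj; split=> [x Ax|].
  by have /derivable_mxP := dj x Ax; exact.
apply: csmooth_ext (IH _ sj) => // x /set_mem Ax.
by rewrite derive_mx ?mxE//; exact: dj.
Qed.

Lemma csmooth_smooth_on (R : realType) m p k (A : set 'rV[R]_m) (f : 'rV[R]_m -> 'rV[R]_p) :
  open A -> (forall l, csmooth k A (fun x => f x 0 l)) -> smooth_on k A f.
Proof.
move=> oA; elim: k f => [|k IH] f sf.
  by split=> // x Ax; exact: csmooth_row_continuous sf Ax.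
split=> [x Ax|j]; first exact: csmooth_row_continuous sf Ax.
have dj x : A x -> derivable f x (delta_mx 0 j).
  by move=> Ax; apply: derivable_row => l; exact: csmooth_derivable (sf l) Ax.
split=> //; apply: IH => l; apply: csmooth_ext (csmoothD j (sf l)) => //.
by move=> x /set_mem Ax; rewrite derive_mx ?mxE//; exact: dj.
Qed.

(** * Compactness, contractions and integrals over the unit interval *)
Lemma continuous_epsP (R : realType) (V W : normedModType R) (f : V -> W) x :
  {for x, continuous f} <->
  (forall e : R, 0 < e ->
    exists2 d : R, 0 < d & forall y, `|y - x| < d -> `|f y - f x| <= e).
Proof.
split=> [/cvgrPdist_le cf e e0|cf].
  have /nbhs_ballP[d /= d0 dP] := cf _ e0; exists d => // y yx.
  by rewrite distrC; apply: dP; rewrite -ball_normE /= distrC.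
apply/cvgrPdist_le => e /cf[d d0 dP].
apply/nbhs_ballP; exists d => //= y; rewrite -ball_normE /= distrC => xy.
by rewrite distrC dP.
Qed.

Section Compactness.
Context {R : realType} {m : nat}.

Lemma compact_cball (c : 'rV[R]_m) r : compact [set z : 'rV[R]_m | `|z - c| <= r].
Proof.
apply: bounded_closed_compact.
  exists (r + `|c|); split; first exact: num_real.
  move=> M rM z /= zr; apply: le_trans (ltW rM).
  by rewrite -[z](subrK c) (le_trans (ler_normD _ _))// lerD2r.
rewrite (_ : mkset _ = (fun z : 'rV[R]_m => `|z - c|) @^-1` [set x : R | x <= r])//.
apply: preimage_closed; last exact: closed_le.
move=> z _; apply: (@continuous_comp _ _ _ (fun z : 'rV[R]_m => z - c) Num.norm).
  by apply: continuousB; [exact: id|exact: cst_continuous].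
exact: norm_continuous.
Qed.

(** Only [z] is confined to the ball: a point [z'] close to it may lie outside,
    which spares the users a boundary discussion. *)
Lemma unif_cont_cball (f : 'rV[R]_m -> R) c r e :
  (forall z, `|z - c| <= r -> {for z, continuous f}) -> 0 < e ->
  exists2 d, 0 < d & forall z z', `|z - c| <= r -> `|z' - z| < d ->
    `|f z' - f z| < e.
Proof.
move=> cf e0; have := @compact_cball c r.
move/compact_near_coveringP => cov.
have /(_ (0 : R)^'+ (fun d z => forall z', `|z' - z| < d -> `|f z' - f z| < e) _)[] := cov R.
  move=> z zr.
  have e2 : 0 < e / 2 by rewrite divr_gt0.
  have /(@cvgrPdist_lt _ _ _ _ _ _ _)/(_ _ e2)/nbhs_ballP[d /= d0 dP] := cf z zr.
  have dP' y : `|y - z| < d -> `|f z - f y| < e / 2.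
    by move=> yz; apply: dP; rewrite -ball_normE /= distrC.
  exists (ball z (d / 2), [set a | a < d / 2]) => /=.
    split; first by apply: nbhsx_ballx; rewrite divr_gt0.
    by apply: nbhs_right_lt; rewrite divr_gt0.
  move=> [y a] /= [yz ad] z' z'y.
  move: yz; rewrite -ball_normE /= distrC => yz.
  have z'z : `|z' - z| < d.
    rewrite -[z' - z](subrKA y) (le_lt_trans (ler_normD _ _))//.
    rewrite (splitr d) ltrD// (lt_trans z'y)//.
  have yz' : `|y - z| < d by rewrite (lt_trans yz)// ltr_pdivrMr// ltr_pMr// ltr1n.
  rewrite -[_ - f y](subrKA (f z)) (le_lt_trans (ler_normD _ _))//.
  by rewrite (splitr e) ltrD// ?dP'// distrC dP'.
move=> d /= d0 dP; exists (d / 2); first by rewrite divr_gt0.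
move=> z z' zr z'z; apply: (dP (d / 2)) z'z => //=.
- by rewrite sub0r normrN ger0_norm ?divr_ge0 ?ltW// ltr_pdivrMr// ltr_pMr// ltr1n.
- by rewrite divr_gt0.
Qed.

Lemma bounded_cball (f : 'rV[R]_m -> R) c r :
  (forall z, `|z - c| <= r -> {for z, continuous f}) ->
  exists2 M, 0 < M & forall z, `|z - c| <= r -> `|f z| <= M.
Proof.
move=> cf.
have /compact_bounded[M [_ MP]] : compact (f @` [set z : 'rV[R]_m | `|z - c| <= r]).
  apply: continuous_compact; last exact: compact_cball.
  apply: continuous_in_subspaceT => z; rewrite inE /=; exact: cf.
exists (`|M| + 1); first by rewrite ltr_wpDl.
move=> z zr; apply: MP; last by exists z.
by rewrite (le_lt_trans (ler_norm _))// ltrDl.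
Qed.

End Compactness.

(** The form in which every contraction argument below is used: a bounded
    quantity whose bounds [K] improve to [theta * K + c] is at most the fixed
    point of this improvement, as one sees by taking its supremum for [K]. *)
Lemma contraction_bound (R : realType) (T : Type) (S : set T) (f : T -> R)
    (M theta c : R) : theta < 1 ->
  (forall s, S s -> f s <= M) ->
  (forall K, (forall s, S s -> f s <= K) -> forall s, S s -> f s <= theta * K + c) ->
  forall s, S s -> f s <= c / (1 - theta).
Proof.
move=> th1 fM H s Ss.
have hs : has_sup (f @` S).
  split; first by exists (f s), s.
  by exists M => _ [u Su <-]; exact: fM.
have ub u : S u -> f u <= sup (f @` S).
  by move=> Su; apply: sup_upper_bound => //; exists u.
have : sup (f @` S) <= theta * sup (f @` S) + c.
  apply: ge_sup; first by exists (f s), s.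
  by move=> _ [u Su <-]; exact: H.
move=> le_sup; apply: le_trans (ub _ Ss) _.
by rewrite ler_pdivlMr ?subr_gt0//; lra.
Qed.

Section UnitIntegral.
Context {R : realType}.
Implicit Types f g : R -> R.

(** Applied to continuous functions only, which are integrable. *)
Definition int01 f : R := (\int[@lebesgue_measure R]_(t in `[0%R, 1%R]) f t)%R.

Let mI : measurable (`[0%R, 1%R] : set R) := measurable_itv _.

Let integ f : continuous f ->
  (@lebesgue_measure R).-integrable `[0%R, 1%R] (EFin \o f).
Proof.
move=> cf; apply: continuous_compact_integrable; first exact: segment_compact.
by apply: continuous_subspaceT.
Qed.

Lemma eq_int01 f g : (forall t, 0 <= t <= 1 -> f t = g t) -> int01 f = int01 g.
Proof.
by move=> fg; apply: eq_Rintegral => t; rewrite inE /= in_itv; exact: fg.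
Qed.

Lemma int01D f g : continuous f -> continuous g ->
  int01 (fun t => f t + g t) = int01 f + int01 g.
Proof. by move=> cf cg; apply: RintegralD => //; exact: integ. Qed.

Lemma int01B f g : continuous f -> continuous g ->
  int01 (fun t => f t - g t) = int01 f - int01 g.
Proof. by move=> cf cg; apply: RintegralB => //; exact: integ. Qed.

Lemma int01Z a f : continuous f -> int01 (fun t => a * f t) = a * int01 f.
Proof. by move=> cf; apply: RintegralZl => //; exact: integ. Qed.

Lemma int01_cst (a : R) : int01 (fun=> a) = a.
Proof.
rewrite /int01 Rintegral_cst//= lebesgue_measure_itv /= lte_fin ltr01.
by rewrite oppr0 adde0 /= mulr1.
Qed.

Lemma int01_norm f K : continuous f -> (forall t, 0 <= t <= 1 -> `|f t| <= K) ->
  `|int01 f| <= K.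
Proof.
move=> cf fK; rewrite -[leRHS]int01_cst.
apply: le_trans (le_normr_Rintegral _ (integ cf)) _ => //.
apply: le_Rintegral => //.
- by apply: (@integ (fun t => `|f t|)) => t; apply: cvg_norm; exact: cf.
- by apply: (@integ (fun=> K)) => t; exact: cst_continuous.
Qed.

Lemma int01_FTC (F f : R -> R) : (forall t, is_derive t (1 : R) F (f t)) ->
  continuous f -> int01 f = F 1 - F 0.
Proof.
move=> dF cf.
have dF' t : derivable F t 1 by case: (dF t).
have cF : continuous F.
  by move=> t; apply: differentiable_continuous; apply/derivable1_diffP.
rewrite /int01 /Rintegral (@continuous_FTC2 _ f F 0 1) ?ltr01//.
- by apply: continuous_subspaceT.
- split => [t _||]; first exact: dF'.
  + by apply: cvg_at_right_filter; exact: cF.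
  + by apply: cvg_at_left_filter; exact: cF.
- by move=> t _; rewrite derive1E; case: (dF t).
Qed.

End UnitIntegral.

Section TimeSpace.
Context {R : realType} {n : nat}.

(** Time and space as one vector, so that joint regularity is regularity of a
    function of one vector. *)
Definition tcons (t : R) (x : 'rV[R]_n) : 'rV[R]_(1 + n) :=
  row_mx (\row_(_ < 1) t) x.

Lemma tconsl t x i : tcons t x 0 (lshift n i) = t.
Proof. by rewrite row_mxEl mxE. Qed.

Lemma tconsr t x j : tcons t x 0 (rshift 1 j) = x 0 j.
Proof. by rewrite row_mxEr. Qed.

Lemma tcons_continuousl x : continuous (tcons ^~ x).
Proof.
move=> t; apply: row_continuousP => j.
case: (split_ordP j) => k ->.
  rewrite (_ : (fun t0 => _) = id); first exact: id.
  by apply/funext => s; rewrite tconsl.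
rewrite (_ : (fun t0 => _) = (fun=> x 0 k)); first exact: cst_continuous.
by apply/funext => s; rewrite tconsr.
Qed.

Lemma tcons_norm t x : `|tcons t x| <= `|t| + `|x|.
Proof.
apply: row_norm_le; first exact: addr_ge0.
move=> j; case: (split_ordP j) => k ->.
  by rewrite tconsl lerDl.
by rewrite tconsr (le_trans (row_norm_ge _ _))// lerDr.
Qed.

Lemma tconsB t x t' x' : tcons t x - tcons t' x' = tcons (t - t') (x - x').
Proof.
rewrite /tcons opp_row_mx add_row_mx; congr row_mx.
by apply/rowP => j; rewrite !mxE.
Qed.

Lemma tcons_delta t x h k :
  tcons t (x + h *: delta_mx 0 k) = tcons t x + h *: delta_mx 0 (rshift 1 k).
Proof.
set E := delta_mx 0 (rshift 1 k).
apply/rowP => j; rewrite [RHS]mxE [(h *: E) 0 j]mxE; case: (split_ordP j) => {}j ->.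
  by rewrite !tconsl !mxE eqxx eq_lrshift mulr0 addr0.
by rewrite !tconsr !mxE !eqxx eq_rshift.
Qed.

(** The integrand is uniformly continuous near the segment over [x]. *)
Lemma int01_continuous (G : 'rV[R]_(1 + n) -> R) : continuous G ->
  continuous (fun x => int01 (fun t => G (tcons t x))).
Proof.
move=> cG x; apply/(@continuous_epsP R 'rV[R]_n R) => e e0.
have cGt y : continuous (fun t => G (tcons t y)).
  move=> t; apply: (@continuous_comp _ _ _ (tcons ^~ y) G); first exact: tcons_continuousl.
  exact: cG.
have [d d0 dP] := unif_cont_cball (c := tcons 0 x) (r := 1) (fun z _ => cG z) e0.
exists d => //= y xy.
rewrite -int01B//; apply: int01_norm => [t|t /andP[t0 t1]].
  by apply: continuousB; exact: cGt.
rewrite ltW// dP//.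
  rewrite tconsB subrr subr0 (le_trans (tcons_norm _ _))//.
  by rewrite normr0 addr0 ger0_norm.
by rewrite tconsB subrr (le_lt_trans (tcons_norm _ _))// normr0 add0r.
Qed.

End TimeSpace.

(** * Integral equations along rays: existence *)

(** The intervals of radius [M * theta ^+ k / (1 - theta)] around the [u k] are
    nested, so the supremum of their lower ends lies in all of them. *)
Lemma geometric_limit (R : realType) (u : nat -> R) (M theta : R) :
  0 <= theta -> theta < 1 -> 
  (forall k, `|u k.+1 - u k| <= M * theta ^+ k) ->
  exists l, forall k, `|u k - l| <= M * theta ^+ k / (1 - theta).
Proof.
move=> th0 th1 du.
have th1' : 0 < 1 - theta by rewrite subr_gt0.
pose e k := M * theta ^+ k / (1 - theta).
have eS k : e k - e k.+1 = M * theta ^+ k.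
  rewrite /e exprS -mulrBl [theta * _]mulrC mulrA -[X in X - _]mulr1 -mulrBr.
  by rewrite mulfK// gt_eqF.
pose lo k := u k - e k; pose hi k := u k + e k.
have loS k : lo k <= lo k.+1.
  have := du k; rewrite -eS ler_norml /lo => /andP[]; lra.
have hiS k : hi k.+1 <= hi k.
  have := du k; rewrite -eS ler_norml /hi => /andP[]; lra.
have e0 k : 0 <= e k.
  rewrite /e divr_ge0 ?(ltW th1')//; exact: le_trans (du k).
have lo_mono j k : (j <= k)%N -> lo j <= lo k.
  by move=> /subnK <-; elim: (k - j)%N => // p IH; rewrite addSn (le_trans IH).
have hi_mono j k : (j <= k)%N -> hi k <= hi j.
  by move=> /subnK <-; elim: (k - j)%N => // p IH; rewrite addSn (le_trans _ IH).
have lohi j k : lo j <= hi k.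
  apply: (le_trans (lo_mono _ _ (leq_maxl j k))).
  apply: (le_trans _ (hi_mono _ _ (leq_maxr j k))).
  by rewrite /lo /hi; have := e0 (maxn j k); lra.
have ne : range lo !=set0 by exists (lo 0%N), 0%N.
exists (sup (range lo)) => k.
have h1 : lo k <= sup (range lo).
  apply: sup_upper_bound; last by exists k.
  by split=> //; exists (hi 0%N) => _ [j _ <-].
have h2 : sup (range lo) <= hi k by apply: ge_sup => // _ [j _ <-].
by move: h1 h2; rewrite /lo /hi -/(e k) ler_norml => *; apply/andP; split; lra.
Qed.

Lemma geometric_small (R : realType) (C theta e : R) :
  0 <= theta -> theta < 1 -> 0 < e -> exists k, C * theta ^+ k <= e.
Proof.
move=> th0 th1 e0.
have cv : (fun k => C * theta ^+ k) @ \oo --> C * 0.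
  apply: cvgM; first exact: cvg_cst.
  by apply: cvg_expr; rewrite ger0_norm.
rewrite mulr0 in cv.
move/cvgrPdist_le: cv => /(_ _ e0)[k _ /(_ k (leqnn k))] /=.
by rewrite sub0r normrN => h; exists k; apply: le_trans (ler_norm _) h.
Qed.

Section IntegralEquation.
Context {R : realType} {n m : nat}.
Variables (c : 'rV[R]_n) (I : 'I_m -> {set 'I_n}).

(** The speed at which the coordinate [k] moves along the segments in the
    directions of [A]. *)
Definition tau (A : {set 'I_n}) (t : R) (k : 'I_n) : R :=
  if k \in A then t else 1.

(** The segment from the point whose coordinates in [A] are those of [c], at
    [t = 0], to [x], at [t = 1]. *)
Definition shrink (A : {set 'I_n}) (t : R) (x : 'rV[R]_n) : 'rV[R]_n :=
  \row_k (c 0 k + tau A t k * (x 0 k - c 0 k)).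

Lemma tau_itv A t k : 0 <= t <= 1 -> 0 <= tau A t k <= 1.
Proof. by rewrite /tau; case: ifP => //; rewrite ler01 lexx. Qed.

Lemma tau_norm A t k : 0 <= t <= 1 -> `|tau A t k| <= 1.
Proof. by move=> /(tau_itv A k)/andP[t0 t1]; rewrite ger0_norm. Qed.

Lemma shrink_norm A t x : 0 <= t <= 1 -> `|shrink A t x - c| <= `|x - c|.
Proof.
move=> t01; apply: row_norm_le => // j.
rewrite !mxE addrAC subrr add0r normrM.
rewrite (le_trans (ler_piMl _ (tau_norm A j t01)))//.
by have := row_norm_ge (x - c) j; rewrite !mxE.
Qed.

Lemma shrink_delta A t x h k :
  shrink A t (x + h *: delta_mx 0 k) = shrink A t x + (tau A t k * h) *: delta_mx 0 k.
Proof.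
apply/rowP => j; rewrite !mxE eqxx /=.
by have [->|jk] := eqVneq j k; rewrite ?mulr1 ?mulr0 ?addr0 //; ring.
Qed.

(** Time, point and value as one vector, so that regularity in all of them is
    regularity of a function of one vector. *)
Definition pt (t : R) (x : 'rV[R]_n) (w : 'rV[R]_m) : 'rV[R]_(1 + (n + m)) :=
  tcons t (row_mx x w).

Lemma ptD t x w t' x' w' : pt t x w + pt t' x' w' = pt (t + t') (x + x') (w + w').
Proof.
rewrite /pt /tcons add_row_mx add_row_mx; congr row_mx.
by apply/rowP => j; rewrite !mxE.
Qed.

Lemma ptZ a t x w : a *: pt t x w = pt (a * t) (a *: x) (a *: w).
Proof.
rewrite /pt /tcons !scale_row_mx; congr row_mx.
by apply/rowP => j; rewrite !mxE.
Qed.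

Lemma pt_norm t x w : `|pt t x w| <= `|t| + (`|x| + `|w|).
Proof.
rewrite (le_trans (tcons_norm _ _))// lerD2l.
apply: row_norm_le; first exact: addr_ge0.
move=> j; case: (split_ordP j) => k ->.
  by rewrite row_mxEl (le_trans (row_norm_ge _ _))// lerDl.
by rewrite row_mxEr (le_trans (row_norm_ge _ _))// lerDr.
Qed.

(** The argument of [H a] in the equation of the component [a] of [W]. *)
Definition pull (a : 'I_m) (W : 'rV[R]_n -> 'rV[R]_m) (z : 'rV[R]_(1 + n)) :
    'rV[R]_(1 + (n + m)) :=
  let t := z 0 (lshift n ord0) in let x := rsubmx z in
  pt t x (W (shrink (I a) t x)).

Lemma pullE a W t x : pull a W (tcons t x) = pt t x (W (shrink (I a) t x)).
Proof. by rewrite /pull tconsl /tcons row_mxKr. Qed.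

Lemma csmooth_tau k A j : csmooth k [set: 'rV[R]_(1 + n)]
  (fun z => tau A (z 0 (lshift n ord0)) j).
Proof.
rewrite /tau; case: (j \in A); first by apply: csmooth_coord; exact: openT.
exact: csmooth_cst.
Qed.

Lemma csmooth_shrink k A j : csmooth k [set: 'rV[R]_(1 + n)]
  (fun z => shrink A (z 0 (lshift n ord0)) (rsubmx z) 0 j).
Proof.
rewrite [X in csmooth _ _ X](_ : _ =
   (fun z : 'rV[R]_(1 + n) => c 0 j + tau A (z 0 (lshift n ord0)) j *
    (z 0 (rshift 1 j) - c 0 j))); last by apply/funext => z; rewrite !mxE.
apply: csmooth_add; [exact: openT|exact: csmooth_cst|].
apply: csmooth_mul; [exact: openT|exact: csmooth_tau|].
apply: csmooth_sub; [exact: openT| |exact: csmooth_cst].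
by apply: csmooth_coord; exact: openT.
Qed.

Lemma csmooth_pull k a (W : 'rV[R]_n -> 'rV[R]_m) l :
  (forall b, csmooth k [set: 'rV[R]_n] (fun x => W x 0 b)) ->
  csmooth k [set: 'rV[R]_(1 + n)] (fun z => pull a W z 0 l).
Proof.
move=> sW; case: (split_ordP l) => {}l ->.
  rewrite [X in csmooth _ _ X](_ : _ = (fun z : 'rV[R]_(1 + n) => z 0 (lshift n ord0))).
    by apply: csmooth_coord; exact: openT.
  by apply/funext => z; rewrite /pull /pt tconsl.
case: (split_ordP l) => {}l ->.
  rewrite [X in csmooth _ _ X](_ : _ = (fun z : 'rV[R]_(1 + n) => z 0 (rshift 1 l))).
    by apply: csmooth_coord; exact: openT.
  by apply/funext => z; rewrite /pull /pt tconsr row_mxEl mxE.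
rewrite [X in csmooth _ _ X](_ : _ = (fun z : 'rV[R]_(1 + n) =>
    W (shrink (I a) (z 0 (lshift n ord0)) (rsubmx z)) 0 l)).
  apply: (@csmooth_comp _ _ _ _ setT setT (fun y => W y 0 l)) => //.
  - exact: openT.
  - exact: openT.
  - by move=> j; exact: csmooth_shrink.
by apply/funext => z; rewrite /pull /pt tconsr row_mxEr.
Qed.

Implicit Types (H : 'I_m -> 'rV[R]_(1 + (n + m)) -> R) (W : 'rV[R]_n -> 'rV[R]_m).

Lemma csmooth_pull_comp k a (f : 'rV[R]_(1 + (n + m)) -> R) W :
  (forall b, csmooth k [set: 'rV[R]_n] (fun x => W x 0 b)) ->
  csmooth k setT f -> csmooth k setT (fun z => f (pull a W z)).
Proof.
move=> sW sf; apply: (csmooth_comp _ _ sf) => //.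
- exact: openT.
- exact: openT.
- by move=> l; exact: csmooth_pull.
Qed.

(** The components have different families of segments: that of [a] moves the
    coordinates in [I a]. *)
Definition solves H W := forall a x,
  W x 0 a = int01 (fun t => H a (pt t x (W (shrink (I a) t x)))).

Definition lipschitz_in_value (theta : R) H := forall a t x w w', 0 <= t <= 1 ->
  `|H a (pt t x w) - H a (pt t x w')| <= theta * `|w - w'|.

Lemma csmooth0 k (f : 'rV[R]_k -> R) : csmooth 0 setT f <-> continuous f.
Proof. by split=> [[cf _] x|cf]; [exact: cf|split=> // x _; exact: cf]. Qed.

Lemma integrand_continuous H W a : continuous (H a) -> continuous W ->
  continuous (fun z => H a (pull a W z)).
Proof.
move=> /csmooth0 cH cW; apply/csmooth0; apply: csmooth_pull_comp => // b.
apply/csmooth0 => x; apply: (@continuous_comp _ _ _ W (fun y : 'rV[R]_m => y 0 b)).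
  exact: cW.
exact: coord_continuous.
Qed.

Lemma integrand_continuous_t H W a x : continuous (H a) -> continuous W ->
  continuous (fun t => H a (pt t x (W (shrink (I a) t x)))).
Proof.
move=> cH cW; under eq_fun do rewrite -pullE.
move=> t; apply: (@continuous_comp _ _ _ (tcons ^~ x) (fun z => H a (pull a W z))).
  exact: tcons_continuousl.
exact: integrand_continuous.
Qed.

(** Picard iteration from 0.  All segments stay in any closed ball around [c]
    that contains [x], so on each such ball, by compactness, the increments of the
    iterates decrease geometrically. *)
Theorem exists_solution H theta : (forall a, continuous (H a)) ->
  0 <= theta -> theta < 1 -> lipschitz_in_value theta H ->
  exists W, continuous W /\ solves H W.
Proof.
move=> cH th0 th1 lH.
have th1' : 0 < 1 - theta by rewrite subr_gt0.
pose Psi W x := \row_a int01 (fun t => H a (pt t x (W (shrink (I a) t x)))).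
have cPsi W : continuous W -> continuous (Psi W).
  move=> cW x; apply: row_continuousP => a.
  rewrite [X in {for x, continuous X}](_ : _ =
    (fun x => int01 (fun t => H a (pull a W (tcons t x))))).
    apply: (@int01_continuous _ _ (fun z => H a (pull a W z))).
    exact: integrand_continuous.
  by apply/funext => y; rewrite mxE; apply: eq_int01 => t _; rewrite pullE.
have lPsi W W' r K : continuous W -> continuous W' ->
    (forall x, `|x - c| <= r -> `|W x - W' x| <= K) ->
    forall x, `|x - c| <= r -> `|Psi W x - Psi W' x| <= theta * K.
  move=> cW cW' WK x xr.
  have K0 : 0 <= K by apply: le_trans (WK x xr).
  apply: row_norm_le => [|a]; first exact: mulr_ge0.
  have c1 := @integrand_continuous_t H W a x (cH a) cW.
  have c2 := @integrand_continuous_t H W' a x (cH a) cW'.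
  rewrite !mxE -int01B//; apply: int01_norm => [t|t t01].
    by apply: continuousB; [exact: c1|exact: c2].
  rewrite (le_trans (lH _ _ _ _ _ t01))// ler_wpM2l// WK//.
  exact: le_trans (shrink_norm _ _ t01) xr.
pose Wk k := iter k Psi (fun=> 0).
have cWk k : continuous (Wk k).
  elim: k => [|k IH]; first by move=> x; exact: cst_continuous.
  exact: cPsi.
have bound r : exists2 M, 0 < M & forall k x, `|x - c| <= r ->
    `|Wk k.+1 x - Wk k x| <= M * theta ^+ k.
  have [M M0 MP] : exists2 M, 0 < M & forall x, `|x - c| <= r -> `|Wk 1%N x - Wk 0%N x| <= M.
    have cj a : continuous (fun x => Wk 1%N x 0 a).
      move=> x; apply: (@continuous_comp _ _ _ (Wk 1%N) (fun y : 'rV[R]_m => y 0 a)).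
        exact: cWk.
      exact: coord_continuous.
    have /choice[B BP] : forall a, exists M, 0 < M /\
        forall x, `|x - c| <= r -> `|Wk 1%N x 0 a| <= M.
      by move=> a; have [M M0 MP] := @bounded_cball _ _ _ c r (fun z _ => cj a z); exists M.
    have B0 a : 0 <= B a by case: (BP a) => /ltW.
    exists (1 + \sum_a B a); first by rewrite ltr_pwDl// sumr_ge0.
    move=> x xr; rewrite subr0; apply: row_norm_le.
      by rewrite addr_ge0// sumr_ge0.
    move=> a; rewrite (bigD1 a)//= addrCA (le_trans ((BP a).2 x xr))//.
    by rewrite lerDl addr_ge0// sumr_ge0.
  exists M => //; elim=> [|k IH] x xr; first by rewrite expr0 mulr1 MP.
  by rewrite exprS mulrCA; exact: (lPsi (Wk k.+1) (Wk k) r _ (cWk _) (cWk _) IH).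
have lim1 x a : exists l, forall r M, 0 < M -> `|x - c| <= r ->
   (forall k x, `|x - c| <= r -> `|Wk k.+1 x - Wk k x| <= M * theta ^+ k) ->
   forall k, `|Wk k x 0 a - l| <= M * theta ^+ k / (1 - theta).
  have [M0 M00 MP0] := bound `|x - c|.
  have [|l lP] := @geometric_limit _ (fun k => Wk k x 0 a) M0 theta th0 th1.
    move=> k; apply: le_trans (MP0 k x (lexx _)).
    by have := row_norm_ge (Wk k.+1 x - Wk k x) a; rewrite !mxE.
  exists l => r M M1 xr MP.
  have [|l' lP'] := @geometric_limit _ (fun k => Wk k x 0 a) M theta th0 th1.
    move=> k; apply: le_trans (MP k x xr).
    by have := row_norm_ge (Wk k.+1 x - Wk k x) a; rewrite !mxE.
  suff -> : l = l' by [].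
  apply/eqP; rewrite -subr_eq0 -normr_le0; apply/ler_addgt0Pr => e e0; rewrite add0r.
  have [k kP] := @geometric_small _ ((M0 + M) / (1 - theta)) theta e th0 th1 e0.
  apply: le_trans kP; rewrite mulrAC mulrDl mulrDl -[l - l'](subrKA (Wk k x 0 a)).
  by rewrite (le_trans (ler_normD _ _))// lerD// distrC.
pose W x : 'rV[R]_m := \row_a sval (cid (lim1 x a)).
have WP r : exists2 M, 0 < M & forall k x, `|x - c| <= r -> 
    `|Wk k x - W x| <= M * theta ^+ k.
  have [M M0 MP] := bound r; exists (M / (1 - theta)); first by rewrite divr_gt0.
  move=> k x xr; apply: row_norm_le => [|a].
    by rewrite mulr_ge0 ?exprn_ge0// divr_ge0// ltW.
  rewrite !mxE; case: (cid (lim1 x a)) => l /= /(_ r M M0 xr MP k).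
  by rewrite mulrAC.
have cW : continuous W.
  move=> x; apply/(@continuous_epsP R 'rV[R]_n 'rV[R]_m) => e e0.
  have e3 : 0 < e / 3 by rewrite divr_gt0.
  have [M M0 MP] := WP (`|x - c| + 1).
  have [k kP] := @geometric_small _ M theta (e / 3) th0 th1 e3.
  have /(@continuous_epsP R 'rV[R]_n 'rV[R]_m) /(_ _ e3)[d d0 dP] := cWk k x.
  exists (Num.min d 1); first by rewrite lt_min d0 ltr01.
  move=> y; rewrite lt_min => /andP[yd y1].
  have yr : `|y - c| <= `|x - c| + 1.
    by rewrite -[y - c](subrKA x) (le_trans (ler_normD _ _))// addrC lerD2l ltW.
  have xr : `|x - c| <= `|x - c| + 1 by rewrite lerDl.
  have h1 := le_trans (MP k y yr) kP; have h2 := le_trans (MP k x xr) kP.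
  have h3 := dP y yd.
  rewrite -[W y - W x](subrKA (Wk k y)) (le_trans (ler_normD _ _))//.
  rewrite -[Wk k y - W x](subrKA (Wk k x)) distrC.
  have := ler_normD (Wk k y - Wk k x) (Wk k x - W x); lra.
exists W; split=> // a x.
apply/eqP; rewrite -subr_eq0 -normr_le0; apply/ler_addgt0Pr => e e0; rewrite add0r.
have [M M0 MP] := WP `|x - c|.
have [k kP] := @geometric_small _ (M * 2) theta e th0 th1 e0.
have h1 := MP k.+1 x (lexx _).
have h2 := @lPsi (Wk k) W _ _ (cWk k) cW (MP k) x (lexx _).
have h3 : M * theta ^+ k.+1 <= M * theta ^+ k.
  by rewrite ler_wpM2l ?(ltW M0)// exprS ler_piMl ?exprn_ge0// ltW.
have h4 : theta * (M * theta ^+ k) <= M * theta ^+ k.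
  by rewrite ler_piMl ?(ltW th1)// mulr_ge0 ?exprn_ge0// ltW.
have g1 := row_norm_ge (Wk k.+1 x - W x) a.
have g2 := row_norm_ge (Psi (Wk k) x - Psi W x) a.
have PW : Psi W x 0 a = int01 (fun t => H a (pt t x (W (shrink (I a) t x)))).
  by rewrite mxE.
have mB (u v : 'rV[R]_m) : (u - v) 0 a = u 0 a - v 0 a by rewrite !mxE.
rewrite -PW; move: g1 g2; rewrite !mB.
have -> : Wk k.+1 x = Psi (Wk k) x by [].
move=> g1 g2; rewrite -[W x 0 a - _](subrKA (Psi (Wk k) x 0 a)).
rewrite (le_trans (ler_normD _ _))// distrC; lra.
Qed.

End IntegralEquation.

(** * Integral equations along rays: regularity *)
Lemma continuous_mulc (R : realType) (a : R) (f : R -> R) :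
  continuous f -> continuous (fun t => a * f t).
Proof. by move=> cf t; apply: cvgM; [exact: cvg_cst|exact: cf]. Qed.

Lemma continuous_sub (R : realType) (f g : R -> R) :
  continuous f -> continuous g -> continuous (fun t => f t - g t).
Proof. by move=> cf cg t; apply: cvgB; [exact: cf|exact: cg]. Qed.

Lemma is_derive_eps (R : realType) (V : normedModType R) (f : V -> R) x v l :
  (forall e : R, 0 < e -> exists2 d : R, 0 < d & forall h, `|h| < d ->
     `|f (x + h *: v) - f x - h * l| <= e * `|h|) ->
  is_derive x v f l.
Proof.
move=> H.
have cv : (fun h : R => h^-1 *: ((f \o shift x) (h *: v) - f x)) @ 0^' --> l.
  apply/cvgrPdist_le => e e0; have [d d0 dP] := H _ e0.
  near=> h.
  have h0 : h != 0 by near: h; exact: nbhs_dnbhs_neq.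
  have hd : `|h| < d by near: h; exact: dnbhs0_lt.
  have -> : l - h^-1 *: ((f \o shift x) (h *: v) - f x) =
      - h^-1 * (f (x + h *: v) - f x - h * l).
    rewrite /= [h *: v + x]addrC; have -> (y : R) : h^-1 *: y = h^-1 * y by [].
    by field.
  rewrite normrM normrN normfV mulrC ler_pdivrMr ?normr_gt0//; exact: dP.
by split; [apply/cvg_ex; exists l|exact: cvg_lim cv].
Unshelve. all: by end_near. Qed.

Lemma derive_norm_le (R : realType) (V : normedModType R) (f : V -> R) x v K :
  derivable f x v -> (forall h, `|f (x + h *: v) - f x| <= K * `|h|) ->
  `|'D_v f x| <= K.
Proof.
move=> df fK.
have near_le : \forall h \near 0^',
    `|h^-1 *: ((f \o shift x) (h *: v) - f x)| <= K.
  near=> h.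
  have h0 : h != 0 by near: h; exact: nbhs_dnbhs_neq.
  rewrite normrZ normfV ler_pdivrMl ?normr_gt0//= [h *: v + x]addrC mulrC.
  exact: fK.
rewrite ler_norml; apply/andP; split.
- apply: limr_ge => //; apply: filterS near_le => h.
  by rewrite ler_norml => /andP[].
- apply: limr_le => //; apply: filterS near_le => h.
  by rewrite ler_norml => /andP[].
Unshelve. all: by end_near. Qed.

Lemma finite_lower_bound (R : realType) (T : finType) (d : T -> R) :
  (forall i, 0 < d i) -> exists2 d0, 0 < d0 & forall i, d0 <= d i.
Proof.
move=> d0; exists (\big[Num.min/1]_i d i).
  by apply: lt_bigmin => // i _.
by move=> i; exact: bigmin_le_cond.
Qed.

(** A common bound for a finite family of monotone conditions. *)
Lemma finite_upper_bound (R : realType) (T : finType) (P : T -> R -> Prop) :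
  (forall i M M', M <= M' -> P i M -> P i M') ->
  (forall i, exists M, P i M) -> exists2 M, 0 < M & forall i, P i M.
Proof.
move=> mono /choice[B BP].
exists (1 + \sum_i `|B i|); first by rewrite ltr_pwDl// sumr_ge0.
move=> i; apply: mono (BP i); rewrite (bigD1 i)//= addrCA.
by rewrite (le_trans (ler_norm _))// lerDl addr_ge0// sumr_ge0.
Qed.

Lemma row_comp_continuous (R : realType) n m (W : 'rV[R]_n -> 'rV[R]_m) b :
  continuous W -> continuous (fun x => W x 0 b).
Proof.
move=> cW x; apply: (@continuous_comp _ _ _ W (fun y : 'rV[R]_m => y 0 b)).
  exact: cW.
exact: coord_continuous.
Qed.

Lemma bounded_cball_row (R : realType) n m (W : 'rV[R]_n -> 'rV[R]_m) c r :
  continuous W -> exists2 M, 0 < M & forall z, `|z - c| <= r -> `|W z| <= M.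
Proof.
move=> cW.
have [b M M' MM' MP|b|M M0 MP] := @finite_upper_bound R 'I_m
  (fun b M => forall z, `|z - c| <= r -> `|W z 0 b| <= M).
- by move=> z /MP /le_trans; exact.
- have [M M0 MP] := @bounded_cball _ _ _ c r (fun z _ => @row_comp_continuous _ _ _ W b cW z).
  by exists M.
- exists M => // z zr; apply: row_norm_le; first exact: ltW.
  by move=> j; exact: MP.
Qed.

Lemma unif_cont_cball_fin (R : realType) m (T : finType) (f : T -> 'rV[R]_m -> R)
    c r e : (forall i z, `|z - c| <= r -> {for z, continuous (f i)}) -> 0 < e ->
  exists2 d, 0 < d & forall i z z', `|z - c| <= r -> `|z' - z| < d ->
    `|f i z' - f i z| < e.
Proof.
move=> cf e0.
have /choice[d dP] i : exists d, 0 < d /\ forall z z', `|z - c| <= r ->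
    `|z' - z| < d -> `|f i z' - f i z| < e.
  by have [d d0 dP] := unif_cont_cball (cf i) e0; exists d.
have [d0 d00 d0P] := finite_lower_bound (fun i => (dP i).1).
exists d0 => // i z z' zr zz'; apply: (dP i).2 => //.
exact: lt_le_trans zz' (d0P i).
Qed.

Section Regularity.
Context {R : realType} {n m : nat}.
Variables (c : 'rV[R]_n) (I : 'I_m -> {set 'I_n}).
Implicit Types (H : 'I_m -> 'rV[R]_(1 + (n + m)) -> R) (W P : 'rV[R]_n -> 'rV[R]_m).

Let ptime (z : 'rV[R]_(1 + (n + m))) := z 0 (lshift (n + m) ord0).
Let pspace (z : 'rV[R]_(1 + (n + m))) : 'rV[R]_n := lsubmx (rsubmx z).
Let pval (z : 'rV[R]_(1 + (n + m))) : 'rV[R]_m := rsubmx (rsubmx z).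

(** The derivative along [e_k] of the argument [pull] of [H a], when [z] carries
    the value of the derivative of the unknown at the shrunk point. *)
Definition velocity (k : 'I_n) (a : 'I_m) (z : 'rV[R]_(1 + (n + m))) :
    'rV[R]_(1 + (n + m)) :=
  pt 0 (delta_mx 0 k) (tau (I a) (ptime z) k *: pval z).

(** The integrand of the equation obtained by differentiating formally the
    equation of [W] along [e_k], with the derivative of [W] as new unknown. *)
Definition linearized H W (k : 'I_n) (a : 'I_m) (z : 'rV[R]_(1 + (n + m))) : R :=
  \sum_l velocity k a z 0 l *
    'D_(delta_mx 0 l) (H a) (pull c I a W (tcons (ptime z) (pspace z))).

Lemma csmooth_differentiable (k : nat) (f : 'rV[R]_k -> R) x :
  csmooth 1 setT f -> differentiable f x.
Proof. by move=> sf; apply: c1_differentiable sf _ => //; exact: openT. Qed.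

Lemma linearizedE H W k a t x p : csmooth 1 setT (H a) ->
  linearized H W k a (pt t x p) =
  'D_(pt 0 (delta_mx 0 k) (tau (I a) t k *: p)) (H a) (pt t x (W (shrink c (I a) t x))).
Proof.
move=> sH; rewrite derive_diff_sum; last exact: csmooth_differentiable.
rewrite /linearized.
have -> : ptime (pt t x p) = t by rewrite /ptime tconsl.
have -> : pspace (pt t x p) = x by rewrite /pspace /pt /tcons row_mxKr row_mxKl.
rewrite pullE /velocity.
have -> : ptime (pt t x p) = t by rewrite /ptime tconsl.
by have -> : pval (pt t x p) = p by rewrite /pval /pt /tcons !row_mxKr.
Qed.

Lemma csmooth_linearized j H W k a : csmooth j.+1 setT (H a) ->
  (forall b, csmooth j [set: 'rV[R]_n] (fun x => W x 0 b)) ->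
  csmooth j setT (linearized H W k a).
Proof.
move=> sH sW; apply: csmooth_sum => [|l _]; first exact: openT.
apply: csmooth_mul; first exact: openT.
  rewrite /velocity /pt; case: (split_ordP l) => {}l ->.
    rewrite [X in csmooth _ _ X](_ : _ = fun=> 0); first exact: csmooth_cst.
    by apply/funext => z; rewrite tconsl.
  case: (split_ordP l) => {}l ->.
    rewrite [X in csmooth _ _ X](_ : _ = fun=> (delta_mx 0 k : 'rV[R]_n) 0 l).
      exact: csmooth_cst.
    by apply/funext => z; rewrite tconsr row_mxEl.
  rewrite [X in csmooth _ _ X](_ : _ = (fun z : 'rV[R]_(1 + (n + m)) =>
      tau (I a) (z 0 (lshift (n + m) ord0)) k * z 0 (rshift 1 (rshift n l)))).
    apply: csmooth_mul; first exact: openT.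
      rewrite /tau; case: (k \in I a); last exact: csmooth_cst.
      by apply: csmooth_coord; exact: openT.
    by apply: csmooth_coord; exact: openT.
  by apply/funext => z; rewrite tconsr row_mxEr !mxE.
pose Q (z : 'rV[R]_(1 + (n + m))) : 'rV[R]_(1 + n) := tcons (ptime z) (pspace z).
apply: (@csmooth_comp _ _ _ _ setT setT
  (fun y => 'D_(delta_mx 0 l) (H a) (pull c I a W y)) Q) => //.
- exact: openT.
- exact: openT.
- by apply: (@csmooth_pull_comp R n m c I j a ('D_(delta_mx 0 l) (H a)) W) => //; exact: csmoothD.
move=> i; rewrite /Q; case: (split_ordP i) => {}i ->.
  rewrite [X in csmooth _ _ X](_ : _ = (fun z : 'rV[R]_(1 + (n + m)) =>
      z 0 (lshift (n + m) ord0))).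
    by apply: csmooth_coord; exact: openT.
  by apply/funext => z; rewrite tconsl.
rewrite [X in csmooth _ _ X](_ : _ = (fun z : 'rV[R]_(1 + (n + m)) =>
      z 0 (rshift 1 (lshift m i)))).
  by apply: csmooth_coord; exact: openT.
by apply/funext => z; rewrite tconsr !mxE.
Qed.

Lemma lipschitz_derive H theta a t x w q : 0 <= t <= 1 -> csmooth 1 setT (H a) ->
  lipschitz_in_value theta H -> `|'D_(pt 0 0 q) (H a) (pt t x w)| <= theta * `|q|.
Proof.
move=> t01 sH lH.
apply: derive_norm_le; first exact/diff_derivable/csmooth_differentiable.
move=> h; rewrite ptZ ptD scaler0 mulr0 !addr0 (le_trans (lH _ _ _ _ _ t01))//.
by rewrite addrAC subrr add0r normrZ mulrCA mulrC.
Qed.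

Lemma deriveB_dir (k : nat) (f : 'rV[R]_k -> R) x u v : differentiable f x ->
  'D_(u - v) f x = 'D_u f x - 'D_v f x.
Proof. by move=> df; rewrite !deriveE// linearB. Qed.

(** The linearized equation inherits the contraction constant, since the new
    unknown enters through the derivative of [H] in its value argument only. *)
Lemma lipschitz_linearized H W theta k : 0 <= theta ->
  (forall a, csmooth 1 setT (H a)) -> lipschitz_in_value theta H ->
  lipschitz_in_value theta (linearized H W k).
Proof.
move=> th0 sH lH a t x p p' t01.
rewrite !linearizedE// -deriveB_dir; last exact: csmooth_differentiable.
have -> : pt 0 (delta_mx 0 k) (tau (I a) t k *: p) -
   pt 0 (delta_mx 0 k) (tau (I a) t k *: p') = pt 0 0 (tau (I a) t k *: (p - p')).
  by rewrite -scaleN1r ptZ ptD mulr0 addr0 !scaleN1r subrr -scalerBr.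
apply: (le_trans (@lipschitz_derive H theta a t x _ _ t01 (sH a) lH)).
rewrite ler_wpM2l//.
by rewrite normrZ ler_piMl// tau_norm.
Qed.

(** First-order expansion of [H a] with an error controlled by the oscillation
    of its partial derivatives. *)
Lemma increment_eps H (a : 'I_m) z v M e : csmooth 1 setT (H a) -> 0 < M ->
  `|v| <= M -> 0 <= e ->
  forall d h : R, `|h| * M < d ->
  (forall l z', `|z' - z| < d ->
     `|'D_(delta_mx 0 l) (H a) z' - 'D_(delta_mx 0 l) (H a) z| <= e) ->
  `|H a (z + h *: v) - H a z - h * 'D_v (H a) z| <= (1 + (n + m))%:R * M * e * `|h|.
Proof.
move=> sH M0 vM e0 d h hd D.
have dH y : differentiable (H a) y by exact: csmooth_differentiable.
have [s _|s sh ->] := @mvt_line _ _ (H a) z v h; first exact: diff_derivable.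
rewrite -mulrBr normrM mulrC ler_wpM2r//.
rewrite !derive_diff_sum// -sumrB.
apply: le_trans (ler_norm_sum _ _ _) _.
have -> : (1 + (n + m))%:R * M * e = \sum_(l < 1 + (n + m)) (M * e).
  by rewrite sumr_const card_ord -mulrA mulr_natl.
apply: ler_sum => l _; rewrite -mulrBr normrM ler_pM//.
  by rewrite (le_trans (row_norm_ge _ _)).
apply: D; rewrite [z + _]addrC addrK normrZ (le_lt_trans _ hd)//.
by rewrite ler_pM.
Qed.

(** The remainder [W (x + h e_k) - W x - h P x] satisfies, by the two equations,
    an estimate in which it reappears multiplied by [theta], up to the
    first-order error of [H], which is small relative to [h] uniformly on a
    ball.  The contraction argument then bounds it by a small multiple of [h].
    The remainder has to be estimated for all increments [s] with
    [`|s| <= `|h|] at once, since the segments turn [h] into [tau * h]. *)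
Theorem solution_derive H W P theta k :
  (forall a, csmooth 1 setT (H a)) -> 0 <= theta -> theta < 1 ->
  lipschitz_in_value theta H -> continuous W -> continuous P ->
  solves c I H W -> solves c I (linearized H W k) P ->
  forall x a, is_derive x (delta_mx 0 k) (fun y => W y 0 a) (P x 0 a).
Proof.
move=> sH th0 th1 lH cW cP sW sP x0 a0.
have th1' : 0 < 1 - theta by rewrite subr_gt0.
set e_k : 'rV[R]_n := delta_mx 0 k.
have ek1 : `|e_k| <= 1.
  apply: row_norm_le => // j; rewrite !mxE eqxx /=.
  by case: eqP => _; rewrite ?normr1 ?normr0.
pose r := `|x0 - c| + 1.
have [Mw Mw0 MwP] := bounded_cball_row c r cW.
have [Mp Mp0 MpP] := bounded_cball_row c r cP.
pose N : R := (1 + (n + m))%:R.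
have N0 : 0 < N by rewrite ltr0n.
pose M := 1 + Mp; have M0 : 0 < M by rewrite addr_gt0.
have cH a : continuous (H a) by move=> z; exact: csmooth_continuous (sH a) _.
have cL a : continuous (linearized H W k a).
  apply/csmooth0; apply: csmooth_linearized => // b; apply/csmooth0.
  exact: row_comp_continuous.
suff claim e : 0 < e -> exists2 d, 0 < d & forall h x, `|h| < d -> `|x - c| <= r ->
    `|x + h *: e_k - c| <= r -> `|W (x + h *: e_k) - W x - h *: P x| <= e * `|h|.
  apply: is_derive_eps => e /claim[d d0 dP].
  exists (Num.min d 1); first by rewrite lt_min d0 ltr01.
  move=> h; rewrite lt_min => /andP[hd h1].
  have xr : `|x0 - c| <= r by rewrite /r lerDl.
  have xhr : `|x0 + h *: e_k - c| <= r.
    rewrite addrAC (le_trans (ler_normD _ _))// lerD2l normrZ.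
    by rewrite -[1]mulr1 ler_pM// ltW.
  apply: le_trans (dP h x0 hd xr xhr).
  by have := row_norm_ge (W (x0 + h *: e_k) - W x0 - h *: P x0) a0; rewrite !mxE.
move=> e0.
pose e1 := e * (1 - theta) / (N * M).
have e10 : 0 < e1 by rewrite divr_gt0 ?mulr_gt0.
have e1E : N * M * e1 = e * (1 - theta).
  by rewrite /e1 mulrC divfK// gt_eqF// mulr_gt0.
pose Rz := 1 + ((r + `|c|) + Mw).
have [|d d0 dP] := @unif_cont_cball_fin R _ ('I_m * 'I_(1 + (n + m)))%type
   (fun al => 'D_(delta_mx 0 al.2) (H al.1)) 0 Rz e1 _ e10.
  by move=> al z _; exact: csmooth_continuous (csmoothD al.2 (sH al.1)) _.
exists (d / M); first by rewrite divr_gt0.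
move=> h x hd xr xhr.
pose S (p : 'rV[R]_n * R) := [/\ `|p.2| <= `|h|, `|p.1 - c| <= r &
   `|p.1 + p.2 *: e_k - c| <= r].
pose f (p : 'rV[R]_n * R) := `|W (p.1 + p.2 *: e_k) - W p.1 - p.2 *: P p.1|.
have fE : e * (1 - theta) * `|h| / (1 - theta) = e * `|h|.
  by field; rewrite gt_eqF.
have Sxh : S (x, h) by split.
have fB s : S s -> f s <= Mw + Mw + `|h| * Mp.
  case: s => [y s] [/= sh yr ysr]; rewrite /f (le_trans (ler_normB _ _))//.
  rewrite lerD//; last by rewrite normrZ ler_pM// MpP.
  by rewrite (le_trans (ler_normB _ _))// lerD// MwP.
rewrite -fE; apply: (contraction_bound th1 fB _ Sxh).
move=> K KP [y s] [/= sh yr ysr].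
have K0 : 0 <= K by apply: le_trans (KP (x, h) Sxh); exact: normr_ge0.
rewrite /f /=.
apply: row_norm_le => [|a].
  by rewrite addr_ge0 ?mulr_ge0// ltW// mulr_gt0.
have c1 := @integrand_continuous_t R n m c I H W a (y + s *: e_k) (cH a) cW.
have c2 := @integrand_continuous_t R n m c I H W a y (cH a) cW.
have c3 := @integrand_continuous_t R n m c I (linearized H W k) P a y (cL a) cP.
have mB (u v : 'rV[R]_m) : (u - v) 0 a = u 0 a - v 0 a by rewrite !mxE.
have mZ (u : 'rV[R]_m) : (s *: u) 0 a = s * u 0 a by rewrite !mxE.
rewrite !mB mZ !sW sP -int01Z// -!int01B//; last 2 first.
- exact: (continuous_sub c1 c2).
- exact: (continuous_mulc c3).
apply: int01_norm => [|t t01].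
  exact: (continuous_sub (continuous_sub c1 c2) (continuous_mulc c3)).
rewrite linearizedE// shrink_delta.
set y' := shrink c (I a) t y; set T := tau (I a) t k.
have y'r : `|y' - c| <= r by apply: le_trans (shrink_norm _ _ _ t01) yr.
have S' : S (y', T * s).
  split => //=.
  - rewrite normrM -[leRHS]mul1r ler_pM//; exact: tau_norm.
  - rewrite -shrink_delta; exact: le_trans (shrink_norm _ _ _ t01) ysr.
have := KP _ S'; rewrite /f /= => Kt.
set v := pt 0 e_k (T *: P y').
have vM : `|v| <= M.
  rewrite (le_trans (pt_norm _ _ _))// normr0 add0r lerD//.
  rewrite normrZ -[leRHS]mul1r ler_pM ?tau_norm// MpP//.
have z1 : pt t (y + s *: e_k) (W y' + s *: (T *: P y')) = pt t y (W y') + s *: v.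
  by rewrite /v ptZ ptD mulr0 addr0.
have h1 : `|H a (pt t (y + s *: e_k) (W (y' + (T * s) *: e_k))) -
           H a (pt t y (W y') + s *: v)| <= theta * K.
  rewrite -z1 (le_trans (lH _ _ _ _ _ t01))// ler_wpM2l//.
  by rewrite opprD addrA scalerA [s * T]mulrC.
have h2 : `|H a (pt t y (W y') + s *: v) - H a (pt t y (W y')) -
   s * 'D_v (H a) (pt t y (W y'))| <= e * (1 - theta) * `|h|.
  apply: (le_trans (@increment_eps H a _ v M e1 (sH a) M0 vM (ltW e10) d s _ _)).
  - apply: le_lt_trans (_ : `|h| * M < d); first by rewrite ler_wpM2r// ltW.
    by rewrite -ltr_pdivlMr.
  - move=> l z' z'z; apply/ltW/(dP (a, l)) => //=.
    rewrite subr0 (le_trans (pt_norm _ _ _))// /Rz.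
    have /andP[t0 t1] := t01; rewrite ger0_norm// lerD// lerD//; last exact: MwP.
    by rewrite -[y](subrK c) (le_trans (ler_normD _ _))// lerD2r.
  - by rewrite -/N e1E ler_wpM2l// ltW// mulr_gt0.
have split_diff (X V Y Z : R) : X - Y - Z = (X - V) + (V - Y - Z) by ring.
rewrite -/e_k (split_diff _ (H a (pt t y (W y') + s *: v))).
by rewrite (le_trans (ler_normD _ _))// lerD.
Qed.

(** Induction on [k], for all equations at once: the derivative of [W] solves the
    linearized equation, whose integrand is as regular as [W] and the first
    derivatives of [H]. *)
Theorem solution_csmooth theta : 0 <= theta -> theta < 1 ->
  forall k H W, (forall a, csmooth k setT (H a)) -> lipschitz_in_value theta H ->
  continuous W -> solves c I H W ->
  forall a, csmooth k [set: 'rV[R]_n] (fun x => W x 0 a).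
Proof.
move=> th0 th1; elim=> [|k IH] H W sH lH cW sW a.
  by apply/csmooth0; exact: row_comp_continuous.
have sWk := IH H W (fun a => csmoothW (sH a)) lH cW sW.
have sH1 b : csmooth 1 setT (H b) by exact: csmooth_le (sH b).
have sL j b : csmooth k setT (linearized H W j b) by exact: csmooth_linearized.
have lL j : lipschitz_in_value theta (linearized H W j) by exact: lipschitz_linearized.
have /choice[P PP] j : exists P, continuous P /\ solves c I (linearized H W j) P.
  apply: exists_solution th0 th1 (lL j) => b x.
  exact: csmooth_continuous (sL j b) _.
apply: (@csmooth_mk _ _ _ _ _ (fun j x => P j x 0 a)).
- exact: openT.
- by move=> x _; exact: row_comp_continuous.
- move=> j x _; have [cP sP] := PP j.
  exact: solution_derive sH1 th0 th1 lH cW cP sW sP x a.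
- move=> j; have [cP sP] := PP j.
  exact: IH (sL j) (lL j) cP sP a.
Qed.

End Regularity.

Lemma int01_derive (R : realType) n (G : 'rV[R]_(1 + n) -> R) (k : 'I_n) x :
  csmooth 1 setT G ->
  is_derive x (delta_mx 0 k) (fun y => int01 (fun t => G (tcons t y)))
    (int01 (fun t => 'D_(delta_mx 0 (rshift 1 k)) G (tcons t x))).
Proof.
move=> sG; set e_k : 'rV[R]_n := delta_mx 0 k; set E := delta_mx 0 (rshift 1 k).
have cc (F : 'rV[R]_(1 + n) -> R) y : continuous F -> continuous (fun t => F (tcons t y)).
  move=> cF t; apply: (@continuous_comp _ _ _ (tcons ^~ y) F).
    exact: tcons_continuousl.
  exact: cF.
have cG : continuous G by move=> z; exact: csmooth_continuous sG _.
have cD : continuous ('D_E G) by move=> z; exact: csmooth_continuous (csmoothD _ sG) _.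
have E1 : `|E| <= 1.
  apply: row_norm_le => // j; rewrite !mxE eqxx /=.
  by case: eqP => _; rewrite ?normr1 ?normr0.
apply: is_derive_eps => e e0.
have [d d0 dP] := unif_cont_cball (c := 0) (r := 1 + `|x|) (fun z _ => cD z) e0.
exists d => // h hd.
have c1 := cc G (x + h *: e_k) cG; have c2 := cc G x cG.
have c3 := cc _ x cD; have c4 := @continuous_mulc R h _ c3.
have c5 := continuous_sub c1 c2.
rewrite -(int01Z h c3) -(int01B c1 c2) -(int01B c5 c4).
apply: int01_norm => [|t /andP[t0 t1]]; first exact: (continuous_sub c5 c4).
rewrite tcons_delta.
have [s _|s sh ->] := @mvt_line _ _ G (tcons t x) E h.
  by apply: csmooth_derivable sG _.
rewrite -mulrBr normrM mulrC ler_wpM2r// ltW// dP//.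
  by rewrite subr0 (le_trans (tcons_norm _ _))// lerD// ger0_norm.
rewrite addrAC subrr add0r normrZ (le_lt_trans _ hd)//.
by rewrite -[leRHS]mulr1 ler_pM.
Qed.

(** * Smooth cut-offs *)
Section Clamp.
Context {R : realType}.

Definition pospart (u : R) : R := Num.max u 0.

Lemma pospart_ge0 u : 0 <= pospart u.
Proof. by rewrite /pospart le_max lexx orbT. Qed.

Lemma pospart_le_norm u : pospart u <= `|u|.
Proof. by rewrite /pospart ge_max normr_ge0 ler_norm. Qed.

Lemma pospart_continuous : continuous pospart.
Proof.
move=> u; apply: continuous_max => [|]; [exact: id|exact: cst_continuous].
Qed.

Lemma is_derive_pospartX p u :
  is_derive u (1 : R) (fun x => pospart x ^+ p.+2) (p.+2%:R * pospart u ^+ p.+1).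
Proof.
have [u0|u0|->] := ltgtP u 0.
- rewrite /pospart (max_r (ltW u0)) expr0n /= mulr0.
  apply: near_eq_is_derive (is_derive_cst 0 _ _).
  by near=> x; rewrite max_r ?expr0n// ltW//; near: x; exact: lt_nbhsl.
- rewrite /pospart (max_l (ltW u0)).
  have dX : is_derive u (1 : R) (fun x : R => x ^+ p.+2) (p.+2%:R * u ^+ p.+1).
    have h := @is_deriveX R R id p.+2 u 1 1 (is_derive_id _ _).
    rewrite exprfctE in h; apply: is_derive_eq h _.
    by rewrite [_ *: _]mulr1.
  apply: near_eq_is_derive dX.
  by near=> x; rewrite max_l// ltW//; near: x; exact: lt_nbhsr.
- have -> : pospart 0 = 0 by rewrite /pospart maxxx.
  rewrite expr0n mulr0; apply: is_derive_eps => e e0.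
  exists (Num.min e 1); first by rewrite lt_min e0 ltr01.
  move=> h; rewrite lt_min => /andP[he h1].
  rewrite [h *: 1]mulr1 add0r mulr0 subr0.
  have -> : pospart 0 = 0 by rewrite /pospart maxxx.
  rewrite expr0n subr0 normrX (ger0_norm (pospart_ge0 h)) exprS.
  have rh := pospart_le_norm h.
  rewrite mulrC ler_pM ?exprn_ge0 ?pospart_ge0// exprS.
  rewrite (le_trans _ (ltW he))// (le_trans _ rh)//.
  by rewrite ler_piMr ?pospart_ge0// exprn_ile1 ?pospart_ge0// (le_trans rh)// ltW.
Unshelve. all: by end_near. Qed.

Lemma is_derive_comp1 (V : normedModType R) (f : V -> R) (g : R -> R) dg x v : derivable f x v ->
  is_derive (f x) (1 : R) g dg -> is_derive x v (fun y => g (f y)) ('D_v f x * dg).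
Proof.
move=> df [dg1 <-]; have dG : differentiable g (f x) by exact/derivable1_diffP.
apply: is_derive_eq (is_derive_comp_diff dG df) _.
rewrite !(deriveE _ dG) -[X in 'd g _ X = _]mulr1.
by rewrite [LHS]linearZ.
Qed.

Context {m : nat}.
Implicit Types (A : set 'rV[R]_m) (f : 'rV[R]_m -> R).

Lemma csmooth_pospart k p A f : open A -> csmooth k A f ->
  csmooth k A (fun x => pospart (f x) ^+ (k + p).+1).
Proof.
move=> oA.
have cpospartX q (g : 'rV[R]_m -> R) x : {for x, continuous g} ->
    {for x, continuous (fun y => pospart (g y) ^+ q)}.
  move=> cg; apply: (@continuous_comp _ _ _ g (fun u => pospart u ^+ q)) => //.
  apply: (@continuous_comp _ _ _ pospart (fun u : R => u ^+ q)).
    exact: pospart_continuous.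
  exact: exprn_continuous.
elim: k p f => [|k IH] p f sf.
  by split=> // x Ax; apply: cpospartX; exact: csmooth_continuous sf Ax.
apply: (@csmooth_mk _ _ _ _ _ (fun j x => 'D_(delta_mx 0 j) f x *
   ((k + p).+2%:R * pospart (f x) ^+ (k + p).+1))) => //.
- by move=> x Ax; apply: cpospartX; exact: csmooth_continuous sf Ax.
- move=> j x Ax; have dfx : derivable f x (delta_mx 0 j) by exact: csmooth_derivable sf Ax.
  exact: (is_derive_comp1 dfx (is_derive_pospartX (k + p) (f x))).
- move=> j; apply: csmooth_mul => //; first exact: csmoothD.
  apply: csmooth_mul => //; first exact: csmooth_cst.
  by apply: IH; exact: csmoothW.
Qed.

Lemma csmooth_inv k A f : open A -> (forall x, A x -> f x != 0) ->
  csmooth k A f -> csmooth k A (fun x => (f x)^-1).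
Proof.
move=> oA f0; elim: k => [|k IH] sf.
  split=> // x Ax; apply: continuousV; first exact: f0.
  exact: csmooth_continuous sf Ax.
have sV := IH (csmoothW sf).
apply: (@csmooth_mk _ _ _ _ _ (fun j x => - ((f x)^-1 * (f x)^-1) * 'D_(delta_mx 0 j) f x)) => //.
- move=> x Ax; apply: continuousV; first exact: f0.
  exact: csmooth_continuous sf Ax.
- move=> j x Ax; have dfx : derivable f x (delta_mx 0 j) by exact: csmooth_derivable sf Ax.
  split; first exact: derivableV (f0 _ Ax) dfx.
  by rewrite (deriveV (f0 _ Ax) dfx) -exprVn expr2.
- move=> j; apply: csmooth_mul => //; last exact: csmoothD.
  by apply: csmooth_opp => //; exact: csmooth_mul.
Qed.

(** The identity on [-1, 1], bounded, Lipschitz, and of class C^2 because the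
    cube of the positive part is. *)
Definition clamp (s : R) : R := s * (1 + pospart (s * s - 1) ^+ 3)^-1.

Lemma clamp_den_gt0 s : 0 < 1 + pospart (s * s - 1) ^+ 3.
Proof. by rewrite ltr_pwDl// exprn_ge0// pospart_ge0. Qed.

Lemma clamp_id s : `|s| <= 1 -> clamp s = s.
Proof.
move=> s1; rewrite /clamp /pospart max_r; last first.
  by move: s1; rewrite ler_norml => /andP[h1 h2]; nra.
by rewrite expr0n addr0 invr1 mulr1.
Qed.

Lemma clamp_le2 s : `|clamp s| <= 2.
Proof.
have d0 := clamp_den_gt0 s.
rewrite /clamp normrM normfV (gtr0_norm d0) ler_pdivrMr//.
have b0 := pospart_ge0 (s * s - 1).
have b1 : s * s - 1 <= pospart (s * s - 1) by rewrite /pospart le_max lexx.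
move: (pospart _) b0 b1 d0 => b b0 b1 d0.
have n0 := normr_ge0 s; have : `|s| * `|s| = s * s by rewrite -normrM ger0_norm// -expr2 sqr_ge0.
move: `|s| n0 => a a0 as2.
have : b <= 1 + b ^+ 3.
  have [b1'|b1'] := leP b 1; first by rewrite (le_trans b1')// lerDl exprn_ge0.
  by rewrite ltW// ltr_pwDl// exprS ler_peMr// exprn_ege1// ltW.
have : 0 <= b ^+ 3 by rewrite exprn_ge0.
by move: (b ^+ 3) (sqr_ge0 (a - 1)) => q; rewrite expr2 => *; nra.
Qed.

Lemma csmooth_clamp k A f : (k <= 2)%N -> open A -> csmooth k A f ->
  csmooth k A (fun x => clamp (f x)).
Proof.
move=> k2 oA sf; apply: csmooth_mul => //; apply: csmooth_inv => //.
  by move=> x _; rewrite gt_eqF// clamp_den_gt0.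
apply: csmooth_add => //; first exact: csmooth_cst.
have -> : 3%N = (k + (2 - k)).+1 by rewrite subnKC.
apply: (@csmooth_pospart _ _ _ (fun x => f x * f x - 1)) => //.
by apply: csmooth_sub => //; [exact: csmooth_mul|exact: csmooth_cst].
Qed.

(** With b the positive part of s^2 - 1, the derivative is 1 if b = 0, and
    (1 + b^3 - 6 (1 + b) b^2) / (1 + b^3)^2 otherwise. *)
Lemma clamp_lipschitz s s' : `|clamp s - clamp s'| <= 13 * `|s - s'|.
Proof.
pose b s := pospart (s * s - 1); pose D s := 1 + b s ^+ 3.
pose dc s := s * (- ((D s)^-1 * (D s)^-1) * ((1 * s + 1 * s) * (3 * b s ^+ 2))) + (D s)^-1.
have der t : is_derive t (1 : R) clamp (dc t).
  have d0 : D t != 0 by rewrite gt_eqF// clamp_den_gt0.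
  have dq : is_derive t (1 : R) (fun s : R => s * s - 1) (1 * t + 1 * t).
    have dm := is_deriveM (is_derive_id t (1 : R)) (is_derive_id t (1 : R)).
    have ds := is_deriveB dm (is_derive_cst (1 : R) t (1 : R)).
    by apply: is_derive_eq ds _; rewrite subr0 ![t *: 1]mulrC.
  have db : is_derive t (1 : R) (fun s => b s ^+ 3) ((1 * t + 1 * t) * (3 * b t ^+ 2)).
    case: dq => dq1 dq2; rewrite -dq2.
    exact: (is_derive_comp1 dq1 (is_derive_pospartX 1 (t * t - 1))).
  have dD : is_derive t (1 : R) D ((1 * t + 1 * t) * (3 * b t ^+ 2)).
    have := is_deriveD (is_derive_cst (1 : R) t (1 : R)) db.
    by move=> h; apply: is_derive_eq h _; rewrite add0r.
  have dV := is_deriveV d0 dD.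
  have := is_deriveM (is_derive_id t (1 : R)) dV.
  move=> h; apply: is_derive_eq h _; rewrite /dc -exprVn expr2.
  by congr (_ + _); rewrite [_ *: _]mulr1.
have bd t : `|dc t| <= 13.
  have d0 : D t != 0 by rewrite gt_eqF// clamp_den_gt0.
  have -> : dc t = (D t - 6 * (t * t) * b t ^+ 2) / (D t * D t).
    by rewrite /dc; field.
  have D0 : 0 < D t by exact: clamp_den_gt0.
  rewrite normrM normfV (gtr0_norm (mulr_gt0 D0 D0)) ler_pdivrMr ?mulr_gt0//.
  have b0 : 0 <= b t by exact: pospart_ge0.
  rewrite ler_norml; move: D0; rewrite /D.
  have [tt|tt] := leP (t * t - 1) 0.
    have -> : b t = 0 by rewrite /b /pospart max_r.
    by rewrite !expr0n /= => _; apply/andP; split; lra.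
  have -> : t * t = b t + 1 by rewrite /b /pospart (max_l (ltW tt)) subrK.
  have b3 : 0 <= b t ^+ 3 by rewrite exprn_ge0.
  have b2 : b t ^+ 2 <= 1 + b t ^+ 3.
    have [b1|b1] := leP (b t) 1.
      by rewrite (le_trans (exprn_ile1 _ b0 b1))// lerDl.
    by rewrite ltW// ltr_pwDl// [leRHS]exprS ler_peMl ?exprn_ge0// ltW.
  have b23 : b t * b t ^+ 2 = b t ^+ 3 by rewrite -exprS.
  have b20 : 0 <= b t ^+ 2 by rewrite exprn_ge0.
  move: (b t) (b t ^+ 2) (b t ^+ 3) b0 b3 b2 b23 b20 => x x2 x3 *.
  by apply/andP; split; nra.
have [r _|r _ E] := @mvt_line R R clamp s' 1 (s - s').
  by case: (der (s' + r *: 1)).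
have sE : s' + (s - s') *: (1 : R) = s by rewrite [_ *: 1]mulr1 addrC subrK.
rewrite sE in E; rewrite E; case: (der (s' + r *: 1)) => _ ->.
by rewrite normrM mulrC ler_wpM2r.
Qed.

End Clamp.

Section ClampRow.
Context {R : realType} {m : nat}.
Implicit Types (c z : 'rV[R]_m).

Definition clamp_row c (rho : R) z : 'rV[R]_m :=
  \row_j (c 0 j + rho * clamp ((z 0 j - c 0 j) / rho)).

Lemma clamp_row_norm c rho z : 0 < rho -> `|clamp_row c rho z - c| <= 2 * rho.
Proof.
move=> r0; apply: row_norm_le => [|j]; first by rewrite mulr_ge0// ltW.
rewrite !mxE addrAC subrr add0r normrM (gtr0_norm r0) mulrC ler_wpM2r ?(ltW r0)//.
exact: clamp_le2.
Qed.

Lemma clamp_row_id c rho z : 0 < rho -> `|z - c| <= rho -> clamp_row c rho z = z.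
Proof.
move=> r0 zc; apply/rowP => j; rewrite mxE clamp_id.
  by rewrite mulrC divfK ?gt_eqF// addrC subrK.
rewrite normrM normfV (gtr0_norm r0) ler_pdivrMr// mul1r (le_trans _ zc)//.
by have := row_norm_ge (z - c) j; rewrite !mxE.
Qed.

Lemma clamp_row_lipschitz c rho z z' : 0 < rho ->
  `|clamp_row c rho z - clamp_row c rho z'| <= 13 * `|z - z'|.
Proof.
move=> r0; apply: row_norm_le => [|j]; first by rewrite mulr_ge0.
rewrite !mxE opprD addrACA subrr add0r -mulrBr normrM (gtr0_norm r0) mulrC.
rewrite -ler_pdivlMr//; apply: le_trans (clamp_lipschitz _ _) _.
have -> : (z 0 j - c 0 j) / rho - (z' 0 j - c 0 j) / rho = (z 0 j - z' 0 j) / rho by ring.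
rewrite -mulrA ler_wpM2l// normrM normfV.
rewrite (gtr0_norm r0) ler_wpM2r ?invr_ge0 ?(ltW r0)//.
by have := row_norm_ge (z - z') j; rewrite !mxE.
Qed.

Lemma csmooth_clamp_row c rho j : csmooth 2 setT (fun z => clamp_row c rho z 0 j).
Proof.
rewrite [X in csmooth _ _ X](_ : _ = (fun z : 'rV[R]_m =>
    c 0 j + rho * clamp ((z 0 j - c 0 j) / rho))); last by apply/funext => z; rewrite mxE.
apply: csmooth_add; [exact: openT|exact: csmooth_cst|].
apply: csmooth_mul; [exact: openT|exact: csmooth_cst|].
apply: csmooth_clamp => //; first exact: openT.
apply: csmooth_mul; [exact: openT| |exact: csmooth_cst].
apply: csmooth_sub; [exact: openT| |exact: csmooth_cst].
by apply: csmooth_coord; exact: openT.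
Qed.

(** The partial derivatives are bounded on the ball, which is convex. *)
Lemma lipschitz_cball (f : 'rV[R]_m -> R) (A : set 'rV[R]_m) c r : open A ->
  csmooth 1 A f -> (forall z, `|z - c| <= r -> A z) ->
  exists2 L, 0 < L & forall z z', `|z - c| <= r -> `|z' - c| <= r ->
    `|f z' - f z| <= L * `|z' - z|.
Proof.
move=> oA sf rA.
have [j B B' BB' BP|j|M M0 MP] := @finite_upper_bound R 'I_m
  (fun j M => forall z, `|z - c| <= r -> `|'D_(delta_mx 0 j) f z| <= M).
- by move=> z /BP /le_trans; exact.
- have [z zr|M M0 MP] := @bounded_cball _ _ ('D_(delta_mx 0 j) f) c r.
    exact: csmooth_continuous (csmoothD j sf) (rA _ zr).
  by exists M.
exists (M * m.+1%:R); first by rewrite mulr_gt0.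
move=> z z' zr z'r.
have cvx s : 0 <= s <= 1 -> `|z + s *: (z' - z) - c| <= r.
  move=> /andP[s0 s1].
  have -> : z + s *: (z' - z) - c = (1 - s) *: (z - c) + s *: (z' - c).
    by apply/rowP => j; rewrite !mxE; ring.
  rewrite (le_trans (ler_normD _ _))// !normrZ.
  have s1' : 0 <= 1 - s by rewrite subr_ge0.
  rewrite (ger0_norm s0) (ger0_norm s1').
  have -> : r = (1 - s) * r + s * r by ring.
  by rewrite lerD// ler_wpM2l.
have dfs s : 0 <= s <= 1 -> differentiable f (z + s *: (z' - z)).
  by move=> /cvx /rA; exact: c1_differentiable.
have zE : z + (z' - z) = z' by rewrite addrC subrK.
have [s s01|s s01] := @mvt_segment _ _ f z (z' - z).
  exact/diff_derivable/dfs.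
rewrite zE => ->.
rewrite derive_diff_sum; last exact: dfs.
apply: le_trans (ler_norm_sum _ _ _) _.
apply: (@le_trans _ _ (\sum_(l < m) `|z' - z| * M)).
  apply: ler_sum => l _; rewrite normrM ler_pM//; first exact: row_norm_ge.
  by apply: MP; exact: cvx.
rewrite sumr_const card_ord -[leLHS]mulr_natr [leRHS]mulrAC [M * _]mulrC.
by rewrite ler_wpM2l ?ler_nat// mulr_ge0// ltW.
Qed.

(** Composing with [clamp_row] turns a function that is regular near [c] into
    one that is regular and Lipschitz everywhere, without changing it near [c]. *)
Lemma cutoff_csmooth (f : 'rV[R]_m -> R) (A : set 'rV[R]_m) c rho : open A -> 0 < rho ->
  csmooth 2 A f -> (forall z, `|z - c| <= 2 * rho -> A z) ->
  csmooth 2 setT (fun z => f (clamp_row c rho z)).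
Proof.
move=> oA r0 sf rA; apply: (csmooth_comp _ oA sf).
- exact: openT.
- by move=> l; exact: csmooth_clamp_row.
- by move=> z _; apply: rA; exact: clamp_row_norm.
Qed.

Lemma cutoff_lipschitz (f : 'rV[R]_m -> R) (A : set 'rV[R]_m) c rho : open A -> 0 < rho ->
  csmooth 2 A f -> (forall z, `|z - c| <= 2 * rho -> A z) ->
  exists2 L, 0 < L & forall z z',
    `|f (clamp_row c rho z') - f (clamp_row c rho z)| <= L * `|z' - z|.
Proof.
move=> oA r0 sf rA.
have [L L0 LP] := lipschitz_cball oA (csmoothW sf) rA.
exists (L * 13); first by rewrite mulr_gt0.
move=> z z'; rewrite (le_trans (LP _ _ _ _)) ?clamp_row_norm//.
by rewrite -mulrA ler_wpM2l ?(ltW L0)// clamp_row_lipschitz.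
Qed.

End ClampRow.

(** * Primitives along rays *)
Section RadialPrimitive.
Context {R : realType} {n : nat}.
Variables (c : 'rV[R]_n) (A : {set 'I_n}) (f : 'I_n -> 'rV[R]_n -> R).
Hypothesis sf : forall i, i \in A -> csmooth 1 setT (f i).

Let Shr (z : 'rV[R]_(1 + n)) : 'rV[R]_n :=
  shrink c A (z 0 (lshift n ord0)) (rsubmx z).

Let integrand (z : 'rV[R]_(1 + n)) : R :=
  \sum_(i in A) (z 0 (rshift 1 i) - c 0 i) * f i (Shr z).

(** The integral over [0, 1] of the form sum_i f_i dx_i along the segment that
    ends at [x]: the candidate primitive of this form in the variables of [A]. *)
Definition radial_primitive (x : 'rV[R]_n) : R :=
  int01 (fun t => \sum_(i in A) (x 0 i - c 0 i) * f i (shrink c A t x)).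

Let csmooth_Shr k j : csmooth k setT (fun z => Shr z 0 j).
Proof. exact: csmooth_shrink. Qed.

Let csmooth_fShr k (g : 'rV[R]_n -> R) : csmooth k setT g ->
  csmooth k setT (fun z => g (Shr z)).
Proof.
move=> sg; apply: (csmooth_comp _ _ sg) => //.
- exact: openT.
- exact: openT.
Qed.

Let csmooth_integrand : csmooth 1 setT integrand.
Proof.
apply: csmooth_sum => [|i iA]; first exact: openT.
apply: csmooth_mul; first exact: openT.
  apply: csmooth_sub; [exact: openT| |exact: csmooth_cst].
  by apply: csmooth_coord; exact: openT.
exact: csmooth_fShr (sf iA).
Qed.

Let ShrE t x : Shr (tcons t x) = shrink c A t x.
Proof. by rewrite /Shr tconsl /tcons row_mxKr. Qed.

Let radialE x : radial_primitive x = int01 (fun t => integrand (tcons t x)).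
Proof.
apply: eq_int01 => t _; apply: eq_bigr => i _.
by rewrite tconsr ShrE.
Qed.

Let tcontinuous (g : 'rV[R]_(1 + n) -> R) x : csmooth 0 setT g ->
  continuous (fun t => g (tcons t x)).
Proof.
move=> sg t; apply: (@continuous_comp _ _ _ (tcons ^~ x) g).
  exact: tcons_continuousl.
exact: csmooth_continuous sg _.
Qed.

Let derive_space k x t : k \in A ->
  is_derive (0 : R) (1 : R) (fun s => integrand (tcons t (x + s *: delta_mx 0 k)))
   (f k (shrink c A t x) + t * \sum_(i in A) (x 0 i - c 0 i) *
      'D_(delta_mx 0 k) (f i) (shrink c A t x)).
Proof.
move=> kA; set e_k : 'rV[R]_n := delta_mx 0 k; set y := shrink c A t x.
have df i : i \in A -> is_derive (0 : R) (1 : R)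
    (fun s => f i (y + (t * s) *: e_k)) (t * 'D_e_k (f i) y).
  move=> iA.
  have der : is_derive (t * 0) (1 : R) (fun s => f i (y + s *: e_k)) ('D_e_k (f i) y).
    rewrite mulr0 -[X in 'D_e_k (f i) X]addr0 -[X in y + X](scale0r e_k).
    by apply: is_derive_line; apply: csmooth_derivable (sf iA) _.
  have dl : is_derive (0 : R) (1 : R) (fun s : R => t * s) t.
    have := is_deriveZ t (is_derive_id (0 : R) (1 : R)).
    by move=> h; apply: is_derive_eq h _; rewrite [_ *: _]mulr1.
  case: dl => dl1 dl2; have := is_derive_comp1 dl1 der.
  by rewrite dl2.
have dc i : is_derive (0 : R) (1 : R) (fun s : R => x 0 i + s * e_k 0 i - c 0 i) (e_k 0 i).
  have h := is_deriveM (is_derive_id (0 : R) (1 : R)) (is_derive_cst (e_k 0 i) (0 : R) (1 : R)).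
  have h2 := is_deriveB (is_deriveD (is_derive_cst (x 0 i) (0 : R) (1 : R)) h) 
     (is_derive_cst (c 0 i) (0 : R) (1 : R)).
  by apply: is_derive_eq h2 _; rewrite scaler0 !add0r subr0 [_ *: 1]mulr1.
have dterm i : i \in A -> is_derive (0 : R) (1 : R)
    (fun s : R => (x 0 i + s * e_k 0 i - c 0 i) * f i (y + (t * s) *: e_k))
    ((x 0 i - c 0 i) * (t * 'D_e_k (f i) y) + f i y * e_k 0 i).
  move=> iA; apply: is_derive_eq (is_deriveM (dc i) (df i iA)) _.
  by rewrite /= mul0r addr0 mulr0 scale0r addr0.
have dsum : is_derive (0 : R) (1 : R)
    (fun s : R => \sum_(i < n)
       if i \in A then (x 0 i + s * e_k 0 i - c 0 i) * f i (y + (t * s) *: e_k) else 0)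
    (\sum_(i < n)
       if i \in A then ((x 0 i - c 0 i) * (t * 'D_e_k (f i) y) + f i y * e_k 0 i) else 0).
  have := @is_derive_sum R R R n
     (fun i s => if i \in A then (x 0 i + s * e_k 0 i - c 0 i) * f i (y + (t * s) *: e_k) else 0)
    0 1
     (fun i => if i \in A then ((x 0 i - c 0 i) * (t * 'D_e_k (f i) y) + f i y * e_k 0 i) else 0).
  rewrite fct_sumE; apply=> i.
  by case: (boolP (i \in A)) => iA; [exact: dterm|exact: is_derive_cst].
have -> : (fun s => integrand (tcons t (x + s *: e_k))) =
   (fun s : R => \sum_(i < n)
       if i \in A then (x 0 i + s * e_k 0 i - c 0 i) * f i (y + (t * s) *: e_k) else 0).
  apply/funext => s; rewrite /integrand [LHS]big_mkcond; apply: eq_bigr => i _.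
  case: ifP => // iA; rewrite tconsr ShrE shrink_delta /tau kA.
  by rewrite [(x + s *: e_k) 0 i]mxE [(s *: e_k) 0 i]mxE.
apply: is_derive_eq dsum _.
rewrite -big_mkcond /= big_split /= addrC; congr (_ + _).
  rewrite (bigD1 k)//= big1 ?addr0; first by rewrite mxE !eqxx mulr1.
  by move=> i /andP[_ ik]; rewrite mxE (negbTE ik) andbF mulr0.
by rewrite mulr_sumr; apply: eq_bigr => i _; rewrite mulrCA.
Qed.

Let derive_space' k x t : k \in A ->
  'D_(delta_mx 0 (rshift 1 k)) integrand (tcons t x) =
   f k (shrink c A t x) + t * \sum_(i in A) (x 0 i - c 0 i) *
      'D_(delta_mx 0 k) (f i) (shrink c A t x).
Proof.
move=> kA; have [_ <-] := derive_space x t kA.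
rewrite /derive; set F := (fun h : R => _); set G := (fun h : R => _).
suff -> : F = G by [].
apply/funext => h; rewrite /F /G /=; congr (_ *: (_ - _)); last first.
  by rewrite scale0r addr0.
by rewrite addr0 [h *: 1]mulr1 tcons_delta addrC.
Qed.

Let derive_time k x t : k \in A ->
  is_derive t (1 : R) (fun s => s * f k (shrink c A s x))
   (f k (shrink c A t x) + t * \sum_(i in A) (x 0 i - c 0 i) *
      'D_(delta_mx 0 i) (f k) (shrink c A t x)).
Proof.
move=> kA.
pose v : 'rV[R]_n := \row_j (if j \in A then x 0 j - c 0 j else 0).
have sE s : shrink c A s x = shrink c A 0 x + s *: v.
  apply/rowP => j; rewrite !mxE /tau; case: (j \in A); ring.
have dfk y : differentiable (f k) y by exact: csmooth_differentiable (sf kA).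
have d1 : is_derive t (1 : R) (fun s => f k (shrink c A s x)) ('D_v (f k) (shrink c A t x)).
  have -> : (fun s => f k (shrink c A s x)) =
      (fun s => f k (shrink c A 0 x + s *: v)) by apply/funext => s; rewrite sE.
  rewrite (sE t); apply: (@is_derive_line _ _ (f k) (shrink c A 0 x) v t).
  exact/diff_derivable.
have := is_deriveM (is_derive_id t (1 : R)) d1.
move=> h; apply: is_derive_eq h _.
rewrite addrC; congr (_ + _); first by rewrite [_ *: _]mulr1.
congr (_ * _); rewrite derive_diff_sum// [RHS]big_mkcond; apply: eq_bigr => i _.
by rewrite mxE; case: ifP => //; rewrite mul0r.
Qed.

(** Differentiating under the integral gives the integral of
    f_k(S_t x) + t sum_i (x_i - c_i) (d_k f_i)(S_t x), while the derivative of
    t f_k(S_t x) in t is f_k(S_t x) + t sum_i (x_i - c_i) (d_i f_k)(S_t x).  The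
    error term is the integral of the rotation of the form. *)
Lemma is_derive_radial_primitive x k : k \in A ->
  is_derive x (delta_mx 0 k) radial_primitive
   (f k x + int01 (fun t => t * \sum_(i in A) (x 0 i - c 0 i) *
      ('D_(delta_mx 0 k) (f i) (shrink c A t x) -
       'D_(delta_mx 0 i) (f k) (shrink c A t x)))).
Proof.
move=> kA; rewrite (funext radialE).
apply: is_derive_eq (int01_derive k x csmooth_integrand) _.
have ct (g : 'rV[R]_n -> R) : csmooth 0 setT g -> continuous (fun t => g (shrink c A t x)).
  move=> sg; have := @tcontinuous (fun z => g (Shr z)) x (csmooth_fShr sg).
  by under eq_fun do rewrite ShrE.
pose dsum (h : 'I_n -> 'rV[R]_n -> R) (t : R) := f k (shrink c A t x) +
   t * \sum_(i in A) (x 0 i - c 0 i) * h i (shrink c A t x).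
have cdsum h : (forall i, i \in A -> csmooth 0 setT (h i)) -> continuous (dsum h).
  move=> sh.
  pose g z := f k (Shr z) + z 0 (lshift n ord0) *
    \sum_(i in A) (x 0 i - c 0 i) * h i (Shr z).
  have -> : dsum h = fun t => g (tcons t x).
    by apply/funext => t; rewrite /dsum /g ShrE tconsl.
  apply: tcontinuous; apply: csmooth_add; first exact: openT.
    by apply: csmooth_fShr; exact: csmoothW (sf kA).
  apply: csmooth_mul; first exact: openT.
    by apply: csmooth_coord; exact: openT.
  apply: csmooth_sum => [|i iA]; first exact: openT.
  apply: csmooth_mul; [exact: openT|exact: csmooth_cst|].
  by apply: csmooth_fShr; exact: sh.
have cd : continuous (dsum (fun i => 'D_(delta_mx 0 i) (f k))).
  by apply: cdsum => i iA; exact: csmoothD (sf kA).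
have -> : f k x = int01 (dsum (fun i => 'D_(delta_mx 0 i) (f k))).
  have dt t := derive_time x t kA.
  rewrite (int01_FTC dt cd) mul0r subr0 mul1r; congr (f k _).
  by apply/rowP => j; rewrite mxE /tau if_same mul1r addrC subrK.
set corr := (fun t : R => t * _ : R).
have cc : continuous corr.
  have c1 := @cdsum (fun i => 'D_(delta_mx 0 k) (f i)) (fun i iA => csmoothD k (sf iA)).
  have -> : corr = (fun t => dsum (fun i => 'D_(delta_mx 0 k) (f i)) t -
      dsum (fun i => 'D_(delta_mx 0 i) (f k)) t).
    apply/funext => t; rewrite /corr /dsum opprD addrACA subrr add0r -mulrBr -sumrB.
    by congr (_ * _); apply: eq_bigr => i _; rewrite mulrBr.
  exact: continuous_sub.
rewrite -(int01D cd cc) /corr.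
apply: eq_int01 => t _; rewrite derive_space'// /dsum -addrA; congr (_ + _).
rewrite -mulrDr -big_split; congr (_ * _); apply: eq_bigr => i _ /=.
by ring.
Qed.

Lemma radial_primitive0 (x : 'rV[R]_n) : (forall i, i \in A -> x 0 i = c 0 i) ->
  radial_primitive x = 0.
Proof.
move=> xc; rewrite -(@int01_cst R 0); apply: eq_int01 => t _.
by rewrite big1// => i iA; rewrite xc// subrr mul0r.
Qed.

End RadialPrimitive.

(** * The chain rule for the right-hand sides *)
Lemma differentiable_row (R : realType) (V : normedModType R) p
    (f : V -> 'rV[R]_p) x :
  (forall l, differentiable (fun y => f y 0 l) x) -> differentiable f x.
Proof.
move=> df.
have -> : f = \sum_(l < p) (fun y => f y 0 l *: (delta_mx 0 l : 'rV[R]_p)).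
  by apply/funext => y; rewrite fct_sumE {1}[f y]row_sum_delta.
by apply: differentiable_sum => l; exact: differentiableZl.
Qed.

Section Arguments.
Context {R : realType} {n : nat} {d : {set 'I_n} -> nat} {II : {set {set 'I_n}}}.
Implicit Types (U V : forall J : {set 'I_n}, 'rV[R]_(d J)) (x : 'rV[R]_n).

Lemma packE (A : {set {set 'I_n}}) U k :
  pack A U 0 k = U (tag (enum_val k)) 0 (tagged (enum_val k)).
Proof. by rewrite mxE. Qed.

Lemma arg_time I i x U j : arg II I i x U 0 (lshift _ j) = x 0 j.
Proof. by rewrite /arg row_mxEl. Qed.

Lemma arg_slot I i x U k : arg II I i x U 0 (rshift n k) =
  U (tag (enum_val k)) 0 (tagged (enum_val k)).
Proof. by rewrite /arg row_mxEr mxE. Qed.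

Lemma slot_mem I i (k : 'I_#|slot d (subI II I i)|) :
  tag (enum_val k) \in subI II I i.
Proof. by have := enum_valP k; rewrite inE. Qed.

Lemma subI_II I i J : J \in subI II I i -> J \in II.
Proof. by rewrite inE => /andP[]. Qed.

Lemma arg_dist I i x x' U U' K : 0 <= K -> `|x - x'| <= K ->
  (forall J, J \in II -> `|U J - U' J| <= K) ->
  `|arg II I i x U - arg II I i x' U'| <= K.
Proof.
move=> K0 xK UK; apply: row_norm_le => // j.
rewrite row_subE; case: (split_ordP j) => k ->.
  rewrite !arg_time (le_trans _ xK)//.
  by rewrite -row_subE row_norm_ge.
rewrite !arg_slot; have /subI_II/UK := slot_mem k; apply: le_trans.
by rewrite -row_subE row_norm_ge.
Qed.

Lemma csmooth_arg k I i p (A : set 'rV[R]_p) (x : 'rV[R]_p -> 'rV[R]_n)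
    (U : 'rV[R]_p -> forall J : {set 'I_n}, 'rV[R]_(d J)) l :
  (forall j, csmooth k A (fun z => x z 0 j)) ->
  (forall J q, csmooth k A (fun z => U z J 0 q)) ->
  csmooth k A (fun z => arg II I i (x z) (U z) 0 l).
Proof.
move=> sx sU; case: (split_ordP l) => {}l ->.
  by under eq_fun do rewrite arg_time.
by under eq_fun do rewrite arg_slot.
Qed.

Lemma is_derive_row (X : normedModType R) p (f : X -> 'rV[R]_p) (g : 'rV[R]_p) (x v : X) :
  (forall l, is_derive x v (fun y => f y 0 l) (g 0 l)) -> is_derive x v f g.
Proof.
move=> df; have df' : derivable f x v.
  by apply/derivable_mxP => i l; rewrite (ord1 i); case: (df l).
split=> //; rewrite derive_mx//; apply/rowP => l; rewrite mxE.
by case: (df l).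
Qed.

Lemma is_derive_row_coord (X : normedModType R) p (f : X -> 'rV[R]_p) (g : 'rV[R]_p) (x v : X) l :
  is_derive x v f g -> is_derive x v (fun y => f y 0 l) (g 0 l).
Proof.
move=> [df <-]; rewrite derive_mx// mxE; apply: derivableP.
by have /derivable_mxP := df; exact.
Qed.

Lemma is_derive_arg I i (U : forall J : {set 'I_n}, 'rV[R]_n -> 'rV[R]_(d J)) x v
    (dU : forall J : {set 'I_n}, 'rV[R]_(d J)) :
  (forall J, J \in subI II I i -> is_derive x v (U J) (dU J)) ->
  is_derive x v (fun y => arg II I i y (U ^~ y)) (row_mx v (pack (subI II I i) dU)).
Proof.
move=> dUP; apply: is_derive_row => l; case: (split_ordP l) => {}l ->.
  rewrite row_mxEl; under eq_fun do rewrite arg_time.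
  exact: is_derive_coord.
rewrite row_mxEr mxE; under eq_fun do rewrite arg_slot.
by apply: is_derive_row_coord; apply: dUP; exact: slot_mem.
Qed.

Lemma is_derive_arg_slot I i J x U (v : 'rV[R]_(d J)) :
  is_derive (U J) v (fun w => arg II I i x (dfwith U J w))
    (row_mx 0 (pack (subI II I i) (dfwith (fun J => 0) J v))).
Proof.
apply: is_derive_row => l; case: (split_ordP l) => {}l ->.
  rewrite row_mxEl mxE; under eq_fun do rewrite arg_time.
  exact: is_derive_cst.
rewrite row_mxEr mxE; under eq_fun do rewrite arg_slot.
move: (enum_val l) => [K k] /=; have [JK|JK] := eqVneq J K.
  subst K; rewrite dfwithin; under eq_fun do rewrite dfwithin.
  exact: is_derive_coord.
rewrite dfwithout// mxE; under eq_fun do rewrite dfwithout//.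
exact: is_derive_cst.
Qed.

Lemma differentiable_arg_slot I i J x U (w : 'rV[R]_(d J)) :
  differentiable (fun w => arg II I i x (dfwith U J w)) w.
Proof.
apply: differentiable_row => l; case: (split_ordP l) => {}l ->.
  under eq_fun do rewrite arg_time.
  exact: differentiable_cst.
under eq_fun do rewrite arg_slot.
move: (enum_val l) => [K q] /=; have [JK|JK] := eqVneq J K.
  subst K; under eq_fun do rewrite dfwithin.
  exact: differentiable_coord.
under eq_fun do rewrite dfwithout//.
exact: differentiable_cst.
Qed.

Lemma dfwith_id U J : dfwith U J (U J) = U.
Proof. by apply: functional_extensionality_dep => K; case: dfwithP. Qed.

Lemma pack_dfwith_sum (A : {set {set 'I_n}}) (V : forall J : {set 'I_n}, 'rV[R]_(d J)) :
  pack A V = \sum_(J in A) pack A (dfwith (fun J => 0) J (V J)).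
Proof.
apply/rowP => k; rewrite summxE packE.
have kA : tag (enum_val k) \in A by have := enum_valP k; rewrite inE.
rewrite (bigD1 (tag (enum_val k)))//= big1 ?addr0.
  by rewrite packE dfwithin.
by move=> J /andP[_ Jk]; rewrite packE dfwithout// mxE.
Qed.

(** The chain rule for [F^I_i(x; U^I_i(x))], in the notation of the
    integrability conditions. *)
Lemma derive_rhs_comp (F : rhs R d II) I i k
    (U : forall J : {set 'I_n}, 'rV[R]_n -> 'rV[R]_(d J)) x :
  differentiable (F I i) (arg II I i x (U ^~ x)) ->
  (forall J, J \in subI II I i -> derivable (U J) x (delta_mx 0 k)) ->
  is_derive x (delta_mx 0 k) (fun y => F I i (arg II I i y (U ^~ y)))
  (rhs_dx F I i k x (U ^~ x) +
   \sum_(J in subI II I i) 'D_(delta_mx 0 k) (U J) x *m rhs_du F I i J x (U ^~ x)).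
Proof.
move=> dF dU; set e_k : 'rV[R]_n := delta_mx 0 k; set z := arg II I i x (U ^~ x).
have chain (X : normedModType R) (Phi : X -> 'rV[R]_(n + #|slot d (subI II I i)|)) y v dPhi :
    differentiable (F I i) (Phi y) -> is_derive y v Phi dPhi ->
    is_derive y v (fun y => F I i (Phi y)) ('d (F I i) (Phi y) dPhi).
  move=> dFy [h1 <-]; rewrite -deriveE//; exact: is_derive_comp_diff.
have dA : is_derive x e_k (fun y => arg II I i y (U ^~ y))
    (row_mx e_k (pack (subI II I i) (fun J => 'D_e_k (U J) x))).
  by apply: is_derive_arg => J JA; apply: derivableP; exact: dU.
have rhs_dxE : rhs_dx F I i k x (U ^~ x) = 'd (F I i) z (row_mx e_k 0).
  have dA1 : is_derive x e_k (fun y => arg II I i y (U ^~ x))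
      (row_mx e_k (pack (subI II I i) (fun J => 0))).
    by apply: (@is_derive_arg I i (fun J _ => U J x)) => J JA; exact: is_derive_cst.
  rewrite /rhs_dx -/e_k.
  have [_ ->] := chain _ (fun y => arg II I i y (U ^~ x)) x e_k _ dF dA1;
     congr ('d _ _ (row_mx _ _)).
  by apply/rowP => l; rewrite packE [LHS]mxE [RHS]mxE.
have du J : 'D_e_k (U J) x *m rhs_du F I i J x (U ^~ x) =
    'd (F I i) z (row_mx 0 (pack (subI II I i) (dfwith (fun=> 0) J ('D_e_k (U J) x)))).
  pose psi w := arg II I i x (dfwith (U ^~ x) J w).
  have zE : psi (U J x) = z by rewrite /psi dfwith_id.
  have dF' : differentiable (F I i) (psi (U J x)) by rewrite zE.
  have dpsi : differentiable psi (U J x) by exact: differentiable_arg_slot.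
  have dcomp : differentiable (fun w => F I i (psi w)) (U J x).
    exact: (@differentiable_comp _ _ _ _ psi (F I i)).
  rewrite /rhs_du -(deriveEjacobian _ dcomp).
  have dA2 := @is_derive_arg_slot I i J x (U ^~ x) ('D_e_k (U J) x).
  by have [_ ->] := chain _ psi _ _ _ dF' dA2; rewrite zE.
apply: is_derive_eq (chain _ (fun y => arg II I i y (U ^~ y)) x e_k _ dF dA) _; rewrite -/z rhs_dxE.
rewrite (eq_bigr _ (fun J _ => du J)) -linear_sum -linearD.
congr ('d _ _ _); rewrite pack_dfwith_sum; set S := \sum_(J in _) _.
have -> : row_mx e_k S = row_mx e_k 0 + row_mx 0 S by rewrite add_row_mx addr0 add0r.
congr (_ + _); rewrite /S.
apply: (big_ind2 (fun a b => row_mx 0 a = b)) => [|a b a' b' <- <-|//].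
  by rewrite row_mx0.
by rewrite add_row_mx addr0.
Qed.

End Arguments.

(** * The integral equation of a Darboux system *)
Section GlobalSystem.
Context {R : realType} {n : nat} {d : {set 'I_n} -> nat} {II : {set {set 'I_n}}}.
Variable c : 'rV[R]_n.

Let T : finType := {J : {set 'I_n} & 'I_(d J)}.

(** A vector listing the values of all unknowns, read as a family. *)
Definition unpack (w : 'rV[R]_#|{: T}|) (J : {set 'I_n}) : 'rV[R]_(d J) :=
  \row_k w 0 (enum_rank (Tagged (fun J : {set 'I_n} => 'I_(d J)) k : T)).

(** The component [a] of the vector of all values belongs to the unknown
    [unknown a], and is its coordinate [component a]. *)
Definition unknown (a : 'I_#|{: T}|) : {set 'I_n} := tag (enum_val a).

Definition component (a : 'I_#|{: T}|) : 'I_(d (unknown a)) := tagged (enum_val a).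

Lemma unpack_norm w w' J : `|unpack w J - unpack w' J| <= `|w - w'|.
Proof.
by apply: row_norm_le => // k; rewrite row_subE !mxE -row_subE row_norm_ge.
Qed.

Variables (G : rhs R d II) (v : forall I : {set 'I_n}, 'rV[R]_#|(~: I)%SET| -> 'rV[R]_(d I)).
Variables (L kappa : R).
Hypothesis L0 : 0 <= L.
Hypothesis kappa0 : 0 < kappa.
Hypothesis csmoothG : forall I i q, I \in II -> i \in I ->
  csmooth 2 setT (fun z => @G I i z 0 q).
Hypothesis lipschitzG : forall I i q z z', I \in II -> i \in I ->
  `|@G I i z' 0 q - @G I i z 0 q| <= L * `|z' - z|.
Hypothesis csmoothv : forall I q, I \in II -> csmooth 2 setT (fun y => @v I y 0 q).
Hypothesis small : n%:R * (2 * kappa) * L <= 1 / 2.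

(** The offset x_i - c_i, made bounded by [2 * kappa]: this bound is what makes
    the integral equation a contraction. *)
Definition clamped_offset (x : 'rV[R]_n) i : R := kappa * clamp ((x 0 i - c 0 i) / kappa).

Lemma clamped_offset_norm x i : `|clamped_offset x i| <= 2 * kappa.
Proof.
rewrite /clamped_offset normrM (gtr0_norm kappa0) mulrC ler_wpM2r ?(ltW kappa0)//.
exact: clamp_le2.
Qed.

Lemma clamped_offset_id x i : `|x - c| <= kappa -> clamped_offset x i = x 0 i - c 0 i.
Proof.
move=> xk; rewrite /clamped_offset clamp_id; first by rewrite mulrC divfK ?gt_eqF.
rewrite normrM normfV (gtr0_norm kappa0) ler_pdivrMr// mul1r (le_trans _ xk)//.
by rewrite -row_subE row_norm_ge.
Qed.

Let N := #|{: T}|.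

(** Components of unknowns outside [II] are solved for as well, trivially, so
    that all components can be treated alike. *)
Definition system_integrand (a : 'I_N) (z : 'rV[R]_(1 + (n + N))) : R :=
  let I := unknown a in let q := component a in
  let t := z 0 (lshift (n + N) ord0) in
  let x : 'rV[R]_n := lsubmx (rsubmx z) in let w : 'rV[R]_N := rsubmx (rsubmx z) in
  if I \in II then
    @v I (xsub (~: I)%SET x) 0 q + \sum_(i in I) clamped_offset x i *
      @G I i (arg II I i (shrink c I t x) (unpack w)) 0 q
  else 0.

Lemma system_integrandE a t x w : unknown a \in II ->
  system_integrand a (pt t x w) =
    @v (unknown a) (xsub (~: unknown a)%SET x) 0 (component a) +
    \sum_(i in unknown a) clamped_offset x i *
    @G (unknown a) i (arg II (unknown a) i (shrink c (unknown a) t x) (unpack w)) 0 (component a).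
Proof.
move=> aII; rewrite /system_integrand aII.
by rewrite tconsl /pt /tcons !row_mxKr row_mxKl.
Qed.

Let csmooth_point k j : csmooth k [set: 'rV[R]_(1 + (n + N))]
  (fun z => (lsubmx (rsubmx z) : 'rV[R]_n) 0 j).
Proof.
rewrite [X in csmooth _ _ X](_ : _ = (fun z : 'rV[R]_(1 + (n + N)) =>
  z 0 (rshift 1 (lshift N j)))); last by apply/funext => z; rewrite !mxE.
by apply: csmooth_coord; exact: openT.
Qed.

Let csmooth_value k j : csmooth k [set: 'rV[R]_(1 + (n + N))]
  (fun z => (rsubmx (rsubmx z) : 'rV[R]_N) 0 j).
Proof.
rewrite [X in csmooth _ _ X](_ : _ = (fun z : 'rV[R]_(1 + (n + N)) =>
  z 0 (rshift 1 (rshift n j)))); last by apply/funext => z; rewrite !mxE.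
by apply: csmooth_coord; exact: openT.
Qed.

Lemma csmooth_system a : csmooth 2 setT (system_integrand a).
Proof.
case: (boolP (unknown a \in II)) => aII; last first.
  rewrite (_ : system_integrand a = fun=> 0); first exact: csmooth_cst.
  by apply/funext => z; rewrite /system_integrand (negbTE aII).
rewrite /system_integrand aII; cbv zeta.
apply: csmooth_add; first exact: openT.
  apply: (@csmooth_comp _ _ _ _ setT setT (fun y => @v (unknown a) y 0 (component a))) => //.
  - exact: openT.
  - exact: openT.
  - exact: csmoothv.
  - move=> l; rewrite /xsub; under eq_fun do rewrite mxE.
    exact: csmooth_point.
apply: csmooth_sum => [|i ia]; first exact: openT.
apply: csmooth_mul; first exact: openT.
  apply: csmooth_mul; [exact: openT|exact: csmooth_cst|].
  apply: csmooth_clamp => //; first exact: openT.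
  apply: csmooth_mul; [exact: openT| |exact: csmooth_cst].
  apply: csmooth_sub; [exact: openT|exact: csmooth_point|exact: csmooth_cst].
apply: (@csmooth_comp _ _ _ _ setT setT (fun y => @G (unknown a) i y 0 (component a))) => //.
- exact: openT.
- exact: openT.
- exact: csmoothG.
move=> l; apply: csmooth_arg => [j|J q]; last first.
  by under eq_fun do rewrite mxE; exact: csmooth_value.
rewrite [X in csmooth _ _ X](_ : _ = (fun z : 'rV[R]_(1 + (n + N)) => c 0 j +
  tau (unknown a) (z 0 (lshift (n + N) ord0)) j * ((lsubmx (rsubmx z) : 'rV[R]_n) 0 j - c 0 j))).
  apply: csmooth_add; [exact: openT|exact: csmooth_cst|].
  apply: csmooth_mul; first exact: openT.
    rewrite /tau; case: (j \in _); last exact: csmooth_cst.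
    by apply: csmooth_coord; exact: openT.
  by apply: csmooth_sub; [exact: openT|exact: csmooth_point|exact: csmooth_cst].
by apply/funext => z; rewrite mxE.
Qed.

Lemma lipschitz_system : lipschitz_in_value (1 / 2) system_integrand.
Proof.
move=> a t x w w' t01; case: (boolP (unknown a \in II)) => aII; last first.
  by rewrite /system_integrand (negbTE aII) subrr normr0 mulr_ge0// divr_ge0.
rewrite !system_integrandE// opprD addrACA subrr add0r -sumrB.
apply: le_trans (ler_norm_sum _ _ _) _.
apply: (@le_trans _ _ (\sum_(i < n) (2 * kappa * (L * `|w - w'|)))).
  rewrite big_mkcond; apply: ler_sum => i _; case: ifP => ia; last first.
    by rewrite !mulr_ge0// ltW.
  rewrite -mulrBr normrM ler_pM ?clamped_offset_norm//.
  apply: (le_trans (lipschitzG _ _ _ aII ia)); rewrite ler_wpM2l//.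
  apply: arg_dist => //; first by rewrite subrr normr0.
  by move=> J _; exact: unpack_norm.
rewrite sumr_const card_ord -[leLHS]mulr_natl !mulrA ler_wpM2r//.
by rewrite -[n%:R * 2 * kappa]mulrA.
Qed.

(** Near [c] the offsets are not clamped, so the integral there is the primitive
    along rays of the right-hand sides evaluated along the solution. *)
Theorem global_solution : exists W : 'rV[R]_n -> 'rV[R]_N,
  (forall a, csmooth 2 [set: 'rV[R]_n] (fun x => W x 0 a)) /\
  (forall I x q, I \in II -> `|x - c| <= kappa ->
    unpack (W x) I 0 q = @v I (xsub (~: I)%SET x) 0 q +
      radial_primitive c I (fun i y => @G I i (arg II I i y (unpack (W y))) 0 q) x).
Proof.
have half0 : 0 <= 1 / 2 :> R by rewrite divr_ge0.
have half1 : 1 / 2 < 1 :> R by lra.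
have cS a : continuous (system_integrand a).
  by move=> z; exact: csmooth_continuous (csmooth_system a) _.
have [W [cW sW]] := @exists_solution R n N c unknown system_integrand (1 / 2) cS
  half0 half1 lipschitz_system.
have W2 := solution_csmooth half0 half1 csmooth_system lipschitz_system cW sW.
exists W; split=> // I x q iII xk.
pose a : 'I_N := enum_rank (Tagged (fun J : {set 'I_n} => 'I_(d J)) q : T).
have -> : unpack (W x) I 0 q = W x 0 a by rewrite mxE.
have aE : enum_val a = Tagged (fun J : {set 'I_n} => 'I_(d J)) q by exact: enum_rankK.
have cI := @integrand_continuous_t R n N c unknown system_integrand W a x (cS a) cW.
have cv := @cst_continuous R R (@v I (xsub (~: I)%SET x) 0 q).
apply/eqP; rewrite addrC -subr_eq -[X in _ - X]int01_cst sW -int01B//; apply/eqP.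
apply: eq_int01 => t t01; rewrite system_integrandE; last by rewrite /unknown aE.
rewrite /unknown /component; move: (enum_val a) aE => s ->/=.
rewrite addrAC subrr add0r; apply: eq_bigr => i iI.
by rewrite clamped_offset_id.
Qed.

End GlobalSystem.

(** * The integral solution satisfies every equation *)
Lemma near_open_ball (R : realType) n (c x : 'rV[R]_n) r : `|x - c| < r ->
  \forall y \near x, `|y - c| < r.
Proof.
move=> xr; apply/nbhs_ballP; exists (r - `|x - c|); first by rewrite /= subr_gt0.
move=> y; rewrite -ball_normE /= distrC => yx.
rewrite -[y - c](subrKA x) (le_lt_trans (ler_normD _ _))//.
by rewrite -ltrBrDr.
Qed.

Lemma xsub_delta (R : realType) n (A : {set 'I_n}) (x : 'rV[R]_n) h k : k \notin A ->
  xsub A (x + h *: delta_mx 0 k) = xsub A x.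
Proof.
move=> kA; apply/rowP => l; rewrite !mxE eqxx /=.
have [E|_] := eqVneq (enum_val l) k; last by rewrite mulr0 addr0.
by have := enum_valP l; rewrite E (negbTE kA).
Qed.

Section Defect.
Context {R : realType} {n : nat} {d : {set 'I_n} -> nat} {II : {set {set 'I_n}}}.
Variables (c : 'rV[R]_n) (G : rhs R d II) (W : 'rV[R]_n -> forall J : {set 'I_n}, 'rV[R]_(d J)).
Variables (v : forall I : {set 'I_n}, 'rV[R]_#|(~: I)%SET| -> 'rV[R]_(d I)).
Variables (L r : R).
Hypothesis L0 : 0 <= L.
Hypothesis r0 : 0 < r.
Hypothesis csmoothG : forall I i q, I \in II -> i \in I ->
  csmooth 2 setT (fun z => @G I i z 0 q).
Hypothesis lipschitzG : forall I i q z z', I \in II -> i \in I ->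
  `|@G I i z' 0 q - @G I i z 0 q| <= L * `|z' - z|.
Hypothesis csmoothU : forall J q, csmooth 2 setT (fun x => W x J 0 q).

Definition rhs_along I i q x : R := @G I i (arg II I i x (W x)) 0 q.
Arguments rhs_along : clear implicits.

Lemma csmooth_rhs_along I i q : I \in II -> i \in I ->
  csmooth 2 setT (rhs_along I i q).
Proof.
move=> iII iI.
apply: (@csmooth_comp _ _ _ _ setT setT (fun z => @G I i z 0 q)) => //.
- exact: openT.
- exact: openT.
- exact: csmoothG.
- move=> l; apply: csmooth_arg => // j.
  by apply: csmooth_coord; exact: openT.
Qed.

Lemma differentiable_rhs I i z : I \in II -> i \in I -> differentiable (@G I i) z.
Proof.
move=> iII iI; apply: differentiable_row => q.
by apply: csmooth_differentiable; apply: csmoothW; exact: csmoothG.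
Qed.

(** A directional derivative of a Lipschitz function is at most the Lipschitz
    constant times the norm of the direction. *)
Lemma rhs_du_bound I i J x U (e : 'rV[R]_(d J)) q : I \in II -> i \in I ->
  `|(e *m rhs_du G I i J x U) 0 q| <= L * `|e|.
Proof.
move=> iII iI; rewrite /rhs_du.
set psi := fun w => arg II I i x (dfwith U J w).
have dcomp : differentiable (fun w => @G I i (psi w)) (U J).
  apply: (@differentiable_comp _ _ _ _ psi (@G I i)).
    exact: differentiable_arg_slot.
  exact: differentiable_rhs.
rewrite -(deriveEjacobian _ dcomp) derive_mx; last exact: diff_derivable.
rewrite mxE; apply: derive_norm_le.
  by have /derivable_mxP := diff_derivable (v := e) dcomp; exact.
move=> h; apply: (le_trans (lipschitzG _ _ _ iII iI)).
rewrite -mulrA ler_wpM2l//; apply: arg_dist.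
- by rewrite mulr_ge0.
- by rewrite subrr normr0 mulr_ge0.
- move=> K _; have [JK|JK] := eqVneq J K.
    by subst K; rewrite !dfwithin addrAC subrr add0r normrZ mulrC.
  by rewrite !dfwithout// subrr normr0 mulr_ge0.
Qed.

Definition defect I i q x : R :=
  'D_(delta_mx 0 i) (fun y => W y I 0 q) x - rhs_along I i q x.
Arguments defect : clear implicits.

Hypothesis integral_eq : forall I q x, I \in II -> `|x - c| < r ->
  W x I 0 q = @v I (xsub (~: I)%SET x) 0 q + radial_primitive c I (fun i => rhs_along I i q) x.

(** The data do not depend on the variables of [I], so only the integral
    contributes to the derivative. *)
Lemma defect_integral I i q x : I \in II -> i \in I -> `|x - c| < r ->
  defect I i q x = int01 (fun t => t * \sum_(j in I) (x 0 j - c 0 j) *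
    ('D_(delta_mx 0 i) (rhs_along I j q) (shrink c I t x) -
     'D_(delta_mx 0 j) (rhs_along I i q) (shrink c I t x))).
Proof.
move=> iII iI xr.
have sf j : j \in I -> csmooth 1 setT (rhs_along I j q).
  by move=> jI; apply: csmoothW; exact: csmooth_rhs_along.
have drad := is_derive_radial_primitive c sf x iI.
have dv : is_derive x (delta_mx 0 i) (fun y => @v I (xsub (~: I)%SET y) 0 q) 0.
  apply: is_derive_eps => e e0; exists 1 => // h _.
  by rewrite xsub_delta ?inE ?iI// subrr mulr0 subr0 normr0 mulr_ge0// ltW.
have dsum := is_deriveD dv drad.
have nearE : \near x, @v I (xsub (~: I)%SET x) 0 q +
    radial_primitive c I (fun i => rhs_along I i q) x = W x I 0 q.
  by apply: filterS (near_open_ball xr) => y yr; rewrite integral_eq.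
have [_ DW] := near_eq_is_derive nearE dsum.
by rewrite /defect DW add0r addrAC subrr add0r.
Qed.

Hypothesis integrable : forall I i j x, I \in II -> i \in I -> j \in I -> i != j ->
  `|x - c| < r -> cross_derivative G I i j x (W x) = cross_derivative G I j i x (W x).

(** Every unknown [J] on which the right-hand side of index [I], [i] depends
    contains [j], so its derivative along [e_j] is the right-hand side plus the
    defect.  The right-hand sides add up to the cross derivative. *)
Lemma derive_rhs_along I i j q x : I \in II -> i \in I -> j \in I -> i != j ->
  'D_(delta_mx 0 j) (rhs_along I i q) x = cross_derivative G I i j x (W x) 0 q +
   \sum_(J in subI II I i) ((\row_p defect J j p x) *m rhs_du G I i J x (W x)) 0 q.
Proof.
move=> iII iI jI ij.
have dW J : derivable (fun y => W y J) x (delta_mx 0 j).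
  apply: derivable_row => l.
  exact: (@csmooth_derivable R n 1 setT (fun y => W y J 0 l) j x (csmoothU l) Logic.I).
have dc := @derive_rhs_comp R n d II G I i j (fun J y => W y J) x
   (differentiable_rhs _ iII iI) (fun J _ => dW J).
have [_ ->] := is_derive_row_coord q dc.
rewrite /cross_derivative !mxE -addrA; congr (_ + _).
rewrite !summxE -big_split; apply: eq_bigr => J JA /=.
rewrite -row_addE -mulmxDl; congr (fun_of_matrix (_ *m _) _ _).
apply/rowP => p; rewrite derive_mx// !mxE /defect /rhs_along.
by rewrite addrC subrK.
Qed.

Hypothesis small : r * (n%:R * (#|II|%:R * L * 2)) <= 1 / 2.

(** The cross derivatives of the two terms agree by integrability; what remains
    is linear in the defects of unknowns of the system. *)
Lemma rotation_bound K I i j q x : 0 <= K ->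
  (forall J k p y, J \in II -> k \in J -> `|y - c| < r -> `|defect J k p y| <= K) ->
  I \in II -> i \in I -> j \in I -> `|x - c| < r ->
  `|'D_(delta_mx 0 i) (rhs_along I j q) x - 'D_(delta_mx 0 j) (rhs_along I i q) x|
  <= #|II|%:R * L * 2 * K.
Proof.
move=> K0 EK iII iI jI xr.
have [->|ij] := eqVneq i j; first by rewrite subrr normr0 !mulr_ge0.
pose S i j := \sum_(J in subI II I i) ((\row_p defect J j p x) *m rhs_du G I i J x (W x)) 0 q.
have SK i' j' : i' \in I -> j' \in I -> i' != j' -> `|S i' j'| <= #|II|%:R * L * K.
  move=> iI' jI' ij'; apply: le_trans (ler_norm_sum _ _ _) _.
  apply: (@le_trans _ _ (\sum_(J in II) L * K)).
    rewrite big_mkcond [leRHS]big_mkcond; apply: ler_sum => J _.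
    case: ifP => JA; last by case: ifP => // _; exact: mulr_ge0.
    rewrite (subI_II JA); apply: (le_trans (rhs_du_bound _ _ _ _ iII iI')).
    rewrite ler_wpM2l//; apply: row_norm_le => // p; rewrite mxE EK//.
      exact: subI_II JA.
    move: JA; rewrite inE => /andP[_ /fintype.subsetP]; apply.
    by rewrite !inE eq_sym ij'.
  by rewrite sumr_const -[leLHS]mulr_natl mulrA.
have ji : j != i by rewrite eq_sym.
have E1 : 'D_(delta_mx 0 i) (rhs_along I j q) x = cross_derivative G I j i x (W x) 0 q + S j i.
  exact: derive_rhs_along.
have E2 : 'D_(delta_mx 0 j) (rhs_along I i q) x = cross_derivative G I i j x (W x) 0 q + S i j.
  exact: derive_rhs_along.
rewrite E1 E2 (integrable iII iI jI ij xr).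
have := SK i j iI jI ij; have := SK j i jI iI ji.
move: (S i j) (S j i) (cross_derivative _ _ _ _ _ _ _ _) => s s' a h1 h2.
have -> : a + s' - (a + s) = s' - s by ring.
rewrite (le_trans (ler_normB _ _))//.
have -> : #|II|%:R * L * 2 * K = #|II|%:R * L * K + #|II|%:R * L * K by ring.
exact: lerD.
Qed.

Lemma defect_contraction K I i q x : 0 <= K ->
  (forall J k p y, J \in II -> k \in J -> `|y - c| < r -> `|defect J k p y| <= K) ->
  I \in II -> i \in I -> `|x - c| < r -> `|defect I i q x| <= 1 / 2 * K + 0.
Proof.
move=> K0 EK iII iI xr; rewrite addr0 defect_integral//.
have sd j k : j \in I -> k \in I ->
    csmooth 0 setT (fun z => 'D_(delta_mx 0 j) (rhs_along I k q) z).
  by move=> jI kI; apply/csmoothD/csmoothW; exact: csmooth_rhs_along.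
apply: int01_norm.
  pose g (z : 'rV[R]_(1 + n)) : R := z 0 (lshift n ord0) * \sum_(j in I) (x 0 j - c 0 j) *
    ('D_(delta_mx 0 i) (rhs_along I j q) (shrink c I (z 0 (lshift n ord0)) (rsubmx z)) -
     'D_(delta_mx 0 j) (rhs_along I i q) (shrink c I (z 0 (lshift n ord0)) (rsubmx z))).
  have sg : csmooth 0 setT g.
    apply: csmooth_mul; first exact: openT.
      by apply: csmooth_coord; exact: openT.
    apply: csmooth_sum => [|j jI]; first exact: openT.
    apply: csmooth_mul; [exact: openT|exact: csmooth_cst|].
    apply: csmooth_sub; first exact: openT.
      apply: (@csmooth_comp _ _ _ _ setT setT ('D_(delta_mx 0 i) (rhs_along I j q))) => //.
      - exact: openT.
      - exact: openT.
      - exact: sd.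
      - by move=> l; exact: csmooth_shrink.
    apply: (@csmooth_comp _ _ _ _ setT setT ('D_(delta_mx 0 j) (rhs_along I i q))) => //.
    - exact: openT.
    - exact: openT.
    - exact: sd.
    - by move=> l; exact: csmooth_shrink.
  have -> : (fun t : R => t * \sum_(j in I) (x 0 j - c 0 j) *
    ('D_(delta_mx 0 i) (rhs_along I j q) (shrink c I t x) -
     'D_(delta_mx 0 j) (rhs_along I i q) (shrink c I t x))) = (fun t => g (tcons t x)).
    apply/funext => t; rewrite /g tconsl; congr (_ * _).
    by rewrite /tcons row_mxKr.
  move=> t; apply: (@continuous_comp _ _ _ (tcons ^~ x) g).
    exact: tcons_continuousl.
  exact: csmooth_continuous sg _.
move=> t t01; set S := \sum_(j in I) _.
have SK : `|S| <= n%:R * (r * (#|II|%:R * L * 2 * K)).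
  apply: le_trans (ler_norm_sum _ _ _) _.
  apply: (@le_trans _ _ (\sum_(j < n) (r * (#|II|%:R * L * 2 * K)))); last first.
    by rewrite sumr_const card_ord -[leLHS]mulr_natl.
  rewrite big_mkcond; apply: ler_sum => j _; case: ifP => jI; last first.
    by rewrite !mulr_ge0// ltW.
  rewrite normrM ler_pM//.
    by rewrite -row_subE (le_trans (row_norm_ge _ _))// ltW.
  apply: rotation_bound => //.
  exact: le_lt_trans (shrink_norm _ _ _ t01) xr.
have /andP[t0 t1] := t01.
rewrite normrM (ger0_norm t0) (le_trans (ler_piMl _ t1))// (le_trans SK)//.
have -> : n%:R * (r * (#|II|%:R * L * 2 * K)) = r * (n%:R * (#|II|%:R * L * 2)) * K by ring.
by rewrite ler_wpM2r.
Qed.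

Theorem defect_eq0 I i q x : I \in II -> i \in I -> `|x - c| < r ->
  'D_(delta_mx 0 i) (fun y => W y I 0 q) x = rhs_along I i q x.
Proof.
move=> iII iI xr.
pose slots : finType := {J : {set 'I_n} & ('I_n * 'I_(d J))%type}.
pose E (s : slots) y := defect (tag s) (tagged s).1 (tagged s).2 y.
have [s B B' BB' BP|s|M M0 MP] := @finite_upper_bound R slots (fun s M => tag s \in II ->
    (tagged s).1 \in tag s -> forall y, `|y - c| <= r -> `|E s y| <= M).
- by move=> s1 s2 y yr; exact: le_trans (BP s1 s2 y yr) BB'.
- case: (boolP (tag s \in II)) => s1; last by exists 0.
  case: (boolP ((tagged s).1 \in tag s)) => s2; last by exists 0.
  have [y _|M M0 MP] := @bounded_cball _ _ (E s) c r.
    apply: (@csmooth_continuous R n 0 setT) => //.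
    apply: csmooth_sub; first exact: openT.
      by apply/csmoothD/csmoothW; exact: csmoothU.
    by apply: csmooth_le (csmooth_rhs_along _ s1 s2).
  by exists M.
pose S (p : slots * 'rV[R]_n) := [/\ tag p.1 \in II, (tagged p.1).1 \in tag p.1 & `|p.2 - c| < r].
pose f (p : slots * 'rV[R]_n) := `|E p.1 p.2|.
have fM p : S p -> f p <= M by move=> [s1 s2 /ltW yr]; exact: MP.
have half1 : 1 / 2 < 1 :> R by rewrite ltr_pdivrMr// mul1r ltr1n.
pose s0 : slots := Tagged (fun J : {set 'I_n} => ('I_n * 'I_(d J))%type) (i, q).
have S0 : S (s0, x) by split.
have := contraction_bound half1 fM (c := 0) _ S0.
rewrite mul0r => h; apply/eqP; rewrite -subr_eq0 -normr_le0; apply: h.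
move=> K KP [s y] [/= s1 s2 yr].
have K0 : 0 <= K by apply: le_trans (KP _ S0); exact: normr_ge0.
apply: defect_contraction => // J k p z JII kJ zr.
exact: (KP (Tagged (fun J : {set 'I_n} => ('I_n * 'I_(d J))%type) (k, p), z)).
Qed.

End Defect.

(** * Uniqueness *)
Section Uniqueness.
Context {R : realType} {n : nat} {d : {set 'I_n} -> nat} {II : {set {set 'I_n}}}.
Variables (c : 'rV[R]_n) (G : rhs R d II).
Variables (U V : 'rV[R]_n -> forall J : {set 'I_n}, 'rV[R]_(d J)).
Variable Ubar : forall J : {set 'I_n}, 'rV[R]_(d J).
Variables (L r rho : R).
Hypothesis L0 : 0 <= L.
Hypothesis rho0 : 0 < rho.
Hypothesis lipschitzG : forall I i q z z', I \in II -> i \in I ->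
  `|@G I i z' 0 q - @G I i z 0 q| <= L * `|z' - z|.

Let N : set 'rV[R]_n := [set x | `|x - c| < r].

Hypothesis openN : open N.
Hypothesis csmoothU : forall J q, J \in II -> csmooth 1 N (fun x => U x J 0 q).
Hypothesis csmoothV : forall J q, J \in II -> csmooth 1 N (fun x => V x J 0 q).
Hypothesis same_data : forall I x, I \in II -> N x ->
  (forall i, i \in I -> x 0 i = c 0 i) -> V x I = U x I.
Hypothesis solU : forall I i q x, I \in II -> i \in I -> N x ->
  'D_(delta_mx 0 i) (fun y => U y I 0 q) x = @G I i (arg II I i x (U x)) 0 q.
Hypothesis solV : forall I i q x, I \in II -> i \in I -> N x ->
  (forall J, J \in II -> `|V x J - Ubar J| <= rho) ->
  'D_(delta_mx 0 i) (fun y => V y I 0 q) x = @G I i (arg II I i x (V x)) 0 q.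
Hypothesis closeU : forall x J, N x -> J \in II -> `|U x J - Ubar J| <= rho / 2.
Hypothesis small : r * (n%:R * L) <= 1 / 2.

Let slots : finType := {J : {set 'I_n} & 'I_(d J)}.

(** Contraction along the segments, on which both solutions have the same
    initial value. *)
Lemma unique_while_close s : s < r ->
  (forall x J, `|x - c| <= s -> J \in II -> `|V x J - Ubar J| <= rho) ->
  forall x J, `|x - c| <= s -> J \in II -> V x J = U x J.
Proof.
move=> sr closeV x J xs JII; apply/rowP => q.
have Ns y : `|y - c| <= s -> N y by move=> ys; exact: le_lt_trans ys sr.
pose S (p : slots * 'rV[R]_n) := tag p.1 \in II /\ `|p.2 - c| <= s.
pose f (p : slots * 'rV[R]_n) := `|V p.2 (tag p.1) 0 (tagged p.1) - U p.2 (tag p.1) 0 (tagged p.1)|.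
have fM p : S p -> f p <= rho + rho / 2.
  move=> [pII ps]; rewrite /f -row_subE (le_trans (row_norm_ge _ _))//.
  rewrite -[V p.2 _ - _](subrKA (Ubar (tag p.1))) (le_trans (ler_normD _ _))//.
  by rewrite lerD// ?closeV// distrC closeU//; exact: Ns.
have half1 : 1 / 2 < 1 :> R by rewrite ltr_pdivrMr// mul1r ltr1n.
pose s0 : slots := Tagged (fun J : {set 'I_n} => 'I_(d J)) q.
have S0 : S (s0, x) by split.
have := contraction_bound half1 fM (c := 0) _ S0.
rewrite mul0r => h; apply/eqP; rewrite -subr_eq0 -normr_le0; apply: h.
move=> K KP [[I p] y] [/= iII ys].
have K0 : 0 <= K by apply: le_trans (KP _ S0); exact: normr_ge0.
have KP' z : `|z - c| <= s -> forall J, J \in II -> `|V z J - U z J| <= K.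
  move=> zs J' J'II; apply: row_norm_le => // q'; rewrite row_subE.
  by apply: (KP (Tagged (fun J : {set 'I_n} => 'I_(d J)) q', z)).
rewrite /f /= addr0.
pose g z := V z I 0 p - U z I 0 p.
have sg : csmooth 1 N g by apply: csmooth_sub => //; [exact: csmoothV|exact: csmoothU].
pose y0 := shrink c I 0 y.
pose v : 'rV[R]_n := \row_j (if j \in I then y 0 j - c 0 j else 0).
have yE t : y0 + t *: v = shrink c I t y.
  by apply/rowP => j; rewrite !mxE /tau; case: (j \in I); ring.
have yt t : 0 <= t <= 1 -> `|y0 + t *: v - c| <= s.
  by move=> t01; rewrite yE (le_trans (shrink_norm _ _ _ t01)).
have y1 : y0 + v = y.
  apply/rowP => j; rewrite !mxE /tau; case: (j \in I); ring.
have dg t : 0 <= t <= 1 -> differentiable g (y0 + t *: v).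
  by move=> /yt/Ns; exact: c1_differentiable.
have [t t01|t t01] := @mvt_segment _ _ g y0 v; first exact/diff_derivable/dg.
have g0 : g y0 = 0.
  have y00 : N y0 by apply: Ns; have := yt 0; rewrite scale0r addr0; apply; rewrite lexx ler01.
  rewrite /g same_data ?subrr// => i iI.
  by rewrite mxE /tau iI mul0r addr0.
rewrite y1 g0 subr0 /g => ->.
rewrite derive_diff_sum; last exact: dg.
have Nt := Ns _ (yt _ t01).
apply: le_trans (ler_norm_sum _ _ _) _.
apply: (@le_trans _ _ (\sum_(l < n) (r * (L * K)))); last first.
  rewrite sumr_const card_ord -[leLHS]mulr_natl.
  have -> : n%:R * (r * (L * K)) = r * (n%:R * L) * K by ring.
  by rewrite ler_wpM2r.
apply: ler_sum => l _; rewrite normrM.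
have r0 : 0 <= r by apply: le_trans (ltW Nt).
rewrite mxE; case: ifP => lI; last by rewrite normr0 mul0r !mulr_ge0.
rewrite ler_pM//.
  by rewrite -row_subE (le_trans (row_norm_ge _ _))// (le_trans ys)// ltW.
have -> : 'D_(delta_mx 0 l) g (y0 + t *: v) =
    @G I l (arg II I l (y0 + t *: v) (V (y0 + t *: v))) 0 p -
    @G I l (arg II I l (y0 + t *: v) (U (y0 + t *: v))) 0 p.
  rewrite -(solU _ iII lI Nt) -(solV _ iII lI Nt); last first.
    by move=> J' J'II; apply: closeV => //; exact: yt.
  apply: deriveB.
    exact: csmooth_derivable (csmoothV p iII) Nt.
  exact: csmooth_derivable (csmoothU p iII) Nt.
apply: (le_trans (lipschitzG _ _ _ iII lI)); rewrite ler_wpM2l//.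
apply: arg_dist => //; first by rewrite subrr normr0.
by apply: KP'; exact: yt.
Qed.

(** [V] solves the modified system only while it stays within [rho] of the base
    value.  Uniform continuity on the closed ball of radius [`|x - c|] provides a
    step by which the radius of the ball of agreement can be increased. *)
Theorem unique_solution x J : N x -> J \in II -> V x J = U x J.
Proof.
move=> Nx; pose s := `|x - c|; move: J.
have Ns y : `|y - c| <= s -> N y by move=> ys; exact: le_lt_trans ys Nx.
have rho2 : 0 < rho / 2 by rewrite divr_gt0.
have [|dl dl0 dlP] := @unif_cont_cball_fin R n slots (fun p y =>
    if tag p \in II then V y (tag p) 0 (tagged p) else 0) c s (rho / 2) _ rho2.
  move=> p z /Ns Nz; case: (boolP (tag p \in II)) => pII.
    exact: csmooth_continuous (csmoothV _ pII) Nz.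
  exact: cst_continuous.
(* The ball on which agreement is proved after [k] steps. *)
pose rk k := Num.min s (k%:R * (dl / 2)).
have dl2 : 0 < dl / 2 by rewrite divr_gt0.
have step k : forall y J, `|y - c| <= rk k -> J \in II -> V y J = U y J.
  elim: k => [|k IH].
    move=> y J; rewrite /rk mul0r le_min => /andP[_]; rewrite normr_le0 subr_eq0.
    move=> /eqP -> JII; apply: same_data => //.
    by apply: Ns; rewrite subrr normr0 /s normr_ge0.
  apply: unique_while_close; first by rewrite /rk gt_min Nx.
  move=> y J; rewrite {1}/rk le_min => /andP[ys yk] JII.
  (* A point of the previous ball close to [y]: [y] itself or its radial
     projection. *)
  have [y' y'k yy'] : exists2 y', `|y' - c| <= rk k & `|y - y'| < dl.
    have [yk'|yk'] := leP `|y - c| (k%:R * (dl / 2)).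
      by exists y; rewrite ?subrr ?normr0// /rk le_min ys.
    have y0 : 0 < `|y - c| by apply: le_lt_trans yk'; rewrite mulr_ge0// ltW.
    pose a := k%:R * (dl / 2) / `|y - c|.
    have a0 : 0 <= a by rewrite !mulr_ge0 ?invr_ge0// ltW.
    have a1 : a <= 1 by rewrite ler_pdivrMr// mul1r ltW.
    have aE : a * `|y - c| = k%:R * (dl / 2) by rewrite /a divfK ?gt_eqF.
    exists (c + a *: (y - c)).
      rewrite addrAC subrr add0r normrZ (ger0_norm a0) aE /rk le_min lexx andbT.
      exact: le_trans (ltW yk') ys.
    have -> : y - (c + a *: (y - c)) = (1 - a) *: (y - c).
      by apply/rowP => j; rewrite !mxE; ring.
    rewrite normrZ ger0_norm ?subr_ge0// mulrBl mul1r aE ltrBlDr.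
    rewrite (le_lt_trans yk)// -natr1 mulrDl mul1r addrC ltrD2r.
    by rewrite ltr_pdivrMr// ltr_pMr// ltr1n.
  have y's : `|y' - c| <= s by rewrite (le_trans y'k)// /rk ge_min lexx.
  rewrite -[V y J - _](subrKA (V y' J)) (le_trans (ler_normD _ _))//.
  rewrite [leRHS](splitr rho) lerD//; last by rewrite (IH _ _ y'k JII) closeU//; exact: Ns.
  apply: row_norm_le => [|q]; first exact: ltW.
  have := dlP (Tagged (fun J : {set 'I_n} => 'I_(d J)) q) _ _ y's yy'.
  by rewrite /= JII row_subE => /ltW.
move=> J; apply: (step (Num.bound (s / (dl / 2)))).
rewrite /rk le_min lexx /= -ler_pdivrMr//.
by apply/ltW/archi_boundP; rewrite divr_ge0 ?normr_ge0// ltW.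
Qed.

End Uniqueness.

(** * Localization and the theorem *)
Lemma open_norm_ball (R : realType) m (c : 'rV[R]_m) r : open [set x | `|x - c| < r].
Proof. by rewrite openE => x xr; exact: near_open_ball. Qed.

Lemma nbhs_norm_ball (R : realType) m (c : 'rV[R]_m) (A : set 'rV[R]_m) : nbhs c A ->
  exists2 r, 0 < r & forall x, `|x - c| < r -> A x.
Proof.
move=> /nbhs_ballP[r /= r0 rA]; exists r => // x xr; apply: rA.
by rewrite -ball_normE /= distrC.
Qed.

Lemma smooth_near_ball (R : realType) m p k (c : 'rV[R]_m) (f : 'rV[R]_m -> 'rV[R]_p) :
  smooth_near k c f -> exists2 r, 0 < r &
    forall q, csmooth k [set x | `|x - c| < r] (fun x => f x 0 q).
Proof.
move=> [A oA sf]; have [r r0 rA] := nbhs_norm_ball (open_nbhs_nbhs oA).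
exists r => // q; apply: csmoothS (smooth_on_csmooth _ _ sf); last by case: oA.
exact: rA.
Qed.

Lemma finite_radius (R : realType) (T : finType) (P : T -> R -> Prop) :
  (forall i d d', d' <= d -> P i d -> P i d') ->
  (forall i, exists2 d, 0 < d & P i d) -> exists2 d, 0 < d & forall i, P i d.
Proof.
move=> mono exP.
have /choice[d dP] i : exists d, 0 < d /\ P i d by have [d d0 dP] := exP i; exists d.
have [d0 d00 d0P] := finite_lower_bound (fun i => (dP i).1).
by exists d0 => // i; apply: mono (d0P i) (dP i).2.
Qed.

Lemma finite_radius2 (R : realType) (S T : finType) (P : S -> T -> R -> Prop) :
  (forall i j d d', d' <= d -> P i j d -> P i j d') ->
  (forall i j, exists2 d, 0 < d & P i j d) ->
  exists2 d, 0 < d & forall i j, P i j d.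
Proof.
move=> mono exP.
have [[i j] d d' /=|[i j] /=|d d0 dP] :=
  @finite_radius R (S * T)%type (fun p => P p.1 p.2).
- exact: mono.
- exact: exP.
- by exists d => // i j; exact: (dP (i, j)).
Qed.

Lemma finite_radius3 (R : realType) (S T X : finType) (P : S -> T -> X -> R -> Prop) :
  (forall i j k d d', d' <= d -> P i j k d -> P i j k d') ->
  (forall i j k, exists2 d, 0 < d & P i j k d) ->
  exists2 d, 0 < d & forall i j k, P i j k d.
Proof.
move=> mono exP.
have [[i j] k d d' /=|[i j] k /=|d d0 dP] :=
  @finite_radius2 R (S * T)%type X (fun p => P p.1 p.2).
- exact: mono.
- exact: exP.
- by exists d => // i j k; exact: (dP (i, j) k).
Qed.

Lemma csmooth_ball_le (R : realType) m k (c : 'rV[R]_m) (f : 'rV[R]_m -> R) r r' :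
  r' <= r -> csmooth k [set x | `|x - c| < r] f -> csmooth k [set x | `|x - c| < r'] f.
Proof. by move=> r'r; apply: csmoothS => x /= xr; exact: lt_le_trans xr r'r. Qed.

Lemma xsub_dist (R : realType) n (A : {set 'I_n}) (x y : 'rV[R]_n) :
  `|xsub A x - xsub A y| <= `|x - y|.
Proof.
by apply: row_norm_le => // k; rewrite row_subE !mxE -row_subE row_norm_ge.
Qed.

Lemma xsub_eqP (R : realType) n (A : {set 'I_n}) (x y : 'rV[R]_n) :
  xsub A x = xsub A y <-> (forall i, i \in A -> x 0 i = y 0 i).
Proof.
split=> [E i iA|E].
  have := congr1 (fun u : 'rV[R]_#|A| => u 0 (enum_rank_in iA i)) E.
  by rewrite !mxE enum_rankK_in.
by apply/rowP => k; rewrite !mxE E// enum_valP.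
Qed.

Section NearEquality.
Context {R : realType} {n : nat} {d : {set 'I_n} -> nat} {II : {set {set 'I_n}}}.

(** The integrability conditions are assumed for [F] and used for its cut-off:
    they only depend on the germ of the right-hand sides. *)
Lemma cross_derivative_near (F G : rhs R d II) I i j x (U : forall J : {set 'I_n}, 'rV[R]_(d J)) :
  (\forall z \near arg II I i x U, F I i z = G I i z) ->
  (forall J, J \in subI II I i -> F J j (arg II J j x U) = G J j (arg II J j x U)) ->
  differentiable (F I i) (arg II I i x U) -> differentiable (G I i) (arg II I i x U) ->
  cross_derivative F I i j x U = cross_derivative G I i j x U.
Proof.
move=> FG FGx dF dG.
have E1 : rhs_dx F I i j x U = rhs_dx G I i j x U.
  apply: near_eq_derive.
  have ca : {for x, continuous (fun y => arg II I i y U)}.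
    apply: (@csmooth_row_continuous _ _ _ 0 setT) => // l.
    apply: csmooth_arg => [k|J q]; last exact: csmooth_cst.
    by apply: csmooth_coord; exact: openT.
  exact: (ca _ FG).
have E2 J : J \in subI II I i ->
    F J j (arg II J j x U) *m rhs_du F I i J x U = G J j (arg II J j x U) *m rhs_du G I i J x U.
  move=> JA; rewrite (FGx J JA).
  set psi := fun w => arg II I i x (dfwith U J w).
  have psiE : psi (U J) = arg II I i x U by rewrite /psi dfwith_id.
  have dpsi : differentiable psi (U J) by exact: differentiable_arg_slot.
  have dcF : differentiable (fun w => F I i (psi w)) (U J).
    have dF' : differentiable (F I i) (psi (U J)) by rewrite psiE.
    exact: (differentiable_comp dpsi dF').
  have dcG : differentiable (fun w => G I i (psi w)) (U J).
    have dG' : differentiable (G I i) (psi (U J)) by rewrite psiE.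
    exact: (differentiable_comp dpsi dG').
  move: (G J j _) => e.
  have eF : e *m rhs_du F I i J x U = 'D_e (fun w => F I i (psi w)) (U J).
    rewrite /rhs_du -(deriveEjacobian _ dcF); reflexivity.
  have eG : e *m rhs_du G I i J x U = 'D_e (fun w => G I i (psi w)) (U J).
    rewrite /rhs_du -(deriveEjacobian _ dcG); reflexivity.
  have cpsi : {for (U J), continuous psi} by exact: differentiable_continuous.
  have FG' : nbhs (psi (U J)) [set z | F I i z = G I i z] by rewrite psiE.
  have eFG : 'D_e (fun w => F I i (psi w)) (U J) = 'D_e (fun w => G I i (psi w)) (U J).
    by apply: near_eq_derive; exact: (cpsi _ FG').
  exact: (etrans eF (etrans eFG (esym eG))).
exact (f_equal2 (fun a b => a + b) E1 (eq_bigr _ E2)).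
Qed.

End NearEquality.

Theorem theorem4p2 (R : realType) (n : nat) (II : {set {set 'I_n}})
    (hII : forall I : {set 'I_n}, I \in II -> I != finset.set0)
    (d : {set 'I_n} -> nat)
    (hd : forall I : {set 'I_n}, I \in II -> (0 < d I)%N)
    (xbar : 'rV[R]_n)
    (B : forall I : {set 'I_n}, set 'rV[R]_#|(~: I)%SET|)
    (ubar : forall I : {set 'I_n}, 'rV[R]_#|(~: I)%SET| -> 'rV[R]_(d I))
    (hB : forall I : {set 'I_n}, I \in II ->
       nbhs (xsub (~: I)%SET xbar) (B I))
    (Ubar : forall I : {set 'I_n}, 'rV[R]_(d I))
    (hUbar : forall I : {set 'I_n}, I \in II ->
       Ubar I = ubar I (xsub (~: I)%SET xbar))
    (D : rhs_dom R d II) (F : rhs R d II)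
    (hDarboux : darboux_system D F xbar Ubar)
    (hF : forall (I : {set 'I_n}) (i : 'I_n), I \in II -> i \in I ->
       smooth_near 2 (arg II I i xbar Ubar) (F I i))
    (hubar : forall I : {set 'I_n}, I \in II ->
       smooth_near 2 (xsub (~: I)%SET xbar) (ubar I)) :
  exists N : set 'rV[R]_n, open_nbhs xbar N /\
    exists U : forall I : {set 'I_n}, 'rV[R]_n -> 'rV[R]_(d I),
      [/\ darboux_solution D F xbar B ubar N U,
          forall I : {set 'I_n}, I \in II -> smooth_on 2 N (U I) &
          forall V : forall I : {set 'I_n}, 'rV[R]_n -> 'rV[R]_(d I),
            darboux_solution D F xbar B ubar N V ->
            (forall I : {set 'I_n}, I \in II -> smooth_on 2 N (V I)) ->
            forall (I : {set 'I_n}) (x : 'rV[R]_n),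
              I \in II -> N x -> V I x = U I x].
Proof.
case: hDarboux => hD hint; pose z0 I i := arg II I i xbar Ubar.
pose y0 (I : {set 'I_n}) := xsub (~: I)%SET xbar.
(* Common radii for the finitely many neighbourhoods: [d1] for the data, [d2]
   for the right-hand sides and [d3] for the integrability conditions. *)
have [d1 d10 d1P] : exists2 d1, 0 < d1 & forall I : {set 'I_n}, I \in II ->
    (forall q, csmooth 2 [set y | `|y - y0 I| < d1] (fun y => ubar I y 0 q)) /\
    (forall y, `|y - y0 I| < d1 -> B I y).
  pose P (I : {set 'I_n}) (r : R) := I \in II ->
    (forall q, csmooth 2 [set y | `|y - y0 I| < r] (fun y => ubar I y 0 q)) /\
    (forall y, `|y - y0 I| < r -> B I y).
  apply: (@finite_radius R _ P) => [I r r' r'r H iII|I].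
    have [h1 h2] := H iII; split=> [q|y yr]; first exact: csmooth_ball_le r'r (h1 q).
    by apply: h2; exact: lt_le_trans yr r'r.
  rewrite /P; case: (boolP (I \in II)) => iII; last by exists 1.
  have [r r0 rP] := smooth_near_ball (hubar _ iII).
  have [s s0 sP] := nbhs_norm_ball (hB _ iII).
  exists (Num.min r s); first by rewrite lt_min r0.
  move=> _; split=> [q|y]; last by rewrite lt_min => /andP[_ /sP].
  by apply: csmooth_ball_le (rP q); rewrite ge_min lexx.
pose P2 (I : {set 'I_n}) (i : 'I_n) (r : R) := I \in II -> i \in I ->
    (forall q, csmooth 2 [set z | `|z - z0 I i| < r] (fun z => F I i z 0 q)) /\
    (forall z, `|z - z0 I i| < r -> D I i z).
have [d2 d20 d2P] : exists2 d2, 0 < d2 & forall I i, P2 I i d2.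
  apply: finite_radius2 => [I i r r' r'r H iII iI|I i].
    have [h1 h2] := H iII iI; split=> [q|y yr]; first exact: csmooth_ball_le r'r (h1 q).
    by apply: h2; exact: lt_le_trans yr r'r.
  rewrite /P2; case: (boolP (I \in II)) => iII; last by exists 1.
  case: (boolP (i \in I)) => iI; last by exists 1.
  have [r r0 rP] := smooth_near_ball (hF _ _ iII iI).
  have [s s0 sP] := nbhs_norm_ball (hD _ _ iII iI).
  exists (Num.min r s); first by rewrite lt_min r0.
  move=> _ _; split=> [q|y]; last by rewrite lt_min => /andP[_ /sP].
  by apply: csmooth_ball_le (rP q); rewrite ge_min lexx.
pose P3 (I : {set 'I_n}) (i j : 'I_n) (r : R) :=
    I \in II -> i \in I -> j \in I -> i != j ->
    forall (x : 'rV[R]_n) (U : forall J : {set 'I_n}, 'rV[R]_(d J)),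
      `|x - xbar| < r -> (forall J, J \in II -> `|U J - Ubar J| < r) ->
      cross_derivative F I i j x U = cross_derivative F I j i x U.
have [d3 d30 d3P] : exists2 d3, 0 < d3 & forall I i j, P3 I i j d3.
  apply: finite_radius3 => [I i j r r' r'r H iII iI jI ij x U xr Ur|I i j].
    exact: (H iII iI jI ij x U (lt_le_trans xr r'r)
      (fun J JII => lt_le_trans (Ur J JII) r'r)).
  case: (boolP [&& I \in II, i \in I, j \in I & i != j]) => [/and4P[iII iI jI ij]|H].
    have [e e0 eP] := hint I i j iII iI jI ij; exists e; first exact: e0.
    move=> _ _ _ _ x U xr Ur; apply: (eP x U); first by rewrite -ball_normE /= distrC.
    by move=> J JII; rewrite -ball_normE /= distrC; exact: Ur.
  exists 1; first exact: ltr01.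
  by move=> h1 h2 h3 h4; case/negP: H; apply/and4P.
(* [clamp_row] at scale [rho] takes its values within [2 * rho], where the
   original functions are regular, and is the identity up to [rho]. *)
pose rho := Num.min (Num.min d1 d2) d3 / 3.
have rho0 : 0 < rho by rewrite divr_gt0// !lt_min d10 d20.
have rhod : 2 * rho < Num.min (Num.min d1 d2) d3.
  have : 0 < Num.min (Num.min d1 d2) d3 by rewrite !lt_min d10 d20.
  by rewrite /rho; move: (Num.min _ _) => e e0; lra.
move: (rhod); rewrite !lt_min => /andP[/andP[rhod1 rhod2] rhod3].
pose G : rhs R d II := fun I i z => F I i (clamp_row (z0 I i) rho z).
pose v (I : {set 'I_n}) y := ubar I (clamp_row (y0 I) rho y).
have GF I i z : `|z - z0 I i| <= rho -> G I i z = F I i z.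
  by move=> zr; rewrite /G clamp_row_id.
have vu I y : `|y - y0 I| <= rho -> v I y = ubar I y.
  by move=> yr; rewrite /v clamp_row_id.
have csG I i q : I \in II -> i \in I -> csmooth 2 setT (fun z => G I i z 0 q).
  move=> iII iI; have [h1 _] := d2P I i iII iI.
  apply: (cutoff_csmooth _ rho0 (h1 q)); first exact: open_norm_ball.
  by move=> z zr; exact: le_lt_trans zr rhod2.
have csv I q : I \in II -> csmooth 2 setT (fun y => v I y 0 q).
  move=> iII; have [h1 _] := d1P I iII.
  apply: (cutoff_csmooth _ rho0 (h1 q)); first exact: open_norm_ball.
  by move=> z zr; exact: le_lt_trans zr rhod1.
have [L L0 LP] : exists2 L, 0 < L & forall p : {I : {set 'I_n} & ('I_n * 'I_(d I))%type},
    tag p \in II -> (tagged p).1 \in tag p -> forall z z',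
    `|G (tag p) (tagged p).1 z' 0 (tagged p).2 - G (tag p) (tagged p).1 z 0 (tagged p).2| <=
       L * `|z' - z|.
  apply: finite_upper_bound => [p M M' MM' H h1 h2 z z'|[I [i q]] /=].
    by apply: (le_trans (H h1 h2 z z')); rewrite ler_wpM2r.
  case: (boolP (I \in II)) => iII; last by exists 0.
  case: (boolP (i \in I)) => iI; last by exists 0.
  have [h1 _] := d2P I i iII iI.
  have [|z zr|L L0 LP] := @cutoff_lipschitz _ _ (fun z => F I i z 0 q) _ (z0 I i) rho _ rho0 (h1 q).
  - exact: open_norm_ball.
  - exact: le_lt_trans zr rhod2.
  - by exists L => _ _ z z'; exact: LP.
have lipG I i q z z' : I \in II -> i \in I ->
    `|G I i z' 0 q - G I i z 0 q| <= L * `|z' - z|.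
  move=> iII iI.
  exact: (LP (Tagged (fun I : {set 'I_n} => ('I_n * 'I_(d I))%type) (i, q)) iII iI).
(* The scale of the offsets: small against the Lipschitz constant, which is why
   the right-hand sides are cut off at the independent scale [rho]. *)
pose kappa := 1 / (4 * n.+1%:R * L).
have kappa0 : 0 < kappa by rewrite divr_gt0// !mulr_gt0.
have kappaP : n%:R * (2 * kappa) * L <= 1 / 2.
  have -> : n%:R * (2 * kappa) * L = n%:R / n.+1%:R * (1 / 2).
    rewrite /kappa; move: (n.+1%:R : R) (ltr0Sn R n) => N N0.
    by field; rewrite (gt_eqF L0) (gt_eqF N0).
  by rewrite ler_piMl ?divr_ge0// ler_pdivrMr// mul1r ler_nat.
have [W0 [csW0 eqW0]] := @global_solution R n d II xbar G v L kappa
   (ltW L0) kappa0 csG lipG csv kappaP.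
pose W x J := unpack (W0 x) J.
have csW J q : csmooth 2 setT (fun x => W x J 0 q).
  rewrite [X in csmooth _ _ X](_ : _ = (fun x => W0 x 0 (enum_rank
    (Tagged (fun J : {set 'I_n} => 'I_(d J)) q)))); first exact: csW0.
  by apply/funext => x; rewrite mxE.
clearbody G v; clear hint hD hubar hB hF.
pose ga I i q x := G I i (arg II I i x (W x)) 0 q.
have eqW I q x : I \in II -> `|x - xbar| <= kappa ->
    W x I 0 q = v I (xsub (~: I)%SET x) 0 q + radial_primitive xbar I (fun i => ga I i q) x.
  by move=> iII xk; exact: eqW0.
have Wbar J : J \in II -> W xbar J = Ubar J.
  move=> JII; apply/rowP => q.
  rewrite eqW ?subrr ?normr0 ?(ltW kappa0)// radial_primitive0// addr0.
  by rewrite vu ?subrr ?normr0 ?(ltW rho0)// hUbar.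
have rho2 : 0 < rho / 2 by rewrite divr_gt0.
have [r1 r10 r1P] : exists2 r1, 0 < r1 & forall x J, `|x - xbar| < r1 -> J \in II ->
    `|W x J - Ubar J| <= rho / 2.
  have cW0 : {for xbar, continuous W0}.
    by apply: (@csmooth_row_continuous _ _ _ 2 setT) => // l; exact: csW0.
  have /(@continuous_epsP R 'rV[R]_n 'rV[R]_#|_|) /(_ _ rho2)[r1 r10 r1P] := cW0.
  exists r1 => // x J xr JII; rewrite -(Wbar J JII).
  exact: le_trans (unpack_norm _ _ _) (r1P x xr).
(* The final radius keeps the solution within [rho / 2] of the base value and
   makes contractions of the two homogeneous estimates, for the defect and for
   the difference of two solutions; [C] is the sum of their constants. *)
pose C := n%:R * (#|II|%:R * L * 2) + n%:R * L.
have C1 : 0 <= n%:R * (#|II|%:R * L * 2) by rewrite !mulr_ge0// ltW.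
have C2 : 0 <= n%:R * L by rewrite !mulr_ge0// ltW.
have C0 : 0 <= C by rewrite addr_ge0.
have C10 : 0 < 2 * (1 + C) by rewrite mulr_gt0// ltr_pwDl.
pose r2 := 1 / (2 * (1 + C)).
have r20 : 0 < r2 by rewrite divr_gt0.
have r2P c : 0 <= c -> c <= C -> r2 * c <= 1 / 2.
  move=> c0 cC; rewrite /r2 mul1r mulrC ler_pdivrMr//.
  by rewrite mulrA divfK// mul1r (le_trans cC)// lerDr.
pose r := Num.min (Num.min kappa (rho / 2)) (Num.min r1 r2).
have r0 : 0 < r by rewrite /r !lt_min kappa0 rho2 r10 r20.
have rk : r <= kappa by rewrite /r !ge_min lexx.
have rr : r <= rho / 2 by rewrite /r !ge_min lexx orbT.
have rr1 : r <= r1 by rewrite /r !ge_min lexx !orbT.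
have rr2 : r <= r2 by rewrite /r !ge_min lexx !orbT.
have small1 : r * (n%:R * (#|II|%:R * L * 2)) <= 1 / 2.
  by apply: le_trans (ler_wpM2r C1 rr2) (r2P _ C1 _); rewrite lerDl.
have small2 : r * (n%:R * L) <= 1 / 2.
  by apply: le_trans (ler_wpM2r C2 rr2) (r2P _ C2 _); rewrite lerDr.
clearbody r C r2 kappa rho; clear r2P C0 C1 C2 C10 r20 rr2 kappaP.
have rrho : rho / 2 < rho by rewrite ltr_pdivrMr// ltr_pMr// ltr1n.
have rhod1' : rho < d1 by lra.
have rhod2' : rho < d2 by lra.
have rhod3' : rho < d3 by lra.
have argW I i x : `|x - xbar| < r -> `|arg II I i x (W x) - z0 I i| <= rho / 2.
  move=> xr; apply: arg_dist; first exact: ltW.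
    exact: le_trans (ltW xr) rr.
  by move=> J JII; apply: r1P => //; exact: lt_le_trans xr rr1.
have nearFG I i z : `|z - z0 I i| < rho -> \forall z' \near z, F I i z' = G I i z'.
  move=> zr; apply: filterS (near_open_ball zr) => z' z'r.
  by rewrite GF// ltW.
have diffF I i z : I \in II -> i \in I -> `|z - z0 I i| < d2 -> differentiable (F I i) z.
  move=> iII iI zr; have [h1 _] := d2P I i iII iI.
  apply: differentiable_row => q.
  pose A : set 'rV[R]_(n + #|slot d (subI II I i)|) := [set z | `|z - z0 I i| < d2].
  exact: (@c1_differentiable R _ A (fun z => F I i z 0 q) z
    (@open_norm_ball R _ (z0 I i) d2)
    (csmoothW (h1 q)) zr).
have crossFG I i j x : I \in II -> i \in I -> j \in I -> i != j -> `|x - xbar| < r ->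
    cross_derivative F I i j x (W x) = cross_derivative G I i j x (W x).
  move=> iII iI jI ij xr.
  have az := argW I i x xr.
  apply: cross_derivative_near.
  - exact: nearFG (le_lt_trans az rrho).
  - move=> J JA; rewrite GF//.
    exact: le_trans (argW J j x xr) (ltW rrho).
  - by apply: diffF => //; exact: le_lt_trans az (lt_trans rrho rhod2').
  - exact: (differentiable_rhs csG).
have intG I i j x : I \in II -> i \in I -> j \in I -> i != j -> `|x - xbar| < r ->
    cross_derivative G I i j x (W x) = cross_derivative G I j i x (W x).
  move=> iII iI jI ij xr.
  have ji : j != i by rewrite eq_sym.
  rewrite -(crossFG I i j x iII iI jI ij xr) -(crossFG I j i x iII jI iI ji xr).
  apply: (d3P I i j iII iI jI ij x (W x)).
    exact: lt_trans (lt_le_trans xr rr) (lt_trans rrho rhod3').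
  move=> J JII; apply: le_lt_trans (r1P x J (lt_le_trans xr rr1) JII) _.
  exact: lt_trans rrho rhod3'.
have eqWr I q x : I \in II -> `|x - xbar| < r ->
    W x I 0 q = v I (xsub (~: I)%SET x) 0 q + radial_primitive xbar I (fun i => ga I i q) x.
  by move=> iII xr; apply: eqW => //; exact: le_trans (ltW xr) rk.
have solG I i q x : I \in II -> i \in I -> `|x - xbar| < r ->
    'D_(delta_mx 0 i) (fun y => W y I 0 q) x = G I i (arg II I i x (W x)) 0 q.
  exact: (@defect_eq0 R n d II xbar G W v L r (ltW L0) r0 csG lipG csW eqWr intG small1 I i q x).
have center : `|xbar - xbar| < r by rewrite subrr normr0.
exists [set x | `|x - xbar| < r]; split.
  by split; [exact: open_norm_ball|exact: center].
have FG I i x (V : forall J : {set 'I_n}, 'rV[R]_(d J)) : `|x - xbar| < r ->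
    (forall J, J \in II -> `|V J - Ubar J| <= rho) ->
    G I i (arg II I i x V) = F I i (arg II I i x V).
  move=> xr VU; apply: GF; apply: arg_dist => //; first exact: ltW.
  exact: le_trans (ltW xr) (le_trans rr (ltW rrho)).
have Wrho x J : `|x - xbar| < r -> J \in II -> `|W x J - Ubar J| <= rho.
  move=> xr JII; apply: le_trans (ltW rrho).
  by apply: r1P => //; exact: lt_le_trans xr rr1.
have y0r I x : `|x - xbar| < r -> `|xsub (~: I)%SET x - y0 I| <= rho.
  move=> xr; apply: le_trans (xsub_dist _ _ _) _.
  exact: le_trans (ltW xr) (le_trans rr (ltW rrho)).
have dataW I x : I \in II -> `|x - xbar| < r -> (forall i, i \in I -> x 0 i = xbar 0 i) ->
    W x I = ubar I (xsub (~: I)%SET x).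
  move=> iII xr xI; apply/rowP => q.
  by rewrite eqWr// radial_primitive0// addr0 vu// y0r.
exists (fun I x => W x I); split.
- split=> [I i x iII iI xr|I x iII xr /xsub_eqP xI].
  + have az := argW I i x xr.
    have [_ DP] := d2P I i iII iI.
    have dW : derivable (fun y => W y I) x (delta_mx 0 i).
      apply: derivable_row => q.
      exact: (@csmooth_derivable R n 1 setT (fun y => W y I 0 q) i x (csW I q) Logic.I).
    split; first by apply: DP; exact: le_lt_trans az (lt_trans rrho rhod2').
      exact: dW.
    apply/rowP => q; rewrite (derive_mx dW) mxE solG//.
    by rewrite FG// => J JII; exact: Wrho.
  + have [_ BP] := d1P I iII.
    split; last exact: dataW.
    by apply: BP; exact: le_lt_trans (y0r I x xr) rhod1'.
- move=> I iII; apply: csmooth_smooth_on => [|q]; first exact: open_norm_ball.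
  exact: csmoothS (@subsetT _ _) (csW I q).
- move=> V [Vsol Vdata] Vsmooth I x iII xr.
  pose V' x J := V J x.
  have csV J q : J \in II -> csmooth 1 [set x | `|x - xbar| < r] (fun x => V' x J 0 q).
    move=> JII; apply: csmoothW.
    by apply: smooth_on_csmooth (Vsmooth J JII); exact: open_norm_ball.
  have csW' J q : J \in II -> csmooth 1 [set x | `|x - xbar| < r] (fun x => W x J 0 q).
    by move=> _; exact: csmoothS (@subsetT _ _) (csmoothW (csW J q)).
  have same J y : J \in II -> `|y - xbar| < r -> (forall i, i \in J -> y 0 i = xbar 0 i) ->
      V' y J = W y J.
    move=> JII yr yJ; rewrite dataW//.
    by have [_] := Vdata J y JII yr ((xsub_eqP J y xbar).2 yJ).
  have solV J i q y : J \in II -> i \in J -> `|y - xbar| < r ->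
      (forall K, K \in II -> `|V' y K - Ubar K| <= rho) ->
      'D_(delta_mx 0 i) (fun z => V' z J 0 q) y = G J i (arg II J i y (V' y)) 0 q.
    move=> JII iJ yr yV; have [_ dV DV] := Vsol J i y JII iJ yr.
    by rewrite FG// -DV derive_mx// mxE.
  have closeW y J : `|y - xbar| < r -> J \in II -> `|W y J - Ubar J| <= rho / 2.
    by move=> yr JII; apply: r1P => //; exact: lt_le_trans yr rr1.
  exact: (@unique_solution R n d II xbar G W V' Ubar L r rho (ltW L0) rho0 lipG
    (@open_norm_ball R n xbar r) csW' csV same solG solV closeW small2 x I xr iII).
Qed.
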